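(* Let $M_t$, $t\in[0,T)$, be a family of smooth closed strictly convex surfaces in $\mathbb{R}^3$ flowing according to $\frac{d}{dt}X=-H^2\nu$. Then $$\max_{M_t}\frac{(\lambda_1+\lambda_2)^3(\lambda_1-\lambda_2)^2}{2(\lambda_1^2+\lambda_2^2)\lambda_1\lambda_2}$$ is non-increasing in time.
   Context: A closed surface is a compact connected embedded surface without boundary. $X=X(x,t)$ is the (smooth) embedding vector of $M_t$ into $\mathbb{R}^3$, $\frac{d}{dt}X$ its total time derivative, and $\nu$ the outer unit normal to $M_t$. The principal curvatures $\lambda_1,\lambda_2$ are the eigenvalues of the second fundamental form with respect to the induced metric, with sign such that round spheres have positive principal curvatures. A surface is strictly convex if all its principal curvatures are strictly positive. $H=\lambda_1+\lambda_2$. *)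

(* Defs.v *)
From HB Require Import structures.
From mathcomp Require Import all_boot all_order all_algebra.
From mathcomp Require Import all_classical all_reals all_analysis.
Set Implicit Arguments.
Unset Strict Implicit.
Unset Printing Implicit Defensive.
Import Order.TTheory GRing.Theory Num.Theory.
Import numFieldNormedType.Exports.
Local Open Scope classical_set_scope.
Local Open Scope ring_scope.

(* ** Differentiability relative to a set *)

(* [df] is a differential at [x] of the restriction of [f] to [D].  It is
   unique for the sets [D] used below: open sets, and products of an open set
   with the interval from 0 (included) to T, where it is one-sided in time at
   time 0. *)
Definition diff_within (R : realType) (E F : normedModType R)
    (D : set E) (f : E -> F) (x : E) (df : {linear E -> F}) : Prop :=
  continuous df /\
  forall eps : R, 0 < eps ->
    \forall y \near within D (nbhs x),
      `|f y - f x - df (y - x)| <= eps * `|y - x|.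

(* For finite-dimensional [E], [x |-> df x] is of class C^k as a map into the
   linear maps iff [x |-> df x v] is so for every [v]. *)
Fixpoint Ck_on (R : realType) (E F : normedModType R) (k : nat)
    (D : set E) (f : E -> F) : Prop :=
  if k is k'.+1 then
    exists df : E -> {linear E -> F},
      (forall x, D x -> diff_within D f x (df x)) /\
      (forall v, Ck_on k' D (fun x => df x v))
  else {within D, continuous f}.

Definition smooth_on (R : realType) (E F : normedModType R)
    (D : set E) (f : E -> F) : Prop := forall k, Ck_on k D f.

(* ** Closed surfaces *)

(* [cmap] only matters on [cdom], and [cinv] only on [cimg]. *)
Record chart (R : realType) (M : topologicalType) := Chart {
  cdom : set M;
  cmap : M -> 'rV[R]_2;
  cinv : 'rV[R]_2 -> M
}.

Definition cimg (R : realType) (M : topologicalType) (c : chart R M) :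
  set 'rV[R]_2 := cmap c @` cdom c.

Definition is_chart (R : realType) (M : topologicalType) (c : chart R M) : Prop :=
  [/\ open (cdom c), open (cimg c),
      forall x, cdom c x -> cinv c (cmap c x) = x,
      {within cdom c, continuous (cmap c)} &
      {within cimg c, continuous (cinv c)}].

Definition smooth_atlas (R : realType) (M : topologicalType)
    (A : set (chart R M)) : Prop :=
  [/\ forall c, A c -> is_chart c,
      forall x, exists2 c, A c & cdom c x &
      forall c d, A c -> A d ->
        smooth_on (cmap c @` (cdom c `&` cdom d)) (cmap d \o cinv c)].

Definition closed_surface (R : realType) (M : topologicalType)
    (A : set (chart R M)) : Prop :=
  [/\ [set: M] !=set0, hausdorff_space M, compact [set: M],
      connected [set: M] & smooth_atlas A].

(* ** Geometry of surfaces in R^3 *)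

(* The library norm on ['rV_3] is the sup norm; it is used for the topology
   only, and lengths and angles come from [dot]. *)
Definition dot (R : realType) (n : nat) (u v : 'rV[R]_n) : R :=
  \sum_(i < n) u 0 i * v 0 i.

Definition local_rep (R : realType) (M : topologicalType) (c : chart R M)
    (f : M -> 'rV[R]_3) : 'rV[R]_2 -> 'rV[R]_3 := f \o cinv c.

(* As [M] is compact, an injective immersion is a homeomorphism onto its
   image. *)
Definition smooth_embedding (R : realType) (M : topologicalType)
    (A : set (chart R M)) (f : M -> 'rV[R]_3) : Prop :=
  [/\ injective f,
      forall c, A c -> smooth_on (cimg c) (local_rep c f) &
      forall c u, A c -> cimg c u -> injective ('d (local_rep c f) u)].

(* The unbounded components of the complement of [S]; a connected component
   taken at a point of [S] itself is empty here, hence bounded. *)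
Definition exterior (R : realType) (S : set 'rV[R]_3) : set 'rV[R]_3 :=
  [set y | ~ bounded_set (connected_component (~` S) y)].

Definition outer_unit_normal (R : realType) (M : topologicalType)
    (A : set (chart R M)) (f : M -> 'rV[R]_3) (x : M) (n : 'rV[R]_3) : Prop :=
  [/\ dot n n = 1,
      forall c, A c -> cdom c x ->
        forall v, dot ('d (local_rep c f) (cmap c x) v) n = 0 &
      \forall s \near 0^'+, exterior (range f) (f x + s *: n)].

Definition basis_vec (R : realType) (i : 'I_2) : 'rV[R]_2 := delta_mx 0 i.

Definition first_form (R : realType) (F : 'rV[R]_2 -> 'rV[R]_3)
    (u : 'rV[R]_2) : 'M[R]_2 :=
  \matrix_(i, j) dot ('D_(basis_vec R i) F u) ('D_(basis_vec R j) F u).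

(* With [n] the outer normal, the sign makes round spheres have positive
   principal curvatures. *)
Definition second_form (R : realType) (F : 'rV[R]_2 -> 'rV[R]_3)
    (n : 'rV[R]_3) (u : 'rV[R]_2) : 'M[R]_2 :=
  \matrix_(i, j)
    - dot ('D_(basis_vec R i) (fun v => 'D_(basis_vec R j) F v) u) n.

(* [l1] and [l2] are the eigenvalues, with multiplicity and in either order,
   of the second form with respect to the first. *)
Definition principal_curvatures (R : realType) (M : topologicalType)
    (A : set (chart R M)) (f : M -> 'rV[R]_3) (x : M) (n : 'rV[R]_3)
    (l1 l2 : R) : Prop :=
  forall c, A c -> cdom c x ->
    char_poly (invmx (first_form (local_rep c f) (cmap c x)) *m
               second_form (local_rep c f) n (cmap c x)) =
    ('X - l1%:P) * ('X - l2%:P).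

(* ** Families of surfaces *)

(* [X x t] is the embedding vector; the surface at time [t] is the range of
   [X ^~ t]. *)
Definition smooth_family (R : realType) (M : topologicalType)
    (A : set (chart R M)) (T : R) (X : M -> R -> 'rV[R]_3) : Prop :=
  (forall c, A c ->
     smooth_on (cimg c `*` `[0, T[)
       (fun p : 'rV[R]_2 * R => X (cinv c p.1) p.2)) /\
  (forall t : R, t \in `[0, T[ -> smooth_embedding A (X ^~ t)).

(* The time derivative of [X x] at [t] (one-sided at [t = 0]) is [V]. *)
Definition time_derivative (R : realType) (T : R) (X : R -> 'rV[R]_3)
    (t : R) (V : 'rV[R]_3) : Prop :=
  (fun h : R => h^-1 *: (X (t + h) - X t)) @
    within [set h | t + h \in `[0, T[] 0^' --> V.

Definition is_max (R : realType) (S : set R) (m : R) : Prop :=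
  S m /\ ubound S m.

(* Main.v *)
Require Import Defs.
From HB Require Import structures.
From mathcomp Require Import all_boot all_order all_algebra.
From mathcomp Require Import all_classical all_reals all_analysis.
From mathcomp Require Import ring lra.
Import Order.TTheory GRing.Theory Num.Theory.
Import numFieldNormedType.Exports.
Local Open Scope classical_set_scope.
Local Open Scope ring_scope.
Set Implicit Arguments.
Unset Strict Implicit.
Unset Printing Implicit Defensive.

(** Write [w = pinch l1 l2] for the quantity of the theorem.  It is symmetric
    in the two principal curvatures and homogeneous of degree one, and for
    positive curvatures it is nonnegative and vanishes exactly at umbilic
    points.

    The maximum principle.  If the maximum of [w] over the surface were larger
    at a time [t2] than at an earlier time [t1], then for a small [eps > 0] the
    function [w - eps * t] on the compact product of the surface with [[t1, t2]]
    would have its maximum at a time [t0 > t1].  There [w] is positive, so the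
    point is not umbilic; it is a spatial maximum of [w]; and [w] grows in time
    at least with speed [eps] ([max_nonincreasing]).  The contradiction comes
    from a local fact: at a spatial maximum where [l1 <> l2], the time
    derivative of [w] is at most zero ([local_speed]).  Since [t0 > 0], that
    fact is only needed at interior times; at time 0 the continuity of [w] is
    enough ([pinching_cont]).

    The local fact.  Near a point that is not umbilic the ordered curvatures
    are smooth and there are smooth orthonormal fields [E1], [E2] of principal
    directions ([smooth_principal_frame]).  They act, like the time derivative
    [Dt], as derivations of the ring of smooth functions.  The matrix [Q] with
    rows [E1 F], [E2 F] and the normal is orthogonal, so each derivation [d]
    has a skew connection matrix with [d Q = connection d Q *m Q], and
    computing the commutators of two derivations on [Q] gives a zero curvature
    equation.  Its entries are, for [phi = (l1 + l2) ^ 2],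
      - Codazzi: [E2 l1 = a (l1 - l2)] and [E1 l2 = b (l2 - l1)];
      - Gauss: [E1 b + E2 a = a ^ 2 + b ^ 2 + l1 l2];
      - evolution: [Dt l1 = E1 E1 phi - a E2 phi + phi l1 ^ 2], and likewise
        for [l2]
    ([structure_equations]).  At a critical point of [w] the difference
    [Dt w - 2 (l1 + l2) (E1 E1 w + E2 E2 w)] contains the second derivatives of
    the curvatures only through [E1 E1 l2 - E2 E2 l1], which the Gauss equation
    turns into terms of lower order.  There remain a reaction term, which is
    minus an explicit positive quantity ([reaction_term]), and for each
    principal direction the square of one free gradient component times a
    coefficient that is at most zero ([gradient_term]).  At a spatial maximum both [Ei Ei w]
    are at most zero, hence so is [Dt w] ([critical_point_inequality],
    [pinching_speed_le0]).

    The normal.  A unit normal is the normalised cross product of the coordinate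
    fields up to a sign that might jump.  Convexity excludes this: the mean
    curvature is positive, so the sign is that of the mean curvature computed
    with the cross product, which never vanishes.  This yields formulas for the
    normal and for the symmetric functions of the curvatures in terms of the
    derivatives of the embedding ([curvatures_from_cross]), and with them both
    the smoothness used in the local fact and the continuity up to time 0. *)

(** * The pinching function and the inequality at a critical point *)

Section Pinching.
Context {R : realFieldType}.
Implicit Types x y p q r : R.

(** Positive on positive arguments, so that [pinch_x x y] has the sign of [x - y]. *)
Definition pinch_slope x y : R :=
  2 * x ^+ 4 - x ^+ 3 * y + 7 * (x ^+ 2 * y ^+ 2) - x * y ^+ 3 + y ^+ 4.

(** The partial derivative of [pinch] in its first argument; by symmetry
    [pinch_x y x] is the one in the second argument. *)
Definition pinch_x x y : R :=
  (x + y) ^+ 2 * (x - y) * pinch_slope x y / (2 * (x ^+ 2 + y ^+ 2) ^+ 2 * x ^+ 2 * y).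

Definition pinch x y : R :=
  (x + y) ^+ 3 * (x - y) ^+ 2 / (2 * (x ^+ 2 + y ^+ 2) * x * y).

(** The Hessian of [pinch] on a vector [(p, q)] that the differential of [pinch]
    annihilates.  With [pinch = N / D], differentiating [pinch * D = N] twice
    gives this formula plus mixed terms that contain the differential of
    [pinch] as a factor. *)
Definition pinch_hess x y p q : R :=
  ((6 * (x + y) * (x - y) ^+ 2 + 12 * (x + y) ^+ 2 * (x - y) + 2 * (x + y) ^+ 3
     - pinch x y * (12 * (x * y))) * p ^+ 2
   + 2 * (6 * (x + y) * (x - y) ^+ 2 - 2 * (x + y) ^+ 3
     - pinch x y * (6 * (x ^+ 2 + y ^+ 2))) * (p * q)
   + (6 * (x + y) * (x - y) ^+ 2 - 12 * (x + y) ^+ 2 * (x - y) + 2 * (x + y) ^+ 3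
     - pinch x y * (12 * (x * y))) * q ^+ 2)
  / (2 * (x ^+ 2 + y ^+ 2) * x * y).

(** Up to a positive factor, minus the coefficient of a squared gradient
    component; the monomials are grouped so that the negative ones sit inside
    definite quadratic forms. *)
Definition gradient_coef x y : R :=
  y ^+ 11 * (5 * y ^+ 2 - 19 * (x * y) + 19 * x ^+ 2)
  + x ^+ 2 * y ^+ 9 * (69 * y ^+ 2 - 52 * (x * y) + 20 * x ^+ 2)
  + (345 * (x ^+ 4 * y ^+ 9) + 81 * (x ^+ 5 * y ^+ 8) + 504 * (x ^+ 6 * y ^+ 7)
     + 640 * (x ^+ 7 * y ^+ 6) + 79 * (x ^+ 8 * y ^+ 5))
  + x ^+ 9 * y ^+ 2 * (319 * y ^+ 2 - 16 * (x * y) + x ^+ 2)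
  + x ^+ 11 * (51 * y ^+ 2 - x * y + 3 * x ^+ 2).

(** Completing the square. *)
Lemma quadratic_ge0 (a b c : R) x y : 0 < a -> b ^+ 2 <= 4 * a * c ->
  0 <= a * x ^+ 2 - b * (x * y) + c * y ^+ 2.
Proof.
move=> a0 hb; have a4 : 0 < 4 * a by rewrite mulr_gt0.
rewrite -(pmulr_rge0 _ a4).
have -> : 4 * a * (a * x ^+ 2 - b * (x * y) + c * y ^+ 2) =
  (2 * a * x - b * y) ^+ 2 + (4 * a * c - b ^+ 2) * y ^+ 2 by ring.
by rewrite addr_ge0 ?sqr_ge0 // mulr_ge0 ?sqr_ge0 ?subr_ge0.
Qed.

Lemma gradient_coef_ge0 x y : 0 < x -> 0 < y -> 0 <= gradient_coef x y.
Proof.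
move=> x0 y0; have x0' := ltW x0; have y0' := ltW y0.
have xn n : 0 <= x ^+ n by rewrite exprn_ge0.
have yn n : 0 <= y ^+ n by rewrite exprn_ge0.
have q1 := @quadratic_ge0 5 19 19 y x; have q2 := @quadratic_ge0 69 52 20 y x.
have q3 := @quadratic_ge0 319 16 1 y x; have q4 := @quadratic_ge0 51 1 3 y x.
rewrite !mul1r ![y * x]mulrC in q1 q2 q3 q4.
by rewrite /gradient_coef !addr_ge0 ?mulr_ge0 ?ler0n ?xn ?yn // ?q1 ?q2 ?q3 ?q4 //; lra.
Qed.

Lemma pinch_slope_gt0 x y : 0 < x -> 0 < y -> 0 < pinch_slope x y.
Proof.
move=> x0 y0.
have -> : pinch_slope x y = x ^+ 2 * (2 * x ^+ 2 - x * y + y ^+ 2) +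
   (5 * (x ^+ 2 * y ^+ 2)) + y ^+ 2 * (x ^+ 2 - x * y + y ^+ 2) by rewrite /pinch_slope; ring.
have h2 : 0 < x ^+ 2 * y ^+ 2 by rewrite mulr_gt0 ?exprn_gt0.
have h1 : 0 <= x ^+ 2 * (2 * x ^+ 2 - x * y + y ^+ 2).
  have := @quadratic_ge0 2 1 1 x y; rewrite !mul1r => q1.
  by rewrite mulr_ge0 ?sqr_ge0 // q1 //; lra.
have h3 : 0 <= y ^+ 2 * (x ^+ 2 - x * y + y ^+ 2).
  have := @quadratic_ge0 1 1 1 x y; rewrite !mul1r => q1.
  by rewrite mulr_ge0 ?sqr_ge0 // q1 //; lra.
by apply: ltr_wpDr h3 _; apply: ltr_wpDl h1 _; rewrite mulr_gt0.
Qed.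

(** The terms without derivatives of the curvatures: [phi l1 ^ 2] and
    [phi l2 ^ 2] from the evolution equations, and [l1 l2] from the Gauss
    equation. *)
Lemma reaction_term x y : 0 < x -> 0 < y ->
  (x + y) ^+ 2 * (pinch_x x y * x ^+ 2 + pinch_x y x * y ^+ 2)
  - 2 * (x + y) * (pinch_x x y - pinch_x y x) * ((x - y) * (x * y))
  = - (2 * (x + y) ^+ 4 * (x - y) ^+ 2 * (x * y) / (x ^+ 2 + y ^+ 2) ^+ 2).
Proof.
move=> x0 y0; rewrite /pinch_x /pinch_slope; field.
by rewrite ?gt_eqF ?addr_gt0 ?exprn_gt0.
Qed.

(** Here [p] and [q] are the derivatives of the two curvatures along the second
    principal direction, and the factor [r] parametrises the solutions of the
    critical point equation.  The quotients by [x - y] come from the Codazzi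
    equation, which gives the connection coefficient [p / (x - y)].  The first
    direction follows by exchanging [x] and [y]. *)
Lemma gradient_term x y r : 0 < x -> 0 < y -> x != y ->
  let p := x * pinch_slope y x * r in let q := y * pinch_slope x y * r in
  2 * pinch_x y x * (p + q) ^+ 2
  - 2 * (x + y) * pinch_x x y * (p / (x - y)) * (p + q)
  - 2 * (x + y) * pinch_hess x y p q
  + 2 * (x + y) * (pinch_x x y - pinch_x y x) * ((p * q - 2 * p ^+ 2) / (x - y))
  = - ((x + y) ^+ 3 * gradient_coef x y / ((x ^+ 2 + y ^+ 2) ^+ 2 * y ^+ 2) * r ^+ 2).
Proof.
move=> x0 y0; rewrite -subr_eq0 => d0 p q.
rewrite /p /q /pinch_hess /pinch /pinch_x /pinch_slope /gradient_coef; field.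
by rewrite ?d0 ?gt_eqF ?addr_gt0 ?exprn_gt0.
Qed.

(** What is left of the derivative of [pinch * D = N] after clearing the
    denominator [D]. *)
Lemma pinch_xE x y : 0 < x -> 0 < y ->
  3 * (x + y) ^+ 2 * (x - y) ^+ 2 + 2 * (x + y) ^+ 3 * (x - y)
  - pinch x y * (6 * x ^+ 2 * y + 2 * y ^+ 3)
  = pinch_x x y * (2 * (x ^+ 2 + y ^+ 2) * x * y).
Proof.
move=> x0 y0; rewrite /pinch /pinch_x /pinch_slope; field.
by rewrite ?gt_eqF ?addr_gt0 ?exprn_gt0.
Qed.

Lemma pinch_ge0 x y : 0 <= x -> 0 <= y -> 0 <= pinch x y.
Proof.
move=> x0 y0; apply: divr_ge0; first by rewrite mulr_ge0 ?sqr_ge0 // exprn_ge0 // addr_ge0.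
by rewrite mulr_ge0 // mulr_ge0 // mulr_ge0 // addr_ge0 // sqr_ge0.
Qed.

Lemma pinchC x y : pinch x y = pinch y x.
Proof. by rewrite /pinch; congr (_ / _); ring. Qed.

Lemma pinch_hessC x y p q : pinch_hess x y p q = pinch_hess y x q p.
Proof. by rewrite /pinch_hess (pinchC y x); congr (_ / _); ring. Qed.

(** As [pinch_slope] is positive, every solution of the critical point equation
    has the form parametrised in [gradient_term]. *)
Lemma critical_direction x y p q : 0 < x -> 0 < y -> x != y ->
  pinch_x x y * p + pinch_x y x * q = 0 ->
  2 * pinch_x y x * (p + q) ^+ 2
  - 2 * (x + y) * pinch_x x y * (p / (x - y)) * (p + q)
  - 2 * (x + y) * pinch_hess x y p q
  + 2 * (x + y) * (pinch_x x y - pinch_x y x) * ((p * q - 2 * p ^+ 2) / (x - y)) <= 0.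
Proof.
move=> x0 y0 xy hc.
have P0 := pinch_slope_gt0 x0 y0; have P0' := pinch_slope_gt0 y0 x0.
pose r := p / (x * pinch_slope y x).
have pE : p = x * pinch_slope y x * r by rewrite /r; field; rewrite ?gt_eqF.
have s0 : 0 < x + y by rewrite addr_gt0.
have d0 : x - y != 0 by rewrite subr_eq0.
have qE : q = y * pinch_slope x y * r.
  have k0 : (x + y) ^+ 2 * (x - y) * pinch_slope y x != 0.
    by rewrite !mulf_neq0 ?expf_neq0 // gt_eqF.
  apply: (mulfI k0).
  have : pinch_x x y * p + pinch_x y x * q =
     ((x + y) ^+ 2 * (x - y) * pinch_slope y x * (y * pinch_slope x y * r) -
      (x + y) ^+ 2 * (x - y) * pinch_slope y x * q) / (2 * (x ^+ 2 + y ^+ 2) ^+ 2 * x * y ^+ 2).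
    rewrite pE /pinch_x; field.
    by rewrite ?gt_eqF ?addr_gt0 ?exprn_gt0.
  rewrite hc => /esym/eqP; rewrite mulf_eq0 invr_eq0 => /orP[|].
    by rewrite subr_eq0 => /eqP ->.
  by rewrite gt_eqF // !mulr_gt0 ?exprn_gt0 ?addr_gt0 ?exprn_gt0.
have := gradient_term r x0 y0 xy; rewrite /= -pE -qE => ->.
rewrite oppr_le0 mulr_ge0 ?sqr_ge0 // divr_ge0 ?mulr_ge0 ?gradient_coef_ge0 ?exprn_ge0 ?addr_ge0 ?exprn_ge0 // ltW //.
Qed.

(** In the application [x], [y] are the curvatures, [p1], [q1] their derivatives
    along [E1] and [p2], [q2] those along [E2], [X11], [Y11], [X22], [Y22] their
    iterated derivatives, [a] and
    [b] the connection coefficients with derivatives [a2 = E2 a] and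
    [b1 = E1 b], and [xt], [yt] the time derivatives.  Subtracting
    [2 (x + y)] times the two second order conditions removes [X11] and [Y22]
    and leaves [Y11] and [X22] only in [Y11 - X22], which the Gauss equation
    expresses through the gradient. *)
Lemma critical_point_inequality x y (p1 p2 q1 q2 X11 X22 Y11 Y22 a b a2 b1 xt yt : R) :
  0 < x -> 0 < y -> x != y ->
  pinch_x x y * p1 + pinch_x y x * q1 = 0 ->
  pinch_x x y * p2 + pinch_x y x * q2 = 0 ->
  pinch_x x y * X11 + pinch_x y x * Y11 + pinch_hess x y p1 q1 <= 0 ->
  pinch_x x y * X22 + pinch_x y x * Y22 + pinch_hess x y p2 q2 <= 0 ->
  p2 = a * (x - y) -> q1 = b * (y - x) ->
  X22 = a2 * (x - y) + a * (p2 - q2) -> Y11 = b1 * (y - x) + b * (q1 - p1) ->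
  b1 + a2 = a * a + b * b + x * y ->
  xt = 2 * (p1 + q1) ^+ 2 + 2 * (x + y) * (X11 + Y11)
       - a * (2 * (x + y) * (p2 + q2)) + (x + y) ^+ 2 * (x * x) ->
  yt = 2 * (p2 + q2) ^+ 2 + 2 * (x + y) * (X22 + Y22)
       - b * (2 * (x + y) * (p1 + q1)) + (x + y) ^+ 2 * (y * y) ->
  pinch_x x y * xt + pinch_x y x * yt <= 0.
Proof.
move=> x0 y0 xy hc1 hc2 w11 w22 p2E q1E X22E Y11E gauss xtE ytE.
have d0 : x - y != 0 by rewrite subr_eq0.
have d0' : y - x != 0 by rewrite subr_eq0 eq_sym.
have yx : y != x by rewrite eq_sym.
have s0 : 0 < 2 * (x + y) by rewrite mulr_gt0 ?addr_gt0.
have g2 := critical_direction x0 y0 xy hc2.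
have hc1' : pinch_x y x * q1 + pinch_x x y * p1 = 0 by rewrite addrC.
have g1 := critical_direction y0 x0 yx hc1'.
rewrite -pinch_hessC in g1.
have g0 := reaction_term x0 y0.
have n0 : - (2 * (x + y) ^+ 4 * (x - y) ^+ 2 * (x * y) / (x ^+ 2 + y ^+ 2) ^+ 2) <= 0.
  rewrite oppr_le0 divr_ge0 ?sqr_ge0 // mulr_ge0 ?(mulr_ge0 (ltW x0) (ltW y0)) //.
  by rewrite mulr_ge0 ?sqr_ge0 // mulr_ge0 // exprn_even_ge0.
rewrite -g0 in n0.
have l1 := mulr_ge0_le0 (ltW s0) w11; have l2 := mulr_ge0_le0 (ltW s0) w22.
have b1E : b1 = a * a + b * b + x * y - a2 by rewrite -gauss addrK.
have aE : a = p2 / (x - y) by rewrite p2E mulfK.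
have bE : b = q1 / (y - x) by rewrite q1E mulfK.
have key : pinch_x x y * xt + pinch_x y x * yt =
  ((x + y) ^+ 2 * (pinch_x x y * x ^+ 2 + pinch_x y x * y ^+ 2)
    - 2 * (x + y) * (pinch_x x y - pinch_x y x) * ((x - y) * (x * y)))
  + (2 * pinch_x y x * (p2 + q2) ^+ 2
  - 2 * (x + y) * pinch_x x y * (p2 / (x - y)) * (p2 + q2)
  - 2 * (x + y) * pinch_hess x y p2 q2
  + 2 * (x + y) * (pinch_x x y - pinch_x y x) * ((p2 * q2 - 2 * p2 ^+ 2) / (x - y)))
  + (2 * pinch_x x y * (q1 + p1) ^+ 2
  - 2 * (y + x) * pinch_x y x * (q1 / (y - x)) * (q1 + p1)
  - 2 * (y + x) * pinch_hess x y p1 q1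
  + 2 * (y + x) * (pinch_x y x - pinch_x x y) * ((q1 * p1 - 2 * q1 ^+ 2) / (y - x)))
  + 2 * (x + y) * (pinch_x x y * X11 + pinch_x y x * Y11 + pinch_hess x y p1 q1)
  + 2 * (x + y) * (pinch_x x y * X22 + pinch_x y x * Y22 + pinch_hess x y p2 q2).
  rewrite xtE ytE X22E Y11E b1E aE bE.
  move: (pinch_x x y) (pinch_x y x) (pinch_hess x y p1 q1) (pinch_hess x y p2 q2).
  move=> A B C D; field.
  by rewrite d0 d0'.
rewrite key; lra.
Qed.

End Pinching.

(** * Moving frames over a differential ring *)

Section DifferentialRing.
Context {A : comNzRingType}.

Definition derivation (d : A -> A) : Prop :=
  (forall f g, d (f + g) = d f + d g) /\
  (forall f g, d (f * g) = d f * g + f * d g).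

(** The matrix [O] with [d Q = O *m Q] when the rows of [Q] are orthonormal. *)
Definition connection (d : A -> A) n (Q : 'M[A]_n) : 'M[A]_n := map_mx d Q *m Q^T.

Section OneDerivation.
Variables (d : A -> A) (hd : derivation d).

Lemma derivD f g : d (f + g) = d f + d g. Proof. exact: hd.1. Qed.
Lemma derivM f g : d (f * g) = d f * g + f * d g. Proof. exact: hd.2. Qed.

Lemma deriv0 : d 0 = 0.
Proof. by apply: (addrI (d 0)); rewrite -derivD !addr0. Qed.

Lemma deriv1 : d 1 = 0.
Proof. have := derivM 1 1; rewrite !mulr1 mul1r => e; by apply: (addrI (d 1)); rewrite addr0 -e. Qed.

Lemma derivN f : d (- f) = - d f.
Proof. by apply: (addrI (d f)); rewrite -derivD !subrr deriv0. Qed.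

Lemma deriv_nat n : d n%:R = 0.
Proof. by elim: n => [|n IH]; rewrite ?deriv0 // -natr1 derivD IH deriv1 addr0. Qed.

Lemma deriv_sum (I : Type) (r : seq I) (P : pred I) (F : I -> A) :
  d (\sum_(i <- r | P i) F i) = \sum_(i <- r | P i) d (F i).
Proof. exact: (big_morph d derivD deriv0). Qed.

Lemma deriv_mulmx m n p (P : 'M[A]_(m, n)) (Q : 'M[A]_(n, p)) :
  map_mx d (P *m Q) = map_mx d P *m Q + P *m map_mx d Q.
Proof.
apply/matrixP => i j; rewrite !mxE deriv_sum -big_split; apply: eq_bigr => k _.
by rewrite derivM !mxE.
Qed.

Lemma connectionE n (Q : 'M[A]_n) : Q *m Q^T = 1%:M ->
  map_mx d Q = connection d Q *m Q.
Proof. by move=> /mulmx1C oQ; rewrite /connection -mulmxA oQ mulmx1. Qed.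

(** The derivative of [Q *m Q^T = 1] vanishes. *)
Lemma connection_skew n (Q : 'M[A]_n) i j : Q *m Q^T = 1%:M ->
  connection d Q i j = - connection d Q j i.
Proof.
move=> oQ; apply/eqP; rewrite -addr_eq0; apply/eqP.
have /matrixP/(_ i j) := deriv_mulmx Q Q^T.
rewrite oQ !mxE => e; apply: etrans (etrans (esym e) _).
  congr (_ + _); apply: eq_bigr => k _; by rewrite !mxE mulrC.
by case: (i == j); rewrite ?deriv0 ?deriv1.
Qed.

Lemma connection_diag n (Q : 'M[A]_n) i : (forall f : A, f + f = 0 -> f = 0) ->
  Q *m Q^T = 1%:M -> connection d Q i i = 0.
Proof. by move=> h2 /(connection_skew i i) e; apply: h2; rewrite {1}e addNr. Qed.

End OneDerivation.

Lemma derivation_lincomb (d d' : A -> A) (x y : A) : derivation d -> derivation d' ->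
  derivation (fun f => x * d f + y * d' f).
Proof.
move=> hd hd'; split=> f g; first by rewrite (derivD hd) (derivD hd'); ring.
by rewrite (derivM hd) (derivM hd'); ring.
Qed.

Lemma connection_lincomb (d d' : A -> A) (x y : A) n (Q : 'M[A]_n) :
  connection (fun f => x * d f + y * d' f) Q =
  x *: connection d Q + y *: connection d' Q.
Proof.
rewrite /connection !scalemxAl -mulmxDl; congr (_ *m _).
by apply/matrixP => i j; rewrite !mxE.
Qed.

(** Both sides compute the commutator of [d] and [d'] on [Q]: directly on the
    right, through the connection matrices on the left. *)
Lemma zero_curvature (d d' dc : A -> A) n (Q : 'M[A]_n) :
  derivation d -> derivation d' -> Q *m Q^T = 1%:M ->
  (forall f, d (d' f) - d' (d f) = dc f) ->
  let O := connection d Q in let O' := connection d' Q in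
  map_mx d O' - map_mx d' O + (O' *m O - O *m O') = connection dc Q.
Proof.
move=> hd hd' oQ hc O O'.
have -> : connection dc Q =
    (map_mx d (map_mx d' Q) - map_mx d' (map_mx d Q)) *m Q^T.
  by congr (_ *m _); apply/matrixP => i j; rewrite !mxE hc.
rewrite (connectionE _ oQ) (connectionE d oQ) -/O -/O'.
rewrite (deriv_mulmx hd) (deriv_mulmx hd') (connectionE _ oQ).
rewrite (connectionE d' oQ) -/O -/O' !mulmxA -[RHS]/(_ *m _).
rewrite mulmxBl !mulmxDl -!mulmxA oQ !mulmx1.
by rewrite opprD addrACA.
Qed.

End DifferentialRing.

(** The frame [Q] has the rows [E1 F], [E2 F] and a unit normal, [E1] and [E2] are
    principal directions, and [F] moves with normal speed [- phi].  As the normal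
    points outwards, the normal component of [Ei Ei F] is minus a curvature. *)
Section MovingFrame.
Context {A : comNzRingType}.
Variables (E1 E2 Dt : A -> A).
Hypotheses (hE1 : derivation E1) (hE2 : derivation E2) (hDt : derivation Dt).
Hypothesis two_reg : forall f : A, f + f = 0 -> f = 0.
Variables (c1 c2 s11 s12 s21 s22 : A).
Hypothesis E12 : forall f, E1 (E2 f) - E2 (E1 f) = c1 * E1 f + c2 * E2 f.
Hypothesis Dt1 : forall f, Dt (E1 f) - E1 (Dt f) = s11 * E1 f + s12 * E2 f.
Hypothesis Dt2 : forall f, Dt (E2 f) - E2 (Dt f) = s21 * E1 f + s22 * E2 f.
Variables (F : 'I_3 -> A) (Q : 'M[A]_3) (l1 l2 phi : A).
Hypothesis oQ : Q *m Q^T = 1%:M.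
Let i0 : 'I_3 := 0.
Let i1 : 'I_3 := 1.
Let i2 : 'I_3 := 2.
Hypothesis Q0 : forall k, Q i0 k = E1 (F k).
Hypothesis Q1 : forall k, Q i1 k = E2 (F k).
Hypothesis Ft : forall k, Dt (F k) = - (phi * Q i2 k).
Let O1 := connection E1 Q.
Let O2 := connection E2 Q.
Let Ot := connection Dt Q.
Hypothesis h11 : O1 i0 i2 = - l1.
Hypothesis h12 : O1 i1 i2 = 0.
Hypothesis h21 : O2 i0 i2 = 0.
Hypothesis h22 : O2 i1 i2 = - l2.

(* coordinates with respect to the orthonormal rows of [Q] are unique *)
Let row_inj (u v : 'I_3 -> A) :
  (forall k, \sum_m u m * Q m k = \sum_m v m * Q m k) -> u =1 v.
Proof.
move=> h m.
have : (\row_m u m) *m Q = (\row_m v m) *m Q.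
  by apply/rowP => k; rewrite !mxE; under eq_bigr do rewrite mxE;
     rewrite h; under [RHS]eq_bigr do rewrite mxE.
move=> /(congr1 (mulmx^~ Q^T)); rewrite -!mulmxA oQ !mulmx1 => /rowP/(_ m).
by rewrite !mxE.
Qed.

Let sum3 (u : 'I_3 -> A) : \sum_m u m = u i0 + u i1 + u i2.
Proof.
rewrite !big_ord_recl big_ord0 addr0 addrA; congr (_ + u _ + u _); exact: val_inj.
Qed.

(* the coordinates of [x E1 F + y E2 F + z nu] *)
Let pick3 (x y z : A) (m : 'I_3) := if m == i0 then x else if m == i1 then y else z.

Let dQ d (hd : derivation d) i k :
  d (Q i k) = \sum_m connection d Q i m * Q m k.
Proof. by have /matrixP/(_ i k) := connectionE d oQ; rewrite !mxE. Qed.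

(** Applied to [F] itself, the commutator of [E1] and [E2] compares two rows of
    connection matrices. *)
Lemma frame_commutator : c1 = - O1 i0 i1 /\ c2 = O2 i1 i0.
Proof.
have : (fun m => O1 i1 m - O2 i0 m) =1 pick3 c1 c2 0.
  apply: row_inj => k; rewrite [RHS]sum3 /pick3 /= mul0r addr0 Q0 Q1 -E12 -Q0 -Q1.
  rewrite (dQ hE1) (dQ hE2) -sumrB; apply: eq_bigr => m _; by rewrite mulrBl.
move=> h; have := h i0; have := h i1; rewrite /pick3 /=.
rewrite (connection_diag hE1 _ two_reg oQ) (connection_diag hE2 _ two_reg oQ).
rewrite /O1 /O2 [connection E2 Q i0 i1](connection_skew hE2 _ _ oQ).
rewrite [connection E1 Q i1 i0](connection_skew hE1 _ _ oQ).
by rewrite sub0r opprK subr0.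
Qed.

(** The same with [Dt F = - phi nu]; the normal components give the motion of the
    normal, the tangential ones the stretching of the frame. *)
Lemma frame_commutator_t :
  [/\ s11 = phi * l1, s22 = phi * l2, s12 = Ot i0 i1 , s21 = Ot i1 i0 &
  Ot i0 i2 = - E1 phi /\ Ot i1 i2 = - E2 phi].
Proof.
have h : (fun m => Ot i0 m + (pick3 0 0 (E1 phi) m + phi * O1 i2 m)) =1 pick3 s11 s12 0.
  apply: row_inj => k; rewrite [RHS]sum3 /pick3 /= mul0r addr0 Q0 Q1 -Dt1 -Q0 Ft.
  rewrite (derivN hE1) (derivM hE1) (dQ hDt) (dQ hE1) opprK.
  by rewrite !sum3 -/Ot -/O1 /=; ring.
have h' : (fun m => Ot i1 m + (pick3 0 0 (E2 phi) m + phi * O2 i2 m)) =1 pick3 s21 s22 0.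
  apply: row_inj => k; rewrite [RHS]sum3 /pick3 /= mul0r addr0 Q0 Q1 -Dt2 -Q1 Ft.
  rewrite (derivN hE2) (derivM hE2) (dQ hDt) (dQ hE2) opprK.
  by rewrite !sum3 -/Ot -/O2 /=; ring.
have sk1 : forall i j, O1 i j = - O1 j i by move=> i j; apply: connection_skew.
have sk2 : forall i j, O2 i j = - O2 j i by move=> i j; apply: connection_skew.
have d1 : forall i, O1 i i = 0 by move=> i; apply: connection_diag.
have d2 : forall i, O2 i i = 0 by move=> i; apply: connection_diag.
have dt : forall i, Ot i i = 0 by move=> i; apply: connection_diag.
have := h i0; have := h i1; have := h i2; have := h' i0; have := h' i1; have := h' i2.
rewrite /pick3 /= !dt (sk1 i2 i0) (sk1 i2 i1) h11 h12 (sk2 i2 i0) (sk2 i2 i1) h21 h22 d1 d2.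
rewrite !oppr0 !opprK !mulr0 !addr0 !add0r => + <- <- + <- <-.
by move=> /eqP; rewrite addr_eq0 => /eqP -> /eqP; rewrite addr_eq0 => /eqP ->.
Qed.

(** The coefficients [a] and [b] are, up to sign, the geodesic curvatures of the
    lines of curvature.  Of the zero curvature equation for [E1], [E2], the entries in the
    last column are the Codazzi equations and the remaining entry is the Gauss
    equation; for [Dt] and [Ei], the entry in row [i] of the last column is the
    evolution equation. *)
Theorem structure_equations : exists a b : A,
  [/\ E2 l1 = a * (l1 - l2), E1 l2 = b * (l2 - l1),
      E1 b + E2 a = a * a + b * b + l1 * l2,
      Dt l1 = E1 (E1 phi) - a * E2 phi + phi * (l1 * l1) &
      Dt l2 = E2 (E2 phi) - b * E1 phi + phi * (l2 * l2)].
Proof.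
have [ec1 ec2] := frame_commutator.
have [e11 e22 e12 e21 [et0 et1]] := frame_commutator_t.
have sk1 : forall i j, O1 i j = - O1 j i by move=> i j; apply: connection_skew.
have sk2 : forall i j, O2 i j = - O2 j i by move=> i j; apply: connection_skew.
have d1 : forall i, O1 i i = 0 by move=> i; apply: connection_diag.
have d2 : forall i, O2 i i = 0 by move=> i; apply: connection_diag.
have dt : forall i, Ot i i = 0 by move=> i; apply: connection_diag.
exists (O1 i0 i1), (O2 i1 i0).
have flat (d d' : A -> A) (u v : A) (hd : derivation d) (hd' : derivation d')
    (hc : forall f, d (d' f) - d' (d f) = u * E1 f + v * E2 f) i j :
    let O := connection d Q in let O' := connection d' Q in
    d (O' i j) - d' (O i j) +
      ((O' i i0 * O i0 j + O' i i1 * O i1 j + O' i i2 * O i2 j) -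
       (O i i0 * O' i0 j + O i i1 * O' i1 j + O i i2 * O' i2 j)) =
    u * O1 i j + v * O2 i j.
  have := zero_curvature hd hd' oQ hc.
  rewrite /= connection_lincomb -/O1 -/O2 => /matrixP/(_ i j).
  move: (connection d Q) (connection d' Q) O1 O2 => C C' C1 C2.
  by rewrite !mxE !sum3.
have H12 := flat _ _ _ _ hE1 hE2 E12.
have Ht1 := flat _ _ _ _ hDt hE1 Dt1.
have Ht2 := flat _ _ _ _ hDt hE2 Dt2.
rewrite /= -/O1 -/O2 -/Ot in H12, Ht1, Ht2.
have O2_01 : O2 i0 i1 = - O2 i1 i0 by [].
split.
- have := H12 i0 i2.
  rewrite h11 h12 h21 h22 !d1 !d2 O2_01 (deriv0 hE1) (derivN hE2) ec1 ec2 => H.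
  apply/eqP; rewrite -subr_eq0; apply/eqP.
  by move/eqP: H; rewrite -subr_eq0 => /eqP <-; ring.
- have := H12 i1 i2.
  rewrite h11 h12 h21 h22 !d1 !d2 (sk1 i1 i0) (deriv0 hE2) (derivN hE1) ec1 ec2 => H.
  apply/eqP; rewrite eq_sym -subr_eq0; apply/eqP.
  by move/eqP: H; rewrite -subr_eq0 => /eqP <-; ring.
- have := H12 i0 i1.
  rewrite !d1 !d2 h11 h21 (sk2 i2 i1) (sk1 i2 i1) h22 h12 O2_01 (derivN hE1) ec1 ec2 => H.
  apply/eqP; rewrite eq_sym -subr_eq0; apply/eqP.
  by move/eqP: H; rewrite -subr_eq0 => /eqP <-; ring.
- have := Ht1 i0 i2.
  rewrite h11 h12 h21 !d1 !dt et0 et1 (derivN hDt) (derivN hE1) e11 e12 => H.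
  apply/eqP; rewrite eq_sym -subr_eq0; apply/eqP.
  by move/eqP: H; rewrite -subr_eq0 => /eqP <-; ring.
- have := Ht2 i1 i2.
  rewrite h12 h21 h22 !d2 !dt et0 et1 (derivN hDt) (derivN hE2) e22 e21 => H.
  apply/eqP; rewrite eq_sym -subr_eq0; apply/eqP.
  by move/eqP: H; rewrite -subr_eq0 => /eqP <-; ring.
Qed.

End MovingFrame.

(** The ring has no division, so [w] is given by the equation [wE] and its
    derivatives are obtained by differentiating that equation. *)
Section PinchingSpeed.
Context {A : comNzRingType} {R : realFieldType}.
Variable ev : {rmorphism A -> R}.
Variables (l1 l2 w : A).
Hypothesis wE : w * (2 * (l1 * l1 + l2 * l2) * l1 * l2) =
  (l1 + l2) * (l1 + l2) * (l1 + l2) * ((l1 - l2) * (l1 - l2)).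
Hypotheses (l1_gt0 : 0 < ev l1) (l2_gt0 : 0 < ev l2).

Let wden : A := 2 * (l1 * l1 + l2 * l2) * l1 * l2.
Let wx : A := 3 * (l1 + l2) * (l1 + l2) * (l1 - l2) * (l1 - l2)
  + 2 * (l1 + l2) * (l1 + l2) * (l1 + l2) * (l1 - l2)
  - w * (6 * l1 * l1 * l2 + 2 * l2 * l2 * l2).
Let wy : A := 3 * (l1 + l2) * (l1 + l2) * (l1 - l2) * (l1 - l2)
  - 2 * (l1 + l2) * (l1 + l2) * (l1 + l2) * (l1 - l2)
  - w * (6 * l2 * l2 * l1 + 2 * l1 * l1 * l1).

Let deriv_w (d : A -> A) (hd : derivation d) : d w * wden = wx * d l1 + wy * d l2.
Proof.
have := congr1 d wE.
rewrite !(deriv_nat hd, derivM hd, derivD hd, derivN hd) => e.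
apply/eqP; rewrite -subr_eq0; apply/eqP.
move/eqP: e; rewrite -subr_eq0 => /eqP <-; rewrite /wden /wx /wy; ring.
Qed.

Let ev_wden : ev wden = 2 * (ev l1 ^+ 2 + ev l2 ^+ 2) * ev l1 * ev l2.
Proof. by rewrite /wden !(rmorph_nat, rmorphM, rmorphD) /= -!expr2. Qed.

Let ev_wden_neq0 : ev wden != 0.
Proof. by rewrite ev_wden !mulf_neq0 ?gt_eqF ?addr_gt0 ?exprn_gt0. Qed.

Let ev_w : ev w = pinch (ev l1) (ev l2).
Proof.
apply: (mulIf ev_wden_neq0); rewrite -rmorphM /= wE /pinch -ev_wden divfK //.
by rewrite !(rmorphM, rmorphD, rmorphN) /=; ring.
Qed.

Let ev_wx : ev wx = pinch_x (ev l1) (ev l2) * ev wden.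
Proof.
rewrite ev_wden -pinch_xE // -ev_w /wx !(rmorph_nat, rmorphM, rmorphD, rmorphN) /=; ring.
Qed.

Let ev_wy : ev wy = pinch_x (ev l2) (ev l1) * ev wden.
Proof.
have -> : ev wden = 2 * (ev l2 ^+ 2 + ev l1 ^+ 2) * ev l2 * ev l1.
  by rewrite ev_wden; ring.
rewrite -pinch_xE // -pinchC -ev_w.
rewrite /wy !(rmorph_nat, rmorphM, rmorphD, rmorphN) /=; ring.
Qed.

Lemma ev_deriv_pinch (d : A -> A) : derivation d ->
  ev (d w) = pinch_x (ev l1) (ev l2) * ev (d l1) + pinch_x (ev l2) (ev l1) * ev (d l2).
Proof.
move=> hd; apply: (mulIf ev_wden_neq0).
have := congr1 ev (deriv_w hd).
move: ev_wx ev_wy; move: wden wx wy => D X Y eX eY.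
by rewrite rmorphD !rmorphM /= eX eY => ->; ring.
Qed.

Lemma ev_deriv2_pinch (d : A -> A) : derivation d -> ev (d w) = 0 ->
  ev (d (d w)) = pinch_x (ev l1) (ev l2) * ev (d (d l1))
    + pinch_x (ev l2) (ev l1) * ev (d (d l2))
    + pinch_hess (ev l1) (ev l2) (ev (d l1)) (ev (d l2)).
Proof.
move=> hd dw0; apply: (mulIf ev_wden_neq0).
have := congr1 (fun f => ev (d f)) (deriv_w hd).
have -> : ev (d (d w * wden)) = ev (d (d w)) * ev wden.
  by move: wden => D; rewrite (derivM hd) rmorphD !rmorphM /= dw0 mul0r addr0.
have -> : ev (d (wx * d l1 + wy * d l2)) = ev (d wx) * ev (d l1) + ev (d wy) * ev (d l2) +
    (ev wx * ev (d (d l1)) + ev wy * ev (d (d l2))).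
  move: wx wy => X Y; rewrite (derivD hd) !(derivM hd) !(rmorphD, rmorphM) /=; ring.
move=> ->; rewrite ev_wx ev_wy /pinch_hess -ev_w -ev_wden.
move: ev_wden_neq0; move: (ev wden) => D D0; rewrite [in RHS]mulrDl divfK //.
rewrite /wx /wy !(deriv_nat hd, derivM hd, derivD hd, derivN hd).
rewrite !(rmorph_nat, rmorph0, rmorphM, rmorphD, rmorphN) /= dw0; ring.
Qed.

Variables (E1 E2 Dt : A -> A) (a b : A).
Hypotheses (hE1 : derivation E1) (hE2 : derivation E2) (hDt : derivation Dt).
Let phi : A := (l1 + l2) * (l1 + l2).
Hypothesis codazzi1 : E2 l1 = a * (l1 - l2).
Hypothesis codazzi2 : E1 l2 = b * (l2 - l1).
Hypothesis gauss : E1 b + E2 a = a * a + b * b + l1 * l2.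
Hypothesis evol1 : Dt l1 = E1 (E1 phi) - a * E2 phi + phi * (l1 * l1).
Hypothesis evol2 : Dt l2 = E2 (E2 phi) - b * E1 phi + phi * (l2 * l2).

Theorem pinching_speed_le0 : ev l1 != ev l2 ->
  ev (E1 w) = 0 -> ev (E2 w) = 0 -> ev (E1 (E1 w)) <= 0 -> ev (E2 (E2 w)) <= 0 ->
  ev (Dt w) <= 0.
Proof.
move=> l12 w1 w2 w11 w22.
have evE := (rmorphM ev, rmorphD ev, rmorphN ev).
have d1E := (derivM hE1, derivD hE1, derivN hE1); have d2E := (derivM hE2, derivD hE2, derivN hE2).
rewrite ev_deriv_pinch //.
apply: (@critical_point_inequality _ (ev l1) (ev l2) (ev (E1 l1)) (ev (E2 l1))
  (ev (E1 l2)) (ev (E2 l2)) (ev (E1 (E1 l1))) (ev (E2 (E2 l1)))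
  (ev (E1 (E1 l2))) (ev (E2 (E2 l2))) (ev a) (ev b) (ev (E2 a)) (ev (E1 b))) => //.
- by rewrite -ev_deriv_pinch.
- by rewrite -ev_deriv_pinch.
- by rewrite -ev_deriv2_pinch.
- by rewrite -ev_deriv2_pinch.
- by rewrite codazzi1 !evE.
- by rewrite codazzi2 !evE.
- by rewrite {1}codazzi1 !d2E !evE.
- by rewrite {1}codazzi2 !d1E !evE.
- by rewrite -!evE gauss.
- rewrite evol1 /phi !d1E !d2E !evE; ring.
- rewrite evol2 /phi !d1E !d2E !evE; ring.
Qed.

End PinchingSpeed.

(** [E1] and [E2] are now combinations of commuting coordinate derivations [d1]
    and [d2], with the inverse determinant [z] of the coefficients.  Since [d1] and
    [d2] are conversely combinations of [E1] and [E2], so are the commutators of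
    the frame fields with each other and with the time derivative. *)
Section CoordinateFrame.
Context {A : comNzRingType} {R : realFieldType}.
Variable ev : {rmorphism A -> R}.
Variables (d1 d2 dt : A -> A).
Hypotheses (hd1 : derivation d1) (hd2 : derivation d2) (hdt : derivation dt).
Hypothesis d12 : forall f, d1 (d2 f) = d2 (d1 f).
Hypothesis dt1 : forall f, dt (d1 f) = d1 (dt f).
Hypothesis dt2 : forall f, dt (d2 f) = d2 (dt f).
Hypothesis two_reg : forall f : A, f + f = 0 -> f = 0.
Variables (F nu : 'I_3 -> A) (x11 x12 x21 x22 z l1 l2 w : A).
Hypothesis detx : z * (x11 * x22 - x12 * x21) = 1.
Let E1 f := x11 * d1 f + x12 * d2 f.
Let E2 f := x21 * d1 f + x22 * d2 f.
Hypothesis g11 : \sum_k E1 (F k) * E1 (F k) = 1.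
Hypothesis g12 : \sum_k E1 (F k) * E2 (F k) = 0.
Hypothesis g22 : \sum_k E2 (F k) * E2 (F k) = 1.
Hypothesis nunu : \sum_k nu k * nu k = 1.
Hypothesis d1nu : \sum_k d1 (F k) * nu k = 0.
Hypothesis d2nu : \sum_k d2 (F k) * nu k = 0.
Let h (a b a' b' : A) := a * a' * \sum_k d1 (d1 (F k)) * nu k +
   (a * b' + b * a') * \sum_k d1 (d2 (F k)) * nu k + b * b' * \sum_k d2 (d2 (F k)) * nu k.
Hypothesis h11 : h x11 x12 x11 x12 = - l1.
Hypothesis h12 : h x11 x12 x21 x22 = 0.
Hypothesis h22 : h x21 x22 x21 x22 = - l2.
Hypothesis flow : forall k, dt (F k) = - ((l1 + l2) * (l1 + l2) * nu k).
Hypothesis wE : w * (2 * (l1 * l1 + l2 * l2) * l1 * l2) =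
  (l1 + l2) * (l1 + l2) * (l1 + l2) * ((l1 - l2) * (l1 - l2)).

Let hE1 : derivation E1. Proof. exact: derivation_lincomb. Qed.
Let hE2 : derivation E2. Proof. exact: derivation_lincomb. Qed.

Let d1E f : d1 f = z * x22 * E1 f - z * x12 * E2 f.
Proof.
rewrite -[LHS]mul1r -detx /E1 /E2; move: (d1 f) (d2 f) => a b; ring.
Qed.

Let d2E f : d2 f = z * x11 * E2 f - z * x21 * E1 f.
Proof.
rewrite -[LHS]mul1r -detx /E1 /E2; move: (d1 f) (d2 f) => a b; ring.
Qed.

Let comm_combo (p q : A) : exists s t, forall f, p * d1 f + q * d2 f = s * E1 f + t * E2 f.
Proof.
exists (p * (z * x22) - q * (z * x21)), (q * (z * x11) - p * (z * x12)) => f.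
by rewrite d1E d2E; ring.
Qed.

Let E12_raw f : E1 (E2 f) - E2 (E1 f) =
  (E1 x21 - E2 x11) * d1 f + (E1 x22 - E2 x12) * d2 f.
Proof.
rewrite /E1 /E2 !(derivD hd1, derivM hd1) !(derivD hd2, derivM hd2) d12; ring.
Qed.

Let Dt1_raw f : dt (E1 f) - E1 (dt f) = dt x11 * d1 f + dt x12 * d2 f.
Proof. rewrite /E1 !(derivD hdt, derivM hdt) dt1 dt2; ring. Qed.

Let Dt2_raw f : dt (E2 f) - E2 (dt f) = dt x21 * d1 f + dt x22 * d2 f.
Proof. rewrite /E2 !(derivD hdt, derivM hdt) dt1 dt2; ring. Qed.

Let i0 : 'I_3 := 0.
Let i1 : 'I_3 := 1.
Let i2 : 'I_3 := 2.

Let Q : 'M[A]_3 := \matrix_(i, k)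
  if i == i0 then E1 (F k) else if i == i1 then E2 (F k) else nu k.

Let E1nu : \sum_k E1 (F k) * nu k = 0.
Proof.
transitivity (x11 * (\sum_k d1 (F k) * nu k) + x12 * \sum_k d2 (F k) * nu k).
  by rewrite !mulr_sumr -big_split; apply: eq_bigr => k _; rewrite /E1 mulrDl !mulrA.
by rewrite d1nu d2nu !mulr0 addr0.
Qed.

Let E2nu : \sum_k E2 (F k) * nu k = 0.
Proof.
transitivity (x21 * (\sum_k d1 (F k) * nu k) + x22 * \sum_k d2 (F k) * nu k).
  by rewrite !mulr_sumr -big_split; apply: eq_bigr => k _; rewrite /E2 mulrDl !mulrA.
by rewrite d1nu d2nu !mulr0 addr0.
Qed.

Let oQ : Q *m Q^T = 1%:M.
Proof.
have swap (u v : 'I_3 -> A) : \sum_k u k * v k = \sum_k v k * u k.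
  by apply: eq_bigr => k _; rewrite mulrC.
apply/matrixP => i j; rewrite !mxE.
under eq_bigr do rewrite !mxE.
case: i => [[|[|[|i]]] hi] //; case: j => [[|[|[|j]]] hj] //=; rewrite -?[RHS]/1 -?[RHS]/0 //.
- by rewrite swap.
- by rewrite swap.
- by rewrite swap.
Qed.

(* the derivatives of the coefficients only contribute tangential terms *)
Let second (a b a' b' : A) :
  \sum_k (a * d1 (a' * d1 (F k) + b' * d2 (F k)) + b * d2 (a' * d1 (F k) + b' * d2 (F k))) * nu k
  = h a b a' b'.
Proof.
transitivity (h a b a' b' + (a * d1 a' + b * d2 a') * (\sum_k d1 (F k) * nu k)
   + (a * d1 b' + b * d2 b') * (\sum_k d2 (F k) * nu k)).
  rewrite /h !mulr_sumr -!big_split; apply: eq_bigr => k _.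
  rewrite !(derivD hd1, derivM hd1) !(derivD hd2, derivM hd2) d12 /=; ring.
by rewrite d1nu d2nu !mulr0 !addr0.
Qed.

Let hC a b a' b' : h a b a' b' = h a' b' a b.
Proof. rewrite /h; ring. Qed.

Let connectionQ d i : connection d Q i i2 = \sum_k d (Q i k) * nu k.
Proof. by rewrite !mxE; apply: eq_bigr => k _; rewrite !mxE. Qed.

Theorem flow_pinching_speed : 0 < ev l1 -> 0 < ev l2 -> ev l1 != ev l2 ->
  ev (E1 w) = 0 -> ev (E2 w) = 0 -> ev (E1 (E1 w)) <= 0 -> ev (E2 (E2 w)) <= 0 ->
  ev (dt w) <= 0.
Proof.
move=> l10 l20 l12.
have [c1 [c2 hc]] := comm_combo (E1 x21 - E2 x11) (E1 x22 - E2 x12).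
have [s11 [s12 hs1]] := comm_combo (dt x11) (dt x12).
have [s21 [s22 hs2]] := comm_combo (dt x21) (dt x22).
have E12 f := etrans (E12_raw f) (hc f).
have Dt1 f := etrans (Dt1_raw f) (hs1 f).
have Dt2 f := etrans (Dt2_raw f) (hs2 f).
have Q0 k : Q i0 k = E1 (F k) by rewrite mxE.
have Q1 k : Q i1 k = E2 (F k) by rewrite mxE.
have Q2 k : Q i2 k = nu k by rewrite mxE.
have Ft k : dt (F k) = - ((l1 + l2) * (l1 + l2) * Q i2 k) by rewrite Q2.
have o11 : connection E1 Q i0 i2 = - l1.
  by rewrite connectionQ -h11 -second; apply: eq_bigr => k _; rewrite Q0.
have o12 : connection E1 Q i1 i2 = 0.
  rewrite connectionQ; apply: etrans h12; rewrite -second; apply: eq_bigr => k _; by rewrite Q1.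
have o21 : connection E2 Q i0 i2 = 0.
  rewrite connectionQ; apply: etrans (etrans (hC _ _ _ _) h12); rewrite -second; apply: eq_bigr => k _; by rewrite Q0.
have o22 : connection E2 Q i1 i2 = - l2.
  by rewrite connectionQ -h22 -second; apply: eq_bigr => k _; rewrite Q1.
have [a [b [co1 co2 ga ev1 ev2]]] :=
  structure_equations hE1 hE2 hdt two_reg E12 Dt1 Dt2 oQ Q0 Q1 Ft o11 o12 o21 o22.
exact: (pinching_speed_le0 wE l10 l20 hE1 hE2 hdt co1 co2 ga ev1 ev2 l12).
Qed.

End CoordinateFrame.

(** * Smooth functions on an open set *)

(** The inequality by which relative differentials are defined determines the
    ordinary differential. *)
Lemma differential_eps (R : realType) (V W : normedModType R) (f : V -> W) (x : V)
    (df : {linear V -> W}) : continuous df ->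
  (forall eps : R, 0 < eps -> \forall y \near x,
     `|f y - f x - df (y - x)| <= eps * `|y - x|) ->
  differentiable f x /\ 'd f x = df :> (V -> W).
Proof.
move=> cdf h.
have dE : f \o shift x = cst (f x) + df +o_ 0 id.
  apply/eqaddoP => eps eps0; near=> y.
  have : `|f (y + x) - f x - df (y + x - x)| <= eps * `|y + x - x|.
    near: y; have := h _ eps0; rewrite (near_shift 0) /=.
    by apply: filterS => y; rewrite subr0.
  by rewrite addrK opprD addrA.
have e := diff_unique cdf dE; split=> //.
by apply/diff_locallyP; rewrite e.
Unshelve. all: by end_near. Qed.

Lemma differentiable_eps (R : realType) (V W : normedModType R) (f : V -> W) (x : V)
    (eps : R) : differentiable f x -> 0 < eps ->
  \forall y \near x, `|f y - f x - 'd f x (y - x)| <= eps * `|y - x|.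
Proof.
move=> /diff_locally /eqaddoP h eps0; rewrite (near_shift 0); have := h _ eps0; apply: filterS => y /=.
by rewrite subr0 addrK opprD addrA.
Qed.

Lemma derivable_eps (R : realType) (V : normedModType R) (f : V -> R) (x v : V)
    (eps : R) : derivable f x v -> 0 < eps ->
  exists2 d : R, 0 < d & forall h, `|h| < d ->
    `|f (x + h *: v) - f x - h * 'D_v f x| <= eps * `|h|.
Proof.
move=> /derivable_nbhs /eqaddoP h eps0; have := h _ eps0.
move=> /nbhs_ballP [d d0 hd]; exists d => // k kd.
have := hd k; rewrite /ball /= sub0r normrN => /(_ kd) /=.
by rewrite [x + _]addrC -addrA -opprD.
Qed.

Section SmoothFunctions.
Context {R : realType} {E : normedModType R}.
Implicit Types (O : set E) (f g : E -> R) (n : nat) (v w x : E).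

(** Requiring every directional derivative to be of the next lower class avoids
    normed spaces of linear maps. *)
Fixpoint Cn n O f : Prop :=
  if n is n'.+1 then
    (forall x, O x -> differentiable f x) /\ forall v, Cn n' O ('D_v f)
  else forall x, O x -> {for x, continuous f}.

Definition smooth O f := forall n, Cn n O f.

Lemma near_eq_differentiable f g x : (\forall y \near x, f y = g y) ->
  differentiable f x -> differentiable g x.
Proof.
move=> fg df; have fgx := nbhs_singleton fg.
have [|//] := @differential_eps R E R^o g x ('d f x) (diff_continuous df).
move=> eps eps0; have := differentiable_eps df eps0.
by apply: filterS2 fg => y <-; rewrite fgx.
Qed.

Lemma Cn_ext n O f g : open O -> (forall x, O x -> f x = g x) -> Cn n O f -> Cn n O g.
Proof.
move=> oO; elim: n f g => [|n IH] f g fg /=.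
  move=> cf x Ox; rewrite /prop_for /continuous_at -(fg _ Ox).
  apply: cvg_trans (cf x Ox); apply: near_eq_cvg.
  by apply: filterS (open_nbhs_nbhs (conj oO Ox)) => y; apply: fg.
have nfg x : O x -> \forall y \near x, f y = g y.
  by move=> Ox; apply: filterS (open_nbhs_nbhs (conj oO Ox)) => y; apply: fg.
move=> [df cf]; split=> [x Ox|v]; first exact: near_eq_differentiable (nfg x Ox) (df x Ox).
by apply: IH (cf v) => x Ox; apply: near_eq_derive; exact: nfg.
Qed.

Lemma smooth_ext O f g : open O -> (forall x, O x -> f x = g x) -> smooth O f -> smooth O g.
Proof. by move=> oO fg sf n; apply: Cn_ext (sf n). Qed.

Lemma Cn_sub n O O' f : O' `<=` O -> Cn n O f -> Cn n O' f.
Proof.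
move=> OO; elim: n f => [|n IH] f /=; first by move=> cf x /OO; apply: cf.
by move=> [df cf]; split=> [x /OO|v]; [apply: df|apply: IH].
Qed.

Lemma CnW n O f : Cn n.+1 O f -> Cn n O f.
Proof.
elim: n f => [|n IH] f /=; last by move=> [df cf]; split=> // v; apply: IH; apply: cf.
by move=> [df _] x Ox; apply: differentiable_continuous; apply: df.
Qed.

Lemma Cn_cst n O (c : R) : Cn n O (cst c).
Proof.
elim: n c => [|n IH] c /=; first by move=> x _; exact: cvg_cst.
split=> [x _|v]; first exact: differentiable_cst.
have -> : 'D_v (cst c : E -> R) = cst 0 by apply/funext => x; rewrite derive_cst.
exact: IH.
Qed.

Lemma CnD n O f g : open O -> Cn n O f -> Cn n O g -> Cn n O (fun x => f x + g x).
Proof.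
move=> oO; elim: n f g => [|n IH] f g /=.
  by move=> cf cg x Ox; apply: cvgD; [apply: cf|apply: cg].
move=> [df cf] [dg cg]; split=> [x Ox|v]; first exact: differentiableD (df x Ox) (dg x Ox).
apply: Cn_ext (IH _ _ (cf v) (cg v)) => // x Ox.
by symmetry; apply: deriveD; apply: diff_derivable; [apply: df|apply: dg].
Qed.

Lemma CnM n O f g : open O -> Cn n O f -> Cn n O g -> Cn n O (fun x => f x * g x).
Proof.
move=> oO; elim: n f g => [|n IH] f g.
  by move=> cf cg x Ox; apply: cvgM; [apply: cf|apply: cg].
move=> cf' cg'; have [df cf] := cf'; have [dg cg] := cg'.
split=> [x Ox|v]; first exact: differentiableM (df x Ox) (dg x Ox).
apply: Cn_ext (CnD oO (IH _ _ (CnW cf') (cg v)) (IH _ _ (CnW cg') (cf v))) => // x Ox.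
by symmetry; apply: deriveM; apply: diff_derivable; [apply: df|apply: dg].
Qed.

Lemma CnV n O f : open O -> (forall x, O x -> f x != 0) -> Cn n O f ->
  Cn n O (fun x => (f x)^-1).
Proof.
move=> oO f0; elim: n => [|n IH].
  by move=> cf x Ox; apply: cvgV; [apply: f0|apply: cf].
move=> cf'; have [df cf] := cf'.
split=> [x Ox|v]; first exact: differentiableV (df x Ox) (f0 x Ox).
have ci := IH (CnW cf').
apply: Cn_ext (CnM oO (CnM oO (Cn_cst _ _ (-1)) (CnM oO ci ci)) (cf v)) => // x Ox.
symmetry; apply: etrans (deriveV (f0 x Ox) _) _; first by apply: diff_derivable; apply: df.
by rewrite mulN1r -invfM -expr2.
Qed.

Lemma Cn_sqrt n O f : open O -> (forall x, O x -> 0 < f x) -> Cn n O f ->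
  Cn n O (fun x => Num.sqrt (f x)).
Proof.
move=> oO f0; elim: n => [|n IH].
  move=> cf x Ox; apply: continuous_comp; [exact: cf|exact: sqrt_continuous].
move=> cf'; have [df cf] := cf'.
have dsq x : O x -> is_derive (f x) 1 (@Num.sqrt R) (2 * Num.sqrt (f x))^-1.
  by move=> Ox; apply: is_derive1_sqrt; apply: f0.
have dd x : O x -> differentiable (@Num.sqrt R) (f x).
  by move=> /dsq [h _]; apply/derivable1_diffP.
split=> [x Ox|v]; first exact: differentiable_comp (df x Ox) (dd x Ox).
have c2 : Cn n O (fun x => (2 * Num.sqrt (f x))^-1).
  apply: CnV => // [x Ox|]; first by rewrite mulf_neq0 // gt_eqF // sqrtr_gt0 f0.
  exact: CnM oO (Cn_cst _ _ 2) (IH (CnW cf')).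
apply: Cn_ext (CnM oO c2 (cf v)) => // x Ox.
rewrite [RHS]deriveE; last exact: differentiable_comp (df x Ox) (dd x Ox).
rewrite (diff_comp (df x Ox) (dd x Ox)) /= -(deriveE v (df x Ox)).
have [h e] := dsq x Ox.
rewrite (deriv1E h) derive1E e [LHS]mulrC; exact: erefl.
Qed.

Lemma smooth_cst O (c : R) : smooth O (cst c). Proof. by move=> n; apply: Cn_cst. Qed.

Lemma smoothD O f g : open O -> smooth O f -> smooth O g -> smooth O (fun x => f x + g x).
Proof. by move=> oO sf sg n; apply: CnD. Qed.

Lemma smoothM O f g : open O -> smooth O f -> smooth O g -> smooth O (fun x => f x * g x).
Proof. by move=> oO sf sg n; apply: CnM. Qed.

Lemma smoothN O f : open O -> smooth O f -> smooth O (fun x => - f x).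
Proof.
move=> oO sf; apply: smooth_ext (smoothM oO (smooth_cst _ (-1)) sf) => // x _.
by rewrite mulN1r.
Qed.

Lemma smoothV O f : open O -> (forall x, O x -> f x != 0) -> smooth O f ->
  smooth O (fun x => (f x)^-1).
Proof. by move=> oO f0 sf n; apply: CnV. Qed.

Lemma smooth_sqrt O f : open O -> (forall x, O x -> 0 < f x) -> smooth O f ->
  smooth O (fun x => Num.sqrt (f x)).
Proof. by move=> oO f0 sf n; apply: Cn_sqrt. Qed.

Lemma smooth_derive O f v : smooth O f -> smooth O ('D_v f).
Proof. by move=> sf n; have [_] := sf n.+1; apply. Qed.

Lemma smooth_sub O O' f : O' `<=` O -> smooth O f -> smooth O' f.
Proof. by move=> OO sf n; apply: Cn_sub (sf n). Qed.

Lemma smooth_differentiable O f x : smooth O f -> O x -> differentiable f x.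
Proof. by move=> sf; have [+ _] := sf 1%N; apply. Qed.

Lemma smooth_continuous O f x : smooth O f -> O x -> {for x, continuous f}.
Proof. by move=> sf Ox; apply: differentiable_continuous; apply: smooth_differentiable Ox. Qed.

End SmoothFunctions.

Lemma half_lt (R : realFieldType) (m : R) : 0 < m -> m / 2 < m.
Proof. by lra. Qed.

Lemma close_quotients (R : realFieldType) (S k a b c : R) : 0 < k ->
  `|S - k * a| <= c * k -> `|S - k * b| <= c * k -> `|a - b| <= 2 * c.
Proof.
move=> k0 h1 h2; rewrite -(ler_pM2l k0) -{1}(gtr0_norm k0) -normrM.
have -> : k * (a - b) = (S - k * b) - (S - k * a) by ring.
by apply: le_trans (ler_normB _ _) _; apply: le_trans (lerD h2 h1) _; lra.
Qed.

Section MixedDerivatives.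
Context {R : realType} {E : normedModType R}.
Implicit Types (O : set E) (f g : E -> R) (n : nat) (v w x : E).

(** Turns a directional derivative into the derivative of a function of one real
    variable, to which the mean value theorem applies. *)
Lemma is_derive_line f x v (t : R) : derivable f (x + t *: v) v ->
  is_derive t 1 (fun s : R => f (x + s *: v)) ('D_v f (x + t *: v)).
Proof.
move=> df.
have e : (fun h : R => h^-1 *: (((fun s : R => f (x + s *: v)) \o shift t) (h *: 1) - f (x + t *: v)))
  = (fun h : R => h^-1 *: ((f \o shift (x + t *: v)) (h *: v) - f (x + t *: v))).
  apply/funext => h /=; congr (_ *: (f _ - _)).
  by rewrite [h *: 1]mulr1 scalerDl addrCA.
by split; rewrite /derivable /derive e.
Qed.

Lemma MVT_line f x v (s : R) : 0 < s ->
  (forall t, 0 <= t <= s -> derivable f (x + t *: v) v) ->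
  exists2 t, 0 < t < s & f (x + s *: v) - f x = s * 'D_v f (x + t *: v).
Proof.
move=> s0 df.
pose g := fun t : R => f (x + t *: v).
have dg (t : R) : 0 <= t <= s -> is_derive t 1 g ('D_v f (x + t *: v)).
  by move=> /df; exact: is_derive_line.
have [t|t|t] := @MVT R g (fun t => 'D_v f (x + t *: v)) 0 s s0.
- by rewrite in_itv /= => /andP[t0 ts]; apply: dg; rewrite !ltW.
- apply: derivable_within_continuous => u; rewrite in_itv /= => hu.
  by have [] := dg u hu.
- rewrite in_itv /= => ht; rewrite /g scale0r addr0 subr0 mulrC => e; by exists t.
Qed.

(** The mean value theorem along [v], applied to [f (y + s w) - f y], reduces the
    second difference to a difference of values of ['D_v f], and this is
    differentiable at [x]. *)
Lemma second_difference f x v w (eps : R) : 0 < eps ->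
  (\forall y \near x, differentiable f y) -> differentiable ('D_v f) x ->
  exists2 d : R, 0 < d & forall s : R, 0 < s < d ->
    `|f (x + s *: v + s *: w) - f (x + s *: v) - f (x + s *: w) + f x
      - s ^+ 2 * 'D_w ('D_v f) x| <= eps * s ^+ 2.
Proof.
move=> eps0 df dfv.
pose K := `|v| + `|w| + 1.
have K0 : 0 < K by rewrite ltr_wpDl ?addr_ge0.
have e0 : 0 < eps / (2 * K) by rewrite divr_gt0 ?mulr_gt0.
have := differentiable_eps dfv e0.
move: df => /nbhs_ballP[d1 d10 h1] /nbhs_ballP[d2 d20 h2].
exists (Num.min d1 d2 / K); first by rewrite divr_gt0 // lt_min d10.
move=> s /andP[s0]; rewrite ltr_pdivlMr // lt_min => /andP[sd1 sd2].
have nrm (t c : R) : 0 <= t <= s -> 0 <= c <= s -> `|t *: v + c *: w| <= s * K.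
  move=> /andP[t0 ts] /andP[c0 cs]; apply: le_trans (ler_normD _ _) _.
  rewrite !normrZ (ger0_norm t0) (ger0_norm c0) /K !mulrDr mulr1.
  by rewrite ler_wpDr ?(ltW s0) // lerD // ler_wpM2r.
have b1 (t c : R) : 0 <= t <= s -> 0 <= c <= s -> differentiable f (x + t *: v + c *: w).
  move=> ht hc; apply: h1; rewrite -ball_normE /= -addrA opprD addNKr normrN.
  by apply: le_lt_trans sd1; apply: nrm.
have b2 (t c : R) : 0 <= t <= s -> 0 <= c <= s ->
   `|'D_v f (x + t *: v + c *: w) - 'D_v f x - 'd ('D_v f) x (t *: v + c *: w)|
      <= eps / (2 * K) * (s * K).
  move=> ht hc; have := h2 (x + t *: v + c *: w).
  rewrite -ball_normE /= -[x + t *: v + _]addrA opprD addNKr normrN.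
  rewrite [x + (_ + _)]addrC addrK => h; apply: le_trans (h _) _.
    by apply: le_lt_trans sd2; apply: nrm.
  by rewrite ler_wpM2l ?(ltW e0) // nrm.
have s00 : 0 <= (0 : R) <= s by rewrite lexx ltW.
have ss : 0 <= s <= s by rewrite lexx ltW.
pose g := fun y => f (y + s *: w) - f y.
have dgl (t : R) : 0 <= t <= s ->
    is_derive (x + t *: v) v g
      ('D_v f (x + t *: v + s *: w) - 'D_v f (x + t *: v)).
  move=> ht; have d1f : derivable f (x + t *: v + s *: w) v by apply: diff_derivable; apply: b1.
  have d0f : derivable f (x + t *: v) v.
    by apply: diff_derivable; have := b1 t 0 ht s00; rewrite scale0r addr0.
  have e : (fun h : R => h^-1 *: (((fun y => f (y + s *: w)) \o shift (x + t *: v)) (h *: v)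
                - f (x + t *: v + s *: w)))
    = (fun h : R => h^-1 *: ((f \o shift (x + t *: v + s *: w)) (h *: v)
                - f (x + t *: v + s *: w))).
    by apply/funext => h /=; rewrite !addrA.
  have i1 : is_derive (x + t *: v) v (fun y => f (y + s *: w))
               ('D_v f (x + t *: v + s *: w)).
    by split; rewrite /derivable /derive e.
  have i0 : is_derive (x + t *: v) v f ('D_v f (x + t *: v)) by split.
  exact: is_deriveB.
have [t ht e] := @MVT_line g x v s s0 (fun t ht => (dgl t ht).(ex_derive)).
have [t0 ts] := andP ht.
have ht' : 0 <= t <= s by rewrite !ltW.
have := e; rewrite {1 2}/g => eg.
have -> : f (x + s *: v + s *: w) - f (x + s *: v) - f (x + s *: w) + f x =
   f (x + s *: v + s *: w) - f (x + s *: v) - (f (x + s *: w) - f x).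
  by rewrite opprB addrA addrAC -addrA [- _ + _]addrC addrA.
rewrite eg (dgl t ht').(derive_val) (deriveE w dfv).
have c1 := b2 t s ht' ss; have c0 := b2 t 0 ht' s00.
have lin (a c : R) : 'd ('D_v f) x (a *: v + c *: w) =
    a * 'd ('D_v f) x v + c * 'd ('D_v f) x w by rewrite linearD !linearZ.
rewrite !lin scale0r mul0r !addr0 in c0; rewrite lin in c1.
set A1 := 'D_v f _ in c1 *; set A0 := 'D_v f (x + t *: v) in c0 *.
set B := 'D_v f x in c1 c0; set Lv := 'd _ x v in c1 c0; set Lw := 'd _ x w in c1 *.
have eE : eps / (2 * K) * (s * K) = eps * s / 2 by field; rewrite gt_eqF.
rewrite eE in c1 c0.
have -> : s * (A1 - A0) - s ^+ 2 * Lw = s * ((A1 - B - (t * Lv + s * Lw)) - (A0 - B - t * Lv)).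
  by ring.
rewrite normrM (gtr0_norm s0) [eps * _]mulrC expr2 -mulrA ler_pM2l //.
apply: le_trans (ler_normB _ _) _.
by apply: le_trans (lerD c1 c0) _; lra.
Qed.

(** The second difference is symmetric in [v] and [w], so that both iterated
    derivatives are its limit after division by [s ^ 2]. *)
Lemma derive_comm O f v w x : open O -> smooth O f -> O x ->
  'D_v ('D_w f) x = 'D_w ('D_v f) x.
Proof.
move=> oO sf Ox.
have nf : \forall y \near x, differentiable f y.
  apply: filterS (open_nbhs_nbhs (conj oO Ox)) => y; exact: smooth_differentiable.
have dv u : differentiable ('D_u f) x.
  by apply: smooth_differentiable Ox; apply: smooth_derive.
apply/eqP/negPn/negP => ne.
pose D := `|'D_v ('D_w f) x - 'D_w ('D_v f) x|.
have D0 : 0 < D by rewrite normr_gt0 subr_eq0.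
have e0 : 0 < D / 4 by rewrite divr_gt0.
have [d1 d10 h1] := second_difference w e0 nf (dv v).
have [d2 d20 h2] := second_difference v e0 nf (dv w).
pose s := Num.min d1 d2 / 2.
have m0 : 0 < Num.min d1 d2 by rewrite lt_min d10.
have s0 : 0 < s by rewrite divr_gt0.
have sm : s < Num.min d1 d2 by apply: half_lt.
have [sd1 sd2] := andP (etrans (esym (lt_min _ _ _)) sm).
have {}h1 := h1 s; rewrite s0 sd1 in h1; have {}h1 := h1 isT.
have {}h2 := h2 s; rewrite s0 sd2 in h2; have {}h2 := h2 isT.
have sw : x + s *: w + s *: v = x + s *: v + s *: w by rewrite addrAC.
rewrite sw in h2.
have sx : f (x + s *: v + s *: w) - f (x + s *: w) - f (x + s *: v) + f x =
    f (x + s *: v + s *: w) - f (x + s *: v) - f (x + s *: w) + f x.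
  by congr (_ + _); rewrite addrAC.
rewrite sx in h2.
have := close_quotients (exprn_gt0 2 s0) h2 h1; rewrite -/D.
have -> : 2 * (D / 4) = D / 2 by move: (D) => a; field.
by rewrite leNgt half_lt.
Qed.

End MixedDerivatives.

Section LocalMaximum.
Context {R : realType} {E : normedModType R}.
Implicit Types (O : set E) (f : E -> R) (v p : E).

Definition line_max f p v : Prop :=
  exists2 d : R, 0 < d & forall h : R, `|h| < d -> f (p + h *: v) <= f p.

Lemma derive_line_max f p v : derivable f p v -> line_max f p v -> 'D_v f p = 0.
Proof.
move=> df [d d0 hm]; apply/eqP/negPn/negP => D0.
have e0 : 0 < `|'D_v f p| / 2 by rewrite divr_gt0 ?normr_gt0.
have [d' d'0 he] := derivable_eps df e0.
pose k := Num.min d d' / 2.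
have m0 : 0 < Num.min d d' by rewrite lt_min d0.
have k0 : 0 < k by rewrite divr_gt0.
have km : k < Num.min d d' by apply: half_lt.
have [kd kd'] := andP (etrans (esym (lt_min _ _ _)) km).
pose h := Num.sg ('D_v f p) * k.
have nh : `|h| = k by rewrite normrM normr_sg D0 mul1r gtr0_norm.
have := he h; rewrite nh => /(_ kd').
have := hm h; rewrite nh => /(_ kd) h1 /ler_normlP[h2 _].
have : h * 'D_v f p = k * `|'D_v f p| by rewrite normrEsg /h; ring.
move: h1 h2; rewrite -normr_gt0 in D0.
have := mulr_gt0 k0 D0; set a := `|_|; nra.
Qed.

(** A positive second derivative at a critical point would make the first
    derivative positive just after it, and [f] larger by the mean value theorem. *)
Lemma derive2_line_max f p v :
  (\forall y \near p, derivable f y v) -> derivable ('D_v f) p v ->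
  line_max f p v -> 'D_v ('D_v f) p <= 0.
Proof.
move=> nf df hm; rewrite leNgt; apply/negP => D0.
have D1 : 'D_v f p = 0 by apply: derive_line_max hm; apply: nbhs_singleton nf.
have e0 : 0 < 'D_v ('D_v f) p / 2 by rewrite divr_gt0.
have [d' d'0 he] := derivable_eps df e0.
move: hm nf => [d d0 hm] /nbhs_ballP[r r0 hr].
have n0 : 0 < `|v| + 1 by rewrite ltr_wpDl.
pose m := Num.min (Num.min d d') (r / (`|v| + 1)).
have m0 : 0 < m by rewrite !lt_min d0 d'0 divr_gt0.
pose s := m / 2.
have s0 : 0 < s by rewrite divr_gt0.
have : s < m by apply: half_lt.
rewrite /m !lt_min => /andP[/andP[sd sd']]; rewrite ltr_pdivlMr // => sr.
have [t ht|t /andP[t0 ts] e] := @MVT_line _ _ f p v s s0.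
  apply: hr; rewrite -ball_normE /= opprD addNKr normrN normrZ.
  case/andP: ht => t0 ts; rewrite (ger0_norm t0); apply: le_lt_trans sr.
  by rewrite ler_pM // lerDl.
have := hm s; rewrite (gtr0_norm s0) => /(_ sd); rewrite -subr_le0 e pmulr_rle0 //.
apply/negP; rewrite -ltNge.
have := he t; rewrite (gtr0_norm t0) => /(_ (lt_trans ts sd')); rewrite D1 subr0.
move=> /ler_normlP[h _]; have := mulr_gt0 t0 D0; lra.
Qed.

(** Only earlier points are compared, which is all that the maximum over a time
    interval provides at its right end. *)
Lemma derive_growth f p v (eps : R) : derivable f p v ->
  (exists2 d : R, 0 < d & forall h, 0 < h < d -> f (p - h *: v) <= f p - eps * h) ->
  eps <= 'D_v f p.
Proof.
move=> df [d d0 hm]; rewrite leNgt; apply/negP => D0.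
have e0 : 0 < (eps - 'D_v f p) / 2 by rewrite divr_gt0 ?subr_gt0.
have [d' d'0 he] := derivable_eps df e0.
have m0 : 0 < Num.min d d' by rewrite lt_min d0.
pose k := Num.min d d' / 2.
have k0 : 0 < k by rewrite divr_gt0.
have km : k < Num.min d d' by apply: half_lt.
have [kd kd'] := andP (etrans (esym (lt_min _ _ _)) km).
have := he (- k); rewrite normrN (gtr0_norm k0) scaleNr => /(_ kd') /ler_normlP[h _].
have := hm k; rewrite k0 => /(_ kd) h'.
have : 0 < k * (eps - 'D_v f p) by rewrite mulr_gt0 ?subr_gt0.
move: h h'; set a := f _; set b := f _; set c := 'D_v f p; nra.
Qed.

End LocalMaximum.

(** The point makes the ring of smooth functions nontrivial, and it is where ring
    elements are evaluated. *)
Record pointed_open (R : realType) (E : normedModType R) := PointedOpen {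
  pset :> set E; pset_open : open pset; base : E; baseP : pset base }.

Section SmoothRing.
Context {R : realType} {E : normedModType R}.
Variable O : pointed_open E.

(** Functions vanish outside [O], so that agreement on [O] is equality. *)
Record sfun := SFun {
  sfun_val :> E -> R;
  sfun_smooth : smooth O sfun_val;
  sfun_out : forall x, ~ pset O x -> sfun_val x = 0 }.

Lemma sfunP (f g : sfun) : (forall x, pset O x -> f x = g x) -> f = g.
Proof.
case: f g => [f sf f0] [g sg g0] /= fg.
have e : f = g.
  by apply/funext => x; have [Ox|nOx] := pselect (pset O x); [apply: fg|rewrite f0 ?g0].
by case: g / e sg g0 fg => sg g0 _; congr SFun; apply: Prop_irrelevance.
Qed.

Definition trunc (f : E -> R) : E -> R := fun x => if pselect (pset O x) then f x else 0.

Lemma truncE f x : pset O x -> trunc f x = f x.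
Proof. by rewrite /trunc; case: pselect. Qed.

Lemma smooth_trunc f : smooth O f -> smooth O (trunc f).
Proof. by move=> sf; apply: smooth_ext sf; [exact: pset_open|move=> x Ox; rewrite truncE]. Qed.

Lemma trunc_out f x : ~ pset O x -> trunc f x = 0.
Proof. by rewrite /trunc; case: pselect. Qed.

Definition mksfun f (sf : smooth O f) : sfun := SFun (smooth_trunc sf) (@trunc_out f).

Lemma mksfunE f (sf : smooth O f) x : pset O x -> mksfun sf x = f x.
Proof. exact: truncE. Qed.

HB.instance Definition _ := gen_eqMixin sfun.
HB.instance Definition _ := gen_choiceMixin sfun.

Let oO := pset_open O.
Definition sfun_add (f g : sfun) : sfun :=
  mksfun (smoothD oO (sfun_smooth f) (sfun_smooth g)).
Definition sfun_opp (f : sfun) : sfun := mksfun (smoothN oO (sfun_smooth f)).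
Definition sfun_mul (f g : sfun) : sfun :=
  mksfun (smoothM oO (sfun_smooth f) (sfun_smooth g)).
Definition sfun_cst (c : R) : sfun := mksfun (smooth_cst O c).

Let addA : associative sfun_add.
Proof. by move=> f g h; apply: sfunP => x Ox; rewrite !mksfunE // addrA. Qed.
Let addC : commutative sfun_add.
Proof. by move=> f g; apply: sfunP => x Ox; rewrite !mksfunE // addrC. Qed.
Let add0 : left_id (sfun_cst 0) sfun_add.
Proof. by move=> f; apply: sfunP => x Ox; rewrite !mksfunE // add0r. Qed.
Let addN : left_inverse (sfun_cst 0) sfun_opp sfun_add.
Proof. by move=> f; apply: sfunP => x Ox; rewrite !mksfunE // addNr. Qed.
HB.instance Definition _ := GRing.isZmodule.Build sfun addA addC add0 addN.

Let mulA : associative sfun_mul.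
Proof. by move=> f g h; apply: sfunP => x Ox; rewrite !mksfunE // mulrA. Qed.
Let mulC : commutative sfun_mul.
Proof. by move=> f g; apply: sfunP => x Ox; rewrite !mksfunE // mulrC. Qed.
Let mul1 : left_id (sfun_cst 1) sfun_mul.
Proof. by move=> f; apply: sfunP => x Ox; rewrite !mksfunE // mul1r. Qed.
Let mulDl : left_distributive sfun_mul sfun_add.
Proof. by move=> f g h; apply: sfunP => x Ox; rewrite !mksfunE // mulrDl. Qed.
Let one_neq0 : sfun_cst 1 != sfun_cst 0.
Proof.
apply/eqP => /(congr1 (fun f : sfun => f (base O))); rewrite !mksfunE; try exact: baseP.
by move/eqP; rewrite oner_eq0.
Qed.
HB.instance Definition _ :=
  GRing.Zmodule_isComNzRing.Build sfun mulA mulC mul1 mulDl one_neq0.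

Lemma sfunDE (f g : sfun) x : pset O x -> (f + g) x = f x + g x.
Proof. exact: mksfunE. Qed.
Lemma sfunNE (f : sfun) x : pset O x -> (- f) x = - f x.
Proof. exact: mksfunE. Qed.
Lemma sfunME (f g : sfun) x : pset O x -> (f * g) x = f x * g x.
Proof. exact: mksfunE. Qed.
Lemma sfun1E x : pset O x -> (1 : sfun) x = 1.
Proof. exact: mksfunE. Qed.
Lemma sfun0E x : pset O x -> (0 : sfun) x = 0.
Proof. exact: mksfunE. Qed.

Definition eval (f : sfun) : R := f (base O).

Let eval_additive : zmod_morphism eval.
Proof. by move=> f g; rewrite /eval sfunDE ?sfunNE; try exact: baseP. Qed.
HB.instance Definition _ := GRing.isZmodMorphism.Build sfun R eval eval_additive.
Let eval_mult : monoid_morphism eval.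
Proof. by split=> [|f g]; rewrite /eval ?sfun1E ?sfunME //; exact: baseP. Qed.
HB.instance Definition _ := GRing.isMonoidMorphism.Build sfun R eval eval_mult.

Lemma sfun_two_regular (f : sfun) : f + f = 0 -> f = 0.
Proof.
move=> e; apply: sfunP => x Ox; rewrite sfun0E //.
have := congr1 (fun f : sfun => f x) e; rewrite sfunDE // sfun0E //; lra.
Qed.

Definition sder (v : E) (f : sfun) : sfun := mksfun (smooth_derive v (sfun_smooth f)).

Lemma sderE v (f : sfun) x : pset O x -> sder v f x = 'D_v f x.
Proof. exact: mksfunE. Qed.

Lemma sfun_derivable v (f : sfun) x : pset O x -> derivable f x v.
Proof. by move=> Ox; apply: diff_derivable; apply: smooth_differentiable (sfun_smooth f) Ox. Qed.

Lemma derive_eqO v (f g : E -> R) x : pset O x -> (forall y, pset O y -> f y = g y) ->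
  'D_v f x = 'D_v g x.
Proof.
move=> Ox fg; apply: near_eq_derive.
by apply: filterS (open_nbhs_nbhs (conj oO Ox)) => y; apply: fg.
Qed.

Lemma sder_derivation v : derivation (sder v).
Proof.
split=> f g; apply: sfunP => x Ox.
  rewrite sfunDE // !sderE // (derive_eqO _ Ox (sfunDE f g)).
  by apply: deriveD; apply: sfun_derivable.
rewrite sfunDE // !sfunME // !sderE // (derive_eqO _ Ox (sfunME f g)).
apply: etrans (deriveM _ _) _; try exact: sfun_derivable.
by rewrite addrC; congr (_ + _); exact: mulrC.
Qed.

Lemma sder_comm v w (f : sfun) : sder v (sder w f) = sder w (sder v f).
Proof.
have second a b x : pset O x -> sder a (sder b f) x = 'D_a ('D_b f) x.
  move=> Ox; apply: etrans (sderE a (sder b f) Ox) _.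
  by apply: derive_eqO Ox _ => y Oy; exact: sderE.
apply: sfunP => x Ox; apply: etrans (second v w x Ox) (etrans _ (esym (second w v x Ox))).
exact: derive_comm oO (sfun_smooth f) Ox.
Qed.

End SmoothRing.

(** * Smooth principal frames *)

Section PrincipalDirections.
Context {R : realFieldType}.

(** The symmetric bilinear form with matrix entries [a], [b], [c] on the vectors
    [(x, y)] and [(x', y')]. *)
Definition sym_form (a b c x y x' y' : R) : R := a * x * x' + b * (x * y' + y * x') + c * y * y'.

(** The vector [(v1, v2)] lies in the kernel of [h - l1 g]; normalising it gives
    the first direction.  The second one is its quarter turn for the metric [g],
    whose area element is [s]; that it belongs to [l2] follows from the trace. *)
Lemma principal_directions (g11 g12 g22 h11 h12 h22 l1 l2 v1 v2 r s : R) :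
  s ^+ 2 = g11 * g22 - g12 ^+ 2 -> r ^+ 2 = sym_form g11 g12 g22 v1 v2 v1 v2 ->
  s != 0 -> r != 0 ->
  (l1 + l2) * (g11 * g22 - g12 ^+ 2) = g22 * h11 - 2 * g12 * h12 + g11 * h22 ->
  (h11 - l1 * g11) * v1 + (h12 - l1 * g12) * v2 = 0 ->
  (h12 - l1 * g12) * v1 + (h22 - l1 * g22) * v2 = 0 ->
  let x11 := v1 / r in let x12 := v2 / r in
  let x21 := - (g12 * x11 + g22 * x12) / s in let x22 := (g11 * x11 + g12 * x12) / s in
  [/\ sym_form g11 g12 g22 x11 x12 x11 x12 = 1, sym_form g11 g12 g22 x11 x12 x21 x22 = 0,
      sym_form g11 g12 g22 x21 x22 x21 x22 = 1 & s * (x11 * x22 - x12 * x21) = 1] /\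
  [/\ sym_form h11 h12 h22 x11 x12 x11 x12 = l1, sym_form h11 h12 h22 x11 x12 x21 x22 = 0 &
      sym_form h11 h12 h22 x21 x22 x21 x22 = l2].
Proof.
move=> sE rE s0 r0 tr m1 m2 x11 x12 x21 x22.
have e1 : (h11 - l1 * g11) * x11 + (h12 - l1 * g12) * x12 = 0.
  by rewrite /x11 /x12 !mulrA -mulrDl m1 mul0r.
have e2 : (h12 - l1 * g12) * x11 + (h22 - l1 * g22) * x12 = 0.
  by rewrite /x11 /x12 !mulrA -mulrDl m2 mul0r.
have G1 : sym_form g11 g12 g22 x11 x12 x11 x12 = 1.
  transitivity (sym_form g11 g12 g22 v1 v2 v1 v2 / r ^+ 2); last by rewrite rE divff // -rE expf_neq0.
  by rewrite /sym_form /x11 /x12; field.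
have x21E : s * x21 = - (g12 * x11 + g22 * x12) by rewrite /x21 mulrC divfK.
have x22E : s * x22 = g11 * x11 + g12 * x12 by rewrite /x22 mulrC divfK.
have s2 : s ^+ 2 != 0 by rewrite expf_neq0.
move: x21 x22 x21E x22E => x21 x22 x21E x22E; move: x11 x12 e1 e2 G1 x21E x22E => x11 x12 e1 e2 G1 x21E x22E.
have G12 : sym_form g11 g12 g22 x11 x12 x21 x22 = 0.
  apply: (mulfI s0); rewrite mulr0.
  transitivity ((g11 * x11 + g12 * x12) * (s * x21) + (g12 * x11 + g22 * x12) * (s * x22)).
    by rewrite /sym_form; ring.
  by rewrite x21E x22E; ring.
have G22 : sym_form g11 g12 g22 x21 x22 x21 x22 = 1.
  apply: (mulfI s2); rewrite mulr1.
  transitivity (sym_form g11 g12 g22 (s * x21) (s * x22) (s * x21) (s * x22)).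
    by rewrite /sym_form; ring.
  rewrite x21E x22E sE -[RHS]mulr1 -G1 /sym_form; ring.
have det : s * (x11 * x22 - x12 * x21) = 1.
  transitivity (x11 * (s * x22) - x12 * (s * x21)); first by ring.
  rewrite x21E x22E -G1 /sym_form; ring.
have pencil y1 y2 : sym_form h11 h12 h22 x11 x12 y1 y2 = l1 * sym_form g11 g12 g22 x11 x12 y1 y2.
  apply/subr0_eq; transitivity (y1 * ((h11 - l1 * g11) * x11 + (h12 - l1 * g12) * x12) +
    y2 * ((h12 - l1 * g12) * x11 + (h22 - l1 * g22) * x12)); first by rewrite /sym_form; ring.
  by rewrite e1 e2 !mulr0 addr0.
have H1 : sym_form h11 h12 h22 x11 x12 x11 x12 = l1 by rewrite pencil G1 mulr1.
have H12 : sym_form h11 h12 h22 x11 x12 x21 x22 = 0 by rewrite pencil G12 mulr0.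
split=> //; split=> //.
apply: (mulfI s2).
transitivity (sym_form h11 h12 h22 (s * x21) (s * x22) (s * x21) (s * x22)).
  by rewrite /sym_form; ring.
transitivity ((g22 * h11 - 2 * g12 * h12 + g11 * h22) * sym_form g11 g12 g22 x11 x12 x11 x12
   - (g11 * g22 - g12 ^+ 2) * sym_form h11 h12 h22 x11 x12 x11 x12).
  by rewrite x21E x22E /sym_form; ring.
by rewrite G1 H1 -tr -sE; ring.
Qed.

End PrincipalDirections.

Section SmoothPrincipalFrame.
Context {R : realType} {E : normedModType R}.
Implicit Types (O : set E) (f : E -> R).

Lemma open_positive O f : open O -> smooth O f -> open [set x | O x /\ 0 < f x].
Proof.
move=> oO sf; rewrite openE => x [Ox fx]; rewrite /interior.
have n1 := open_nbhs_nbhs (conj oO Ox).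
have n2 : \forall y \near x, 0 < f y.
  exact: (cvgr_gt _ (smooth_continuous sf Ox)).
by apply: filterS2 n1 n2 => y ? ?; split.
Qed.

(** The rows of the adjugate of the singular matrix [h - l1 g] span its kernel
    and depend smoothly on the point.  At [p] one of them is nonzero, since
    otherwise [h = l1 g] and [l2 = l1]; it stays nonzero nearby. *)
Lemma smooth_principal_frame O p (g11 g12 g22 h11 h12 h22 l1 l2 : E -> R) :
  open O -> O p ->
  smooth O g11 -> smooth O g12 -> smooth O g22 ->
  smooth O h11 -> smooth O h12 -> smooth O h22 -> smooth O l1 -> smooth O l2 ->
  (forall q, O q -> 0 < g11 q) ->
  (forall q, O q -> 0 < g11 q * g22 q - g12 q ^+ 2) ->
  (forall q, O q -> (l1 q + l2 q) * (g11 q * g22 q - g12 q ^+ 2) =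
     g22 q * h11 q - 2 * g12 q * h12 q + g11 q * h22 q) ->
  (forall q, O q -> l1 q * l2 q * (g11 q * g22 q - g12 q ^+ 2) =
     h11 q * h22 q - h12 q ^+ 2) ->
  l1 p != l2 p ->
  exists O' : set E, [/\ open O', O' p, O' `<=` O &
  exists x11 x12 x21 x22 z : E -> R,
    [/\ smooth O' x11, smooth O' x12, smooth O' x21, smooth O' x22 & smooth O' z] /\
    forall q, O' q ->
    [/\ sym_form (g11 q) (g12 q) (g22 q) (x11 q) (x12 q) (x11 q) (x12 q) = 1,
        sym_form (g11 q) (g12 q) (g22 q) (x11 q) (x12 q) (x21 q) (x22 q) = 0,
        sym_form (g11 q) (g12 q) (g22 q) (x21 q) (x22 q) (x21 q) (x22 q) = 1 &
        z q * (x11 q * x22 q - x12 q * x21 q) = 1] /\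
    [/\ sym_form (h11 q) (h12 q) (h22 q) (x11 q) (x12 q) (x11 q) (x12 q) = l1 q,
        sym_form (h11 q) (h12 q) (h22 q) (x11 q) (x12 q) (x21 q) (x22 q) = 0 &
        sym_form (h11 q) (h12 q) (h22 q) (x21 q) (x22 q) (x21 q) (x22 q) = l2 q]].
Proof.
move=> oO Op sg11 sg12 sg22 sh11 sh12 sh22 sl1 sl2 g0 D0 tr det l12.
pose m11 q := h11 q + - (l1 q * g11 q).
pose m12 q := h12 q + - (l1 q * g12 q).
pose m22 q := h22 q + - (l1 q * g22 q).
have sm11 : smooth O m11 by apply: smoothD => //; apply: smoothN => //; apply: smoothM.
have sm12 : smooth O m12 by apply: smoothD => //; apply: smoothN => //; apply: smoothM.
have sm22 : smooth O m22 by apply: smoothD => //; apply: smoothN => //; apply: smoothM.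
have dm q : O q -> m11 q * m22 q - m12 q ^+ 2 = 0.
  move=> Oq; have t := tr q Oq; have d := det q Oq.
  transitivity ((h11 q * h22 q - h12 q ^+ 2) -
    l1 q * (g22 q * h11 q - 2 * g12 q * h12 q + g11 q * h22 q) +
    l1 q ^+ 2 * (g11 q * g22 q - g12 q ^+ 2)); first by rewrite /m11 /m12 /m22; ring.
  by rewrite -t -d; ring.
(* the constants select a row of the adjugate that does not vanish at [p] *)
pose al : R := (m11 p != 0)%:R.
pose be : R := (m11 p == 0)%:R.
pose v1 q := (- al) * m12 q + be * m22 q.
pose v2 q := al * m11 q + (- be) * m12 q.
have sv1 : smooth O v1.
  by apply: smoothD => //; apply: smoothM => //; apply: smooth_cst.
have sv2 : smooth O v2.
  by apply: smoothD => //; apply: smoothM => //; apply: smooth_cst.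
pose G q := g11 q * v1 q * v1 q + g12 q * (v1 q * v2 q + v2 q * v1 q) + g22 q * v2 q * v2 q.
have sG : smooth O G.
  by do ?[assumption | apply: smoothM => // | apply: smoothD => //].
have vp : (v1 p != 0) || (v2 p != 0).
  rewrite /v1 /v2 /al /be; case: (eqVneq (m11 p) 0) => [m110|m11n0] /=; last first.
    by rewrite mul1r oppr0 !mul0r !addr0 m11n0 orbT.
  rewrite oppr0 !mul0r !add0r mul1r.
  have := dm p Op; rewrite m110 mul0r sub0r => /eqP; rewrite oppr_eq0 sqrf_eq0 => /eqP m120.
  rewrite m120 mulr0 eqxx orbF; apply/eqP => m220; case/eqP: l12.
  have D0p := D0 p Op; apply: (mulIf (lt0r_neq0 D0p)).
  have := tr p Op; move: m110 m120 m220; rewrite /m11 /m12 /m22.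
  move=> /subr0_eq e1 /subr0_eq e2 /subr0_eq e3; rewrite e1 e2 e3 => e.
  by apply: (addrI (l1 p * (g11 p * g22 p - g12 p ^+ 2))); rewrite -mulrDl [RHS]addrC -mulrDl [l2 p + _]addrC e; ring.
have Gp : 0 < G p.
  rewrite -(pmulr_rgt0 _ (g0 p Op)).
  have -> : g11 p * G p = (g11 p * v1 p + g12 p * v2 p) ^+ 2
      + (g11 p * g22 p - g12 p ^+ 2) * v2 p ^+ 2 by rewrite /G; ring.
  have D0p := D0 p Op; case: (eqVneq (v2 p) 0) vp => [-> |n0 _].
    rewrite orbF mulr0 addr0 expr0n mulr0 addr0 => n1.
    by rewrite exprn_even_gt0 //= mulf_neq0 // gt_eqF // g0.
  by apply: ltr_wpDl; rewrite ?sqr_ge0 // mulr_gt0 // exprn_even_gt0.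
pose O' := [set q | O q /\ 0 < G q].
have O'O : O' `<=` O by move=> q [].
have oO' : open O' by apply: open_positive.
exists O'; split=> //.
have rest f : smooth O f -> smooth O' f by apply: smooth_sub.
pose r q := Num.sqrt (G q); pose s q := Num.sqrt (g11 q * g22 q + - (g12 q * g12 q)).
have ss : smooth O' s.
  apply: smooth_sqrt => // [q [Oq _]|]; first by rewrite -expr2; apply: D0.
  by apply: smoothD => //; [|apply: smoothN => //]; apply: smoothM => //; apply: rest.
have sr : smooth O' r by apply: smooth_sqrt => //; [move=> q []|apply: rest].
have r0 q : O' q -> r q != 0 by move=> [_ Gq]; rewrite gt_eqF // sqrtr_gt0.
have s0 q : O' q -> s q != 0.
  by move=> [Oq _]; rewrite gt_eqF // sqrtr_gt0 -expr2; apply: D0.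
have sVr := smoothV oO' r0 sr; have sVs := smoothV oO' s0 ss.
pose x11 q := v1 q / r q; pose x12 q := v2 q / r q.
have sx11 : smooth O' x11 by apply: smoothM => //; apply: rest.
have sx12 : smooth O' x12 by apply: smoothM => //; apply: rest.
pose x21 q := - (g12 q * x11 q + g22 q * x12 q) / s q.
pose x22 q := (g11 q * x11 q + g12 q * x12 q) / s q.
exists x11, x12, x21, x22, s; split.
  split=> //; apply: smoothM => //.
    by apply: smoothN => //; apply: smoothD => //; apply: smoothM => //; apply: rest.
  by apply: smoothD => //; apply: smoothM => //; apply: rest.
move=> q O'q; have Oq := O'O q O'q.
apply: principal_directions (tr q Oq) _ _; [| |exact: s0|exact: r0| |].
- have D' : 0 < g11 q * g22 q + - (g12 q * g12 q) by have := D0 q Oq; rewrite expr2.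
  by rewrite /s sqr_sqrtr ?(ltW D') // [in RHS]expr2.
- by rewrite sqr_sqrtr // ltW //; case: O'q.
- have := dm q Oq; rewrite -/(m11 q) -/(m12 q) => e.
  transitivity (be * (m11 q * m22 q - m12 q ^+ 2)); first by rewrite /v1 /v2; ring.
  by rewrite e mulr0.
- have := dm q Oq; rewrite -/(m11 q) -/(m12 q) -/(m22 q) => e.
  rewrite -/(m12 q) -/(m22 q); transitivity (al * (m11 q * m22 q - m12 q ^+ 2)).
    by rewrite /v1 /v2; ring.
  by rewrite e mulr0.
Qed.

End SmoothPrincipalFrame.

(** * Normal and curvatures of a parametrised surface *)

Section CrossProduct.
Context {R : realFieldType}.
Implicit Types u v n : 'I_3 -> R.

(** Indices are taken modulo 3. *)
Definition cross u v (k : 'I_3) : R := u (k + 1) * v (k + 2) - u (k + 2) * v (k + 1).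

Lemma sum3E (A : nmodType) (f : 'I_3 -> A) : \sum_k f k = f 0 + f 1 + f 2.
Proof.
by rewrite !big_ord_recl big_ord0 addr0 addrA; congr (_ + f _ + f _); exact: val_inj.
Qed.

Lemma ord3E : [/\ (0 + 1 = 1 :> 'I_3), (0 + 2 = 2 :> 'I_3), (1 + 1 = 2 :> 'I_3) &
  [/\ (1 + 2 = 0 :> 'I_3), (2 + 1 = 0 :> 'I_3) & (2 + 2 = 1 :> 'I_3)]].
Proof. by split=> //; try split; apply: val_inj. Qed.

Lemma ord3P (P : 'I_3 -> Prop) : P 0 -> P 1 -> P 2 -> forall k, P k.
Proof.
move=> p0 p1 p2 [[|[|[|k]]] hk] //.
- by congr P: p0; apply: val_inj.
- by congr P: p1; apply: val_inj.
- by congr P: p2; apply: val_inj.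
Qed.

Lemma lagrange u v : \sum_k cross u v k * cross u v k =
  (\sum_k u k * u k) * (\sum_k v k * v k) - (\sum_k u k * v k) ^+ 2.
Proof.
have [e1 e2 e3 [e4 e5 e6]] := ord3E.
rewrite !sum3E /cross e1 e2 e3 e4 e5 e6; ring.
Qed.

(** The double product of [u], [v] and [n] is [(u . n) v - (v . n) u = 0], so the
    cross product of [u] and [v] is parallel to [n]. *)
Lemma cross_normal u v n : \sum_k u k * n k = 0 -> \sum_k v k * n k = 0 ->
  \sum_k n k * n k = 1 ->
  let s := \sum_k n k * cross u v k in
  (forall k, cross u v k = s * n k) /\
  s ^+ 2 = (\sum_k u k * u k) * (\sum_k v k * v k) - (\sum_k u k * v k) ^+ 2.
Proof.
move=> un vn nn s.
have h : forall k, cross u v k = s * n k.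
  have [e1 e2 e3 [e4 e5 e6]] := ord3E; rewrite /s.
  move: un vn nn; rewrite !sum3E /cross => un vn nn; apply: ord3P.
  - rewrite -[LHS]mulr1 -nn !(e1, e2, e3, e4, e5, e6).
    apply/subr0_eq; transitivity ((n 1 * v 2 - n 2 * v 1) * (u 0 * n 0 + u 1 * n 1 + u 2 * n 2)
      + (n 2 * u 1 - n 1 * u 2) * (v 0 * n 0 + v 1 * n 1 + v 2 * n 2)); first by ring.
    by rewrite un vn !mulr0 addr0.
  - rewrite -[LHS]mulr1 -nn !(e1, e2, e3, e4, e5, e6).
    apply/subr0_eq; transitivity ((n 2 * v 0 - n 0 * v 2) * (u 0 * n 0 + u 1 * n 1 + u 2 * n 2)
      + (n 0 * u 2 - n 2 * u 0) * (v 0 * n 0 + v 1 * n 1 + v 2 * n 2)); first by ring.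
    by rewrite un vn !mulr0 addr0.
  - rewrite -[LHS]mulr1 -nn !(e1, e2, e3, e4, e5, e6).
    apply/subr0_eq; transitivity ((n 0 * v 1 - n 1 * v 0) * (u 0 * n 0 + u 1 * n 1 + u 2 * n 2)
      + (n 1 * u 0 - n 0 * u 1) * (v 0 * n 0 + v 1 * n 1 + v 2 * n 2)); first by ring.
    by rewrite un vn !mulr0 addr0.
split=> //; rewrite -lagrange.
under [RHS]eq_bigr do rewrite !h.
transitivity (s ^+ 2 * \sum_k n k * n k); first by rewrite nn mulr1.
by rewrite mulr_sumr; apply: eq_bigr => k _; ring.
Qed.

End CrossProduct.

Section Curvatures.
Context {R : rcfType}.

(** Here [u], [v] are the coordinate fields, [a], [b], [c] the second
    derivatives of the embedding, [n] a unit normal, and [la], [mu] the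
    curvatures it defines.  The sum of the curvatures has the sign of [T] times
    the sign of [n . N]; as it is positive, [n] is determined without choice. *)
Lemma curvatures_from_cross (u v n a b c : 'I_3 -> R) (la mu : R) :
  let D := (\sum_k u k * u k) * (\sum_k v k * v k) - (\sum_k u k * v k) ^+ 2 in
  let N := cross u v in
  let T := - ((\sum_k v k * v k) * (\sum_k a k * N k)
     - 2 * (\sum_k u k * v k) * (\sum_k b k * N k)
     + (\sum_k u k * u k) * (\sum_k c k * N k)) in
  \sum_k u k * n k = 0 -> \sum_k v k * n k = 0 -> \sum_k n k * n k = 1 -> D != 0 ->
  (la + mu) * D = (\sum_k v k * v k) * - (\sum_k a k * n k)
     - 2 * (\sum_k u k * v k) * - (\sum_k b k * n k)
     + (\sum_k u k * u k) * - (\sum_k c k * n k) ->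
  la * mu * D = (\sum_k a k * n k) * (\sum_k c k * n k) - (\sum_k b k * n k) ^+ 2 ->
  0 < la + mu ->
  [/\ 0 < D, T != 0, forall k, n k = N k * (T / (Num.sqrt (T ^+ 2) * Num.sqrt D)),
    la + mu = Num.sqrt D * Num.sqrt (T ^+ 2) / (D * D) &
    la * mu = ((\sum_k a k * N k) * (\sum_k c k * N k) - (\sum_k b k * N k) ^+ 2) / (D * D)].
Proof.
move=> D N T un vn nn D0 hH hK H0.
have [hN s2] := cross_normal un vn nn; rewrite -/N -/D in hN s2.
set s := \sum_k n k * N k in hN s2.
have Dpos : 0 < D by rewrite lt0r D0 -s2 sqr_ge0.
have s0 : s != 0 by rewrite -sqrf_eq0 s2.
have dotN (x : 'I_3 -> R) : \sum_k x k * N k = s * \sum_k x k * n k.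
  by rewrite mulr_sumr; apply: eq_bigr => k _; rewrite hN mulrCA.
have TE : T = s * ((la + mu) * D) by rewrite hH /T !dotN; ring.
have T0 : T != 0 by rewrite TE !mulf_neq0 // gt_eqF.
have sqT : Num.sqrt (T ^+ 2) = `|s| * ((la + mu) * D).
  by rewrite sqrtr_sqr TE normrM (gtr0_norm (mulr_gt0 H0 Dpos)).
have sqD : Num.sqrt D = `|s| by rewrite -s2 sqrtr_sqr.
have ns : `|s| * `|s| = D by rewrite -s2 -normrM -expr2 ger0_norm ?sqr_ge0.
have H00 : la + mu != 0 by rewrite gt_eqF.
split=> //.
- move=> k; rewrite hN sqT sqD TE.
  have -> : `|s| * ((la + mu) * D) * `|s| = s * s * ((la + mu) * D).
    by rewrite mulrAC ns -s2 expr2.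
  by field; rewrite s0 H00 D0.
- by rewrite sqD sqT mulrA ns; field.
- rewrite !dotN; transitivity (s ^+ 2 * (la * mu * D) / (D * D)).
    by rewrite s2; field.
  by rewrite hK; congr (_ / _); ring.
Qed.

End Curvatures.

(** * The evolution inequality at a non-umbilic spatial maximum *)

Section SmoothRingFacts.
Context {R : realType} {E : normedModType R}.
Variable O : pointed_open E.
Local Notation sfun := (sfun O).

Lemma sfun_sumE (I : Type) (r : seq I) (f : I -> sfun) x : pset O x ->
  (\sum_(k <- r) f k) x = \sum_(k <- r) f k x.
Proof.
move=> Ox; elim: r => [|k r IH]; first by rewrite !big_nil sfun0E.
by rewrite !big_cons sfunDE // IH.
Qed.

Lemma sder_lin (a c : R) (u v : E) (f : sfun) :
  sder (a *: u + c *: v) f = sfun_cst O a * sder u f + sfun_cst O c * sder v f.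
Proof.
apply: sfunP => x Ox; rewrite sfunDE // !sfunME // !mksfunE //.
have df := smooth_differentiable (sfun_smooth f) Ox.
by rewrite !(deriveE _ df) linearD !linearZ.
Qed.

Lemma sder_cst (v : E) (c : R) : sder v (sfun_cst O c) = 0.
Proof.
apply: sfunP => x Ox; rewrite sderE // sfun0E //.
rewrite (derive_eqO (g := cst c) v Ox); first by rewrite derive_cst.
by move=> y Oy; rewrite mksfunE.
Qed.

(** At a critical point the derivatives of the coefficients of a field drop out of
    its second derivative, so the coefficients may be frozen: what remains is the
    second derivative along a straight line. *)
Lemma eval_frame_hessian (u v : E) (x y w : sfun) :
  eval (sder u w) = 0 -> eval (sder v w) = 0 ->
  let D f := x * sder u f + y * sder v f in
  let e := eval x *: u + eval y *: v in
  eval (D (D w)) = eval (sder e (sder e w)).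
Proof.
move=> hu hv D e; rewrite /D /e !sder_lin; clear D e.
have du := sder_derivation O u; have dv := sder_derivation O v.
rewrite !(derivD du) !(derivD dv) !(derivM du) !(derivM dv) !sder_cst.
have ec c : eval (sfun_cst O c) = c by rewrite /eval mksfunE //; exact: baseP.
have [cx ecx] : exists2 c, c = sfun_cst O (eval x) & eval c = eval x by eexists; last exact: ec.
have [cy ecy] : exists2 c, c = sfun_cst O (eval y) & eval c = eval y by eexists; last exact: ec.
move: (sder u (sder u w)) (sder u (sder v w)) (sder v (sder u w)) (sder v (sder v w)).
move: (sder u x) (sder u y) (sder v x) (sder v y); rewrite -ecx -ecy.
move: (sder u w) (sder v w) hu hv => wu wv hu hv.
move=> xu yu xv yv wuu wuv wvu wvv ey ex.
clear du dv ecx ecy ec u v w.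
rewrite !(rmorphD, rmorphM, rmorph0) /= hu hv ex ey; ring.
Qed.

End SmoothRingFacts.

Section LocalFlow.
Context {R : realType} {E : normedModType R}.
Implicit Types (O : set E) (f : E -> R).

Lemma smooth_sum O (I : Type) (r : seq I) (f : I -> E -> R) : open O ->
  (forall k, smooth O (f k)) -> smooth O (fun x => \sum_(k <- r) f k x).
Proof.
move=> oO sf; elim: r => [|k r IH].
  by apply: smooth_ext (smooth_cst O 0) => // x _; rewrite big_nil.
by apply: smooth_ext (smoothD oO (sf k) IH) => // x _; rewrite big_cons.
Qed.

Definition smooth_dot O (u v : 'I_3 -> E -> R) (oO : open O)
  (su : forall k, smooth O (u k)) (sv : forall k, smooth O (v k)) :
  smooth O (fun x => \sum_k u k x * v k x) :=
  smooth_sum _ oO (fun k => smoothM oO (su k) (sv k)).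

Lemma sder_mksfun (O : pointed_open E) v f (sf : smooth O f) x : pset O x ->
  sder v (mksfun sf) x = 'D_v f x.
Proof.
move=> Ox; apply: etrans (sderE _ _ Ox) _.
by apply: derive_eqO Ox _ => y Oy; exact: mksfunE.
Qed.

Lemma sder2_mksfun (O : pointed_open E) u v f (sf : smooth O f) x : pset O x ->
  sder u (sder v (mksfun sf)) x = 'D_u ('D_v f) x.
Proof.
move=> Ox; apply: etrans (sderE _ _ Ox) _.
by apply: derive_eqO Ox _ => y Oy; exact: sder_mksfun.
Qed.

Lemma sym_form_sum (u v : 'I_3 -> R) a b a' b' :
  \sum_k (a * u k + b * v k) * (a' * u k + b' * v k) =
  sym_form (\sum_k u k * u k) (\sum_k u k * v k) (\sum_k v k * v k) a b a' b'.
Proof. by rewrite /sym_form !sum3E; ring. Qed.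

Lemma sfun_sym_formE (O : pointed_open E) (X Y X' Y' S1 S2 S3 : sfun O) q (s1 s2 s3 : R) :
  pset O q -> S1 q = s1 -> S2 q = s2 -> S3 q = s3 ->
  (X * X' * S1 + (X * Y' + Y * X') * S2 + Y * Y' * S3) q =
  - sym_form (- s1) (- s2) (- s3) (X q) (Y q) (X' q) (Y' q).
Proof.
move=> Oq <- <- <-; rewrite !(sfunDE, sfunME) // /sym_form.
by move: (X q) (Y q) (X' q) (Y' q) (S1 q) (S2 q) (S3 q) => x y x' y' a b c; ring.
Qed.

Lemma sfun_pinch_lhs (O : pointed_open E) (W A B : sfun O) q : pset O q ->
  (W * (2 * (A * A + B * B) * A * B)) q =
  W q * (2 * (A q * A q + B q * B q) * A q * B q).
Proof. by move=> Oq; rewrite !(sfunDE, sfunME, sfun1E). Qed.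

Lemma sfun_pinch_rhs (O : pointed_open E) (A B : sfun O) q : pset O q ->
  ((A + B) * (A + B) * (A + B) * ((A - B) * (A - B))) q =
  (A q + B q) * (A q + B q) * (A q + B q) * ((A q - B q) * (A q - B q)).
Proof. by move=> Oq; rewrite !(sfunDE, sfunME, sfunNE). Qed.

(** Elements of the ring of smooth functions on [O] satisfy the hypotheses of
    [flow_pinching_speed], because equations in this ring are checked pointwise. *)
Lemma framed_speed (O : pointed_open E) (b1 b2 bt : E) (F nu : 'I_3 -> E -> R)
    (x11 x12 x21 x22 z l1 l2 w : E -> R) :
  let u k := 'D_b1 (F k) in let v k := 'D_b2 (F k) in
  let p := base O in
  (forall k, smooth O (F k)) -> (forall k, smooth O (nu k)) ->
  smooth O x11 -> smooth O x12 -> smooth O x21 -> smooth O x22 -> smooth O z ->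
  smooth O l1 -> smooth O l2 -> smooth O w ->
  (forall q, pset O q -> [/\ \sum_k u k q * nu k q = 0, \sum_k v k q * nu k q = 0
     & \sum_k nu k q * nu k q = 1]) ->
  (forall q, pset O q ->
    let g := sym_form (\sum_k u k q * u k q) (\sum_k u k q * v k q) (\sum_k v k q * v k q) in
    let h := sym_form (- \sum_k 'D_b1 (u k) q * nu k q) (- \sum_k 'D_b1 (v k) q * nu k q)
      (- \sum_k 'D_b2 (v k) q * nu k q) in
    [/\ g (x11 q) (x12 q) (x11 q) (x12 q) = 1, g (x11 q) (x12 q) (x21 q) (x22 q) = 0,
       g (x21 q) (x22 q) (x21 q) (x22 q) = 1 & z q * (x11 q * x22 q - x12 q * x21 q) = 1] /\
    [/\ h (x11 q) (x12 q) (x11 q) (x12 q) = l1 q, h (x11 q) (x12 q) (x21 q) (x22 q) = 0 &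
       h (x21 q) (x22 q) (x21 q) (x22 q) = l2 q]) ->
  (forall q k, pset O q -> 'D_bt (F k) q = - ((l1 q + l2 q) ^+ 2 * nu k q)) ->
  (forall q, pset O q -> 0 < l1 q /\ 0 < l2 q) ->
  (forall q, pset O q -> w q = pinch (l1 q) (l2 q)) ->
  l1 p != l2 p ->
  (forall a b : R, line_max w p (a *: b1 + b *: b2)) ->
  'D_bt w p <= 0.
Proof.
move=> u v p sF snu sx11 sx12 sx21 sx22 sz sl1 sl2 sw orth frame flow lpos wE l12 wmax.
pose fF k := mksfun (sF k); pose fn k := mksfun (snu k).
pose X11 := mksfun sx11; pose X12 := mksfun sx12; pose X21 := mksfun sx21.
pose X22 := mksfun sx22; pose Z := mksfun sz; pose A := mksfun sl1; pose B := mksfun sl2.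
pose W := mksfun sw.
have Op : pset O p := baseP O.
have D1 := sder_derivation O b1; have D2 := sder_derivation O b2.
have Dt := sder_derivation O bt.
have wd e : derivable w p e by apply: diff_derivable; apply: smooth_differentiable sw Op.
have w1 : eval (sder b1 W) = 0.
  apply: etrans (sder_mksfun b1 sw Op) _; apply: derive_line_max => //.
  by have := wmax 1 0; rewrite scale1r scale0r addr0.
have w2 : eval (sder b2 W) = 0.
  apply: etrans (sder_mksfun b2 sw Op) _; apply: derive_line_max => //.
  by have := wmax 0 1; rewrite scale1r scale0r add0r.
have hess x y : eval (x * sder b1 (x * sder b1 W + y * sder b2 W) +
    y * sder b2 (x * sder b1 W + y * sder b2 W)) <= 0.
  rewrite (eval_frame_hessian x y w1 w2); set e := _ + _.
  rewrite -[eval _]/(sder e (sder e W) p) (sder2_mksfun e e sw Op).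
  apply: derive2_line_max (wmax _ _).
    apply: filterS (open_nbhs_nbhs (conj (pset_open O) Op)) => y' Oy'.
    by apply: diff_derivable; apply: smooth_differentiable sw Oy'.
  by apply: diff_derivable; apply: smooth_differentiable Op; apply: smooth_derive.
have grad0 x y : eval (x * sder b1 W + y * sder b2 W) = 0.
  transitivity (eval x * eval (sder b1 W) + eval y * eval (sder b2 W)).
    by rewrite rmorphD; congr (_ + _); exact: rmorphM.
  by rewrite w1 w2 !mulr0 addr0.
have ev1 : eval A = l1 p by apply: mksfunE.
have ev2 : eval B = l2 p by apply: mksfunE.
have [l1p l2p] := lpos p Op.
rewrite -(sder_mksfun bt sw Op) -[_ p]/(eval (sder bt W)).
have fu q k : pset O q -> sder b1 (fF k) q = u k q by move=> Oq; apply: sder_mksfun.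
have fv q k : pset O q -> sder b2 (fF k) q = v k q by move=> Oq; apply: sder_mksfun.
have fuu q k : pset O q -> sder b1 (sder b1 (fF k)) q = 'D_b1 (u k) q.
  by move=> Oq; apply: sder2_mksfun.
have fuv q k : pset O q -> sder b1 (sder b2 (fF k)) q = 'D_b1 (v k) q.
  by move=> Oq; apply: sder2_mksfun.
have fvv q k : pset O q -> sder b2 (sder b2 (fF k)) q = 'D_b2 (v k) q.
  by move=> Oq; apply: sder2_mksfun.
have ft q k : pset O q -> sder bt (fF k) q = 'D_bt (F k) q.
  by move=> Oq; apply: sder_mksfun.
have fnE q k : pset O q -> fn k q = nu k q by move=> Oq; apply: mksfunE.
have X11E q : pset O q -> X11 q = x11 q by apply: mksfunE.
have X12E q : pset O q -> X12 q = x12 q by apply: mksfunE.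
have X21E q : pset O q -> X21 q = x21 q by apply: mksfunE.
have X22E q : pset O q -> X22 q = x22 q by apply: mksfunE.
have ZE q : pset O q -> Z q = z q by apply: mksfunE.
have AE q : pset O q -> A q = l1 q by apply: mksfunE.
have BE q : pset O q -> B q = l2 q by apply: mksfunE.
have WE q : pset O q -> W q = w q by apply: mksfunE.
have tr q (Oq : pset O q) := (X11E q Oq, X12E q Oq, X21E q Oq, X22E q Oq).
pose ev : {rmorphism sfun O -> R} := @eval R E O.
have main := @flow_pinching_speed _ _ ev (sder b1) (sder b2) (sder bt) D1 D2 Dt
  (sder_comm b1 b2) (sder_comm bt b1) (sder_comm bt b2) (@sfun_two_regular _ _ O)
  fF fn X11 X12 X21 X22 Z A B W.
have e1 : ev A = l1 p := ev1; have e2 : ev B = l2 p := ev2.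
rewrite e1 e2 in main.
move: hess grad0 => hess grad0.
clear ev1 ev2 e1 e2 w1 w2 wd wmax D1 D2 Dt.
move: fF fn X11 X12 X21 X22 Z A B W fu fv fuu fuv fvv ft fnE X11E X12E X21E X22E ZE AE BE WE tr main hess grad0.
move=> f n X11 X12 X21 X22 Z A B W fu fv fuu fuv fvv ft fnE X11E X12E X21E X22E ZE AE BE WE tr main hess grad0.
have dot (h h' : 'I_3 -> sfun O) q (Oq : pset O q) :
    (\sum_k h k * h' k) q = \sum_k h k q * h' k q.
  by rewrite sfun_sumE //; apply: eq_bigr => k _; rewrite sfunME.
have combo (X Y : sfun O) k q (Oq : pset O q) :
    (X * sder b1 (f k) + Y * sder b2 (f k)) q = X q * u k q + Y q * v k q.
  by rewrite (sfunDE _ _ Oq) !(sfunME _ _ Oq) (fu q k Oq) (fv q k Oq).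
have gram (X Y X' Y' : sfun O) q (Oq : pset O q) :
  (\sum_k (X * sder b1 (f k) + Y * sder b2 (f k)) * (X' * sder b1 (f k) + Y' * sder b2 (f k))) q
  = sym_form (\sum_k u k q * u k q) (\sum_k u k q * v k q) (\sum_k v k q * v k q) (X q) (Y q) (X' q) (Y' q).
  rewrite (dot _ _ q Oq) -sym_form_sum; apply: eq_bigr => k _.
  by rewrite (combo X Y k q Oq) (combo X' Y' k q Oq).
have sec (X Y X' Y' : sfun O) q (Oq : pset O q) :
  (X * X' * (\sum_k sder b1 (sder b1 (f k)) * n k) +
   (X * Y' + Y * X') * (\sum_k sder b1 (sder b2 (f k)) * n k) +
   Y * Y' * (\sum_k sder b2 (sder b2 (f k)) * n k)) q =
  - sym_form (- \sum_k 'D_b1 (u k) q * nu k q) (- \sum_k 'D_b1 (v k) q * nu k q)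
      (- \sum_k 'D_b2 (v k) q * nu k q) (X q) (Y q) (X' q) (Y' q).
  have s1 : (\sum_k sder b1 (sder b1 (f k)) * n k) q = \sum_k 'D_b1 (u k) q * nu k q.
    by rewrite (dot _ _ q Oq); apply: eq_bigr => k _; rewrite (fuu q k Oq) (fnE q k Oq).
  have s2 : (\sum_k sder b1 (sder b2 (f k)) * n k) q = \sum_k 'D_b1 (v k) q * nu k q.
    by rewrite (dot _ _ q Oq); apply: eq_bigr => k _; rewrite (fuv q k Oq) (fnE q k Oq).
  have s3 : (\sum_k sder b2 (sder b2 (f k)) * n k) q = \sum_k 'D_b2 (v k) q * nu k q.
    by rewrite (dot _ _ q Oq); apply: eq_bigr => k _; rewrite (fvv q k Oq) (fnE q k Oq).
  exact: (sfun_sym_formE X Y X' Y' Oq s1 s2 s3).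
refine (main _ _ _ _ _ _ _ _ _ _ _ _ l1p l2p l12 (grad0 _ _) (grad0 _ _) (hess _ _) (hess _ _)).
- apply: sfunP => q Oq; have [[_ _ _ e] _] := frame q Oq.
  rewrite (sfunME _ _ Oq) (sfunDE _ _ Oq) (sfunNE _ Oq) !(sfunME _ _ Oq).
  by rewrite (ZE q Oq) !(tr q Oq) (sfun1E Oq).
- apply: sfunP => q Oq; have [[e _ _ _] _] := frame q Oq.
  by rewrite (gram _ _ _ _ q Oq) !(tr q Oq) (sfun1E Oq).
- apply: sfunP => q Oq; have [[_ e _ _] _] := frame q Oq.
  by rewrite (gram _ _ _ _ q Oq) !(tr q Oq) (sfun0E Oq).
- apply: sfunP => q Oq; have [[_ _ e _] _] := frame q Oq.
  by rewrite (gram _ _ _ _ q Oq) !(tr q Oq) (sfun1E Oq).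
- apply: sfunP => q Oq; have [_ _ e] := orth q Oq.
  by rewrite (dot _ _ q Oq) (sfun1E Oq) -[RHS]e; apply: eq_bigr => k _; rewrite !(fnE q k Oq).
- apply: sfunP => q Oq; have [e _ _] := orth q Oq.
  rewrite (dot _ _ q Oq) (sfun0E Oq) -[RHS]e; apply: eq_bigr => k _.
  by rewrite (fnE q k Oq) (fu q k Oq).
- apply: sfunP => q Oq; have [_ e _] := orth q Oq.
  rewrite (dot _ _ q Oq) (sfun0E Oq) -[RHS]e; apply: eq_bigr => k _.
  by rewrite (fnE q k Oq) (fv q k Oq).
- apply: sfunP => q Oq; have [_ [e _ _]] := frame q Oq.
  by rewrite (sec _ _ _ _ q Oq) !(tr q Oq) (sfunNE _ Oq) (AE q Oq) e.
- apply: sfunP => q Oq; have [_ [_ e _]] := frame q Oq.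
  by rewrite (sec _ _ _ _ q Oq) !(tr q Oq) (sfun0E Oq) e oppr0.
- apply: sfunP => q Oq; have [_ [_ _ e]] := frame q Oq.
  by rewrite (sec _ _ _ _ q Oq) !(tr q Oq) (sfunNE _ Oq) (BE q Oq) e.
- move=> k; apply: sfunP => q Oq.
  rewrite (ft q k Oq) (flow q k Oq) (sfunNE _ Oq) !(sfunME _ _ Oq) !(sfunDE _ _ Oq).
  by rewrite (AE q Oq) (BE q Oq) (fnE q k Oq) expr2.
- apply: sfunP => q Oq; have [a0 b0] := lpos q Oq.
  rewrite (sfun_pinch_lhs W A B Oq) (sfun_pinch_rhs A B Oq).
  rewrite (AE q Oq) (BE q Oq) (WE q Oq) (wE q Oq) /pinch.
  move: (l1 q) (l2 q) a0 b0 => x y x0 y0; field.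
  by rewrite ?gt_eqF ?addr_gt0 ?exprn_gt0.
Qed.

End LocalFlow.

Section LocalSpeed.
Context {R : realType} {E : normedModType R}.
Implicit Types (O : set E) (f : E -> R).

(** The given curvatures come in no particular order and may swap from point to
    point; the larger and the smaller root are smooth where they differ, and
    [pinch] does not see the order. *)
Lemma sorted_roots (la mu : R) :
  let H := la + mu in let K := la * mu in let d := Num.sqrt (H ^+ 2 - 4 * K) in
  pinch la mu = pinch ((H + d) / 2) ((H - d) / 2) /\
  (0 < la -> 0 < mu -> 0 < (H + d) / 2 /\ 0 < (H - d) / 2).
Proof.
move=> H K d.
have dE : d = `|la - mu|.
  by rewrite /d -sqrtr_sqr; congr Num.sqrt; rewrite /H /K; ring.
rewrite dE /H; case: (lerP mu la) => h.
  have -> : (la + mu + (la - mu)) / 2 = la by field.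
  by have -> : (la + mu - (la - mu)) / 2 = mu by field.
have -> : (la + mu + (mu - la)) / 2 = mu by field.
have -> : (la + mu - (mu - la)) / 2 = la by field.
by split=> [|? ?]; [rewrite pinchC|].
Qed.

(** The normal and the sum and product of the curvatures are given by smooth
    expressions in the derivatives of [F], hence the ordered curvatures are
    smooth near the non-umbilic point [p], and a smooth principal frame exists
    there. *)
Lemma local_speed O p (b1 b2 bt : E) (F : 'I_3 -> E -> R) (nu : E -> 'I_3 -> R)
    (la mu : E -> R) :
  let u k := 'D_b1 (F k) in let v k := 'D_b2 (F k) in
  let g11 q := \sum_k u k q * u k q in
  let g12 q := \sum_k u k q * v k q in
  let g22 q := \sum_k v k q * v k q in
  let h11 q := - \sum_k 'D_b1 (u k) q * nu q k in
  let h12 q := - \sum_k 'D_b1 (v k) q * nu q k in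
  let h22 q := - \sum_k 'D_b2 (v k) q * nu q k in
  let w q := pinch (la q) (mu q) in
  open O -> O p -> (forall k, smooth O (F k)) ->
  (forall q, O q -> [/\ \sum_k u k q * nu q k = 0, \sum_k v k q * nu q k = 0
     & \sum_k nu q k * nu q k = 1]) ->
  (forall q, O q -> g11 q * g22 q - g12 q ^+ 2 != 0) ->
  (forall q, O q -> (la q + mu q) * (g11 q * g22 q - g12 q ^+ 2) =
     g22 q * h11 q - 2 * g12 q * h12 q + g11 q * h22 q) ->
  (forall q, O q -> la q * mu q * (g11 q * g22 q - g12 q ^+ 2) =
     h11 q * h22 q - h12 q ^+ 2) ->
  (forall q, O q -> 0 < la q /\ 0 < mu q) ->
  (forall q k, O q -> 'D_bt (F k) q = - ((la q + mu q) ^+ 2 * nu q k)) ->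
  la p != mu p ->
  (forall a b : R, line_max w p (a *: b1 + b *: b2)) ->
  derivable w p bt /\ 'D_bt w p <= 0.
Proof.
move=> u v g11 g12 g22 h11 h12 h22 w oO Op sF orth D0 hH hK pos flow lamu wmax.
have su k : smooth O (u k) by apply: smooth_derive.
have sv k : smooth O (v k) by apply: smooth_derive.
have sa k : smooth O ('D_b1 (u k)) by apply: smooth_derive.
have sb k : smooth O ('D_b1 (v k)) by apply: smooth_derive.
have sc k : smooth O ('D_b2 (v k)) by apply: smooth_derive.
have sg11 : smooth O g11 := smooth_dot oO su su.
have sg12 : smooth O g12 := smooth_dot oO su sv.
have sg22 : smooth O g22 := smooth_dot oO sv sv.
pose N k q := cross (u^~ q) (v^~ q) k.
have sN k : smooth O (N k).
  rewrite /N /cross; apply: smoothD => //; first exact: smoothM.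
  by apply: smoothN => //; apply: smoothM.
pose D q := g11 q * g22 q + - (g12 q * g12 q).
have DE q : D q = g11 q * g22 q - g12 q ^+ 2 by rewrite /D expr2.
have sD : smooth O D.
  by apply: smoothD => //; [exact: smoothM|apply: smoothN => //; exact: smoothM].
pose La q := \sum_k 'D_b1 (u k) q * N k q.
pose Lb q := \sum_k 'D_b1 (v k) q * N k q.
pose Lc q := \sum_k 'D_b2 (v k) q * N k q.
have sLa : smooth O La := smooth_dot oO sa sN.
have sLb : smooth O Lb := smooth_dot oO sb sN.
have sLc : smooth O Lc := smooth_dot oO sc sN.
pose T q := - (g22 q * La q - 2 * g12 q * Lb q + g11 q * Lc q).
have sT : smooth O T.
  apply: smoothN => //; apply: smoothD => //; last exact: smoothM.
  apply: smoothD => //; first exact: smoothM.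
  apply: smoothN => //; apply: smoothM => //; apply: smoothM => //; exact: smooth_cst.
have facts q : O q -> [/\ 0 < D q, T q != 0,
    forall k, nu q k = N k q * (T q / (Num.sqrt (T q ^+ 2) * Num.sqrt (D q))),
    la q + mu q = Num.sqrt (D q) * Num.sqrt (T q ^+ 2) / (D q * D q) &
    la q * mu q = (La q * Lc q - Lb q ^+ 2) / (D q * D q)].
  move=> Oq; have [un vn nn] := orth q Oq; have [la0 mu0] := pos q Oq.
  have := @curvatures_from_cross R (u^~ q) (v^~ q) (nu q) (fun k => 'D_b1 (u k) q)
    (fun k => 'D_b1 (v k) q) (fun k => 'D_b2 (v k) q) (la q) (mu q).
  rewrite DE; apply => //; first exact: D0.
  - exact: hH.
  - by rewrite (hK q Oq) /h11 /h12 /h22 mulrNN sqrrN.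
  - exact: addr_gt0.
have D1 q : O q -> 0 < D q by move=> /facts[].
have T2 q : O q -> 0 < T q * T q.
  by move=> /facts[_ T0 _ _ _]; rewrite -expr2 lt0r sqr_ge0 sqrf_eq0 T0.
have ssD : smooth O (fun q => Num.sqrt (D q)) by apply: smooth_sqrt.
have ssT : smooth O (fun q => Num.sqrt (T q * T q)).
  by apply: smooth_sqrt => //; exact: smoothM.
have sD0 q : O q -> Num.sqrt (D q) != 0 by move=> /D1 ?; rewrite gt_eqF ?sqrtr_gt0.
have sT0 q : O q -> Num.sqrt (T q * T q) != 0 by move=> /T2 ?; rewrite gt_eqF ?sqrtr_gt0.
have sVDD : smooth O (fun q => (D q * D q)^-1).
  apply: smoothV => //; last exact: smoothM.
  by move=> q /D1 ?; rewrite mulf_neq0 // gt_eqF.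
pose n k q := N k q * (T q * (Num.sqrt (T q * T q) * Num.sqrt (D q))^-1).
have sn k : smooth O (n k).
  apply: smoothM => //; apply: smoothM => //; apply: smoothV => //.
    by move=> q Oq; rewrite mulf_neq0 ?sD0 ?sT0.
  exact: smoothM.
have nE q k : O q -> nu q k = n k q by move=> /facts[_ _ h _ _]; rewrite h /n expr2.
pose H q := Num.sqrt (D q) * Num.sqrt (T q * T q) * (D q * D q)^-1.
pose K q := (La q * Lc q + - (Lb q * Lb q)) * (D q * D q)^-1.
have HE q : O q -> la q + mu q = H q by move=> /facts[_ _ _ h _]; rewrite h /H expr2.
have KE q : O q -> la q * mu q = K q by move=> /facts[_ _ _ _ h]; rewrite h /K expr2.
have sH : smooth O H by apply: smoothM => //; exact: smoothM.
have sK : smooth O K.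
  apply: smoothM => //; apply: smoothD => //; first exact: smoothM.
  by apply: smoothN => //; exact: smoothM.
pose disc q := H q * H q + - (4 * K q).
have discE q : O q -> disc q = (la q - mu q) ^+ 2.
  by move=> Oq; rewrite /disc -HE // -KE //; ring.
have sdisc : smooth O disc.
  apply: smoothD => //; first exact: smoothM.
  by apply: smoothN => //; apply: smoothM => //; exact: smooth_cst.
pose O1 := [set q | O q /\ 0 < disc q].
have oO1 : open O1 by apply: open_positive.
have O1O : O1 `<=` O by move=> q [].
have O1p : O1 p by split=> //; rewrite discE // lt0r sqrf_eq0 subr_eq0 lamu sqr_ge0.
pose d q := Num.sqrt (disc q).
have sd : smooth O1 d.
  by apply: smooth_sqrt => // [q []|]; last exact: smooth_sub sdisc.
pose l1 q := (H q + d q) * 2^-1; pose l2 q := (H q + - d q) * 2^-1.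
have sH1 := smooth_sub O1O sH.
have sl1 : smooth O1 l1.
  by apply: smoothM => //; [exact: smoothD|exact: smooth_cst].
have sl2 : smooth O1 l2.
  by apply: smoothM => //; [apply: smoothD => //; exact: smoothN|exact: smooth_cst].
have lsum q : l1 q + l2 q = H q by rewrite /l1 /l2; field.
have lprod q : O1 q -> l1 q * l2 q = K q.
  move=> [Oq dq]; have := sqr_sqrtr (ltW dq); rewrite -/(d q) /disc => e.
  transitivity ((H q * H q - d q ^+ 2) / 4); first by rewrite /l1 /l2; field.
  by rewrite e; field.
have roots q : O q -> w q = pinch (l1 q) (l2 q) /\ (0 < l1 q /\ 0 < l2 q).
  move=> Oq; have [e pp] := sorted_roots (la q) (mu q); have [la0 mu0] := pos q Oq.
  have dE : d q = Num.sqrt ((la q + mu q) ^+ 2 - 4 * (la q * mu q)).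
    by rewrite /d /disc HE // KE // expr2.
  by rewrite /l1 /l2 -HE // dE; split; [exact: e|exact: pp].
have sub f : smooth O f -> smooth O1 f := smooth_sub O1O.
have l12 : l1 p != l2 p.
  have dp : 0 < d p by rewrite sqrtr_gt0; case: O1p.
  rewrite -subr_eq0; have -> : l1 p - l2 p = d p by rewrite /l1 /l2; field.
  by rewrite gt_eqF.
have g11pos q : O q -> 0 < g11 q.
  move=> Oq; rewrite lt0r sumr_ge0 ?andbT; last by move=> k _; rewrite -expr2 sqr_ge0.
  apply/eqP => g0; have := D1 q Oq; rewrite DE g0 mul0r sub0r oppr_gt0.
  by rewrite ltNge sqr_ge0.
have hn (a : 'I_3 -> E -> R) q : O q -> \sum_k a k q * nu q k = \sum_k a k q * n k q.
  by move=> Oq; apply: eq_bigr => k _; rewrite nE.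
pose k11 q := - \sum_k 'D_b1 (u k) q * n k q.
pose k12 q := - \sum_k 'D_b1 (v k) q * n k q.
pose k22 q := - \sum_k 'D_b2 (v k) q * n k q.
have sk11 : smooth O1 k11 by apply: sub; apply: smoothN => //; exact: (smooth_dot oO sa sn).
have sk12 : smooth O1 k12 by apply: sub; apply: smoothN => //; exact: (smooth_dot oO sb sn).
have sk22 : smooth O1 k22 by apply: sub; apply: smoothN => //; exact: (smooth_dot oO sc sn).
have k11E q : O q -> h11 q = k11 q.
  by move=> Oq; rewrite /h11 (hn (fun k => 'D_b1 (u k)) q Oq).
have k12E q : O q -> h12 q = k12 q.
  by move=> Oq; rewrite /h12 (hn (fun k => 'D_b1 (v k)) q Oq).
have k22E q : O q -> h22 q = k22 q.
  by move=> Oq; rewrite /h22 (hn (fun k => 'D_b2 (v k)) q Oq).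
have main :
  exists O' : set E, [/\ open O', O' p, O' `<=` O1 &
  exists x11 x12 x21 x22 z : E -> R,
    [/\ smooth O' x11, smooth O' x12, smooth O' x21, smooth O' x22 & smooth O' z] /\
    forall q, O' q ->
    [/\ sym_form (g11 q) (g12 q) (g22 q) (x11 q) (x12 q) (x11 q) (x12 q) = 1,
        sym_form (g11 q) (g12 q) (g22 q) (x11 q) (x12 q) (x21 q) (x22 q) = 0,
        sym_form (g11 q) (g12 q) (g22 q) (x21 q) (x22 q) (x21 q) (x22 q) = 1 &
        z q * (x11 q * x22 q - x12 q * x21 q) = 1] /\
    [/\ sym_form (k11 q) (k12 q) (k22 q) (x11 q) (x12 q) (x11 q) (x12 q) = l1 q,
        sym_form (k11 q) (k12 q) (k22 q) (x11 q) (x12 q) (x21 q) (x22 q) = 0 &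
        sym_form (k11 q) (k12 q) (k22 q) (x21 q) (x22 q) (x21 q) (x22 q) = l2 q]].
  apply: smooth_principal_frame => //; try exact: sub.
  - by move=> q /O1O; exact: g11pos.
  - by move=> q /O1O Oq; rewrite -DE; exact: D1.
  - by move=> q /O1O Oq; rewrite lsum -HE // hH // k11E // k12E // k22E.
  - by move=> q O1q; have Oq := O1O q O1q; rewrite lprod // -KE // hK // k11E // k12E // k22E.
have [V [oO' O'p O'1 [x11 [x12 [x21 [x22 [z [[s1 s2 s3 s4 s5] frame]]]]]]]] := main.
have O'O : V `<=` O by move=> q /O'1 /O1O.
pose P := PointedOpen oO' O'p.
pose W q := pinch (l1 q) (l2 q).
have wW q : O q -> w q = W q by move=> /roots[].
have res f : smooth O1 f -> smooth V f := smooth_sub O'1.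
have sW : smooth V W.
  have a1 := res _ sl1; have a2 := res _ sl2.
  have pw : smooth V (fun q => (l1 q + l2 q) * (l1 q + l2 q) * (l1 q + l2 q) *
     ((l1 q + - l2 q) * (l1 q + - l2 q)) *
     (2 * (l1 q * l1 q + l2 q * l2 q) * l1 q * l2 q)^-1).
    have b1' : smooth V (fun q => l1 q + l2 q) by exact: smoothD.
    have b2' : smooth V (fun q => l1 q + - l2 q) by apply: smoothD => //; exact: smoothN.
    apply: smoothM => //.
      by apply: smoothM => //; [apply: smoothM => //; exact: smoothM|exact: smoothM].
    apply: smoothV => //.
      move=> q /O'O Oq; have [_ [l10 l20]] := roots q Oq.
      have p2 : 0 < l1 q * l1 q + l2 q * l2 q by apply: addr_gt0; apply: mulr_gt0.
      apply: lt0r_neq0; apply: mulr_gt0 => //; apply: mulr_gt0 => //; exact: mulr_gt0.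
    apply: smoothM => //; apply: smoothM => //; apply: smoothM => //; first exact: smooth_cst.
    by apply: smoothD => //; exact: smoothM.
  apply: smooth_ext pw => // q _; rewrite /W /pinch; congr (_ / _); ring.
have nw : \forall y \near p, w y = W y.
  by apply: filterS (open_nbhs_nbhs (conj oO Op)) => y; exact: wW.
have dW : derivable W p bt by apply: diff_derivable; exact: smooth_differentiable sW O'p.
split.
  apply: (near_eq_derivable _ dW).
  by apply: filterS nw => y ->.
rewrite (near_eq_derive _ nw).
apply: (@framed_speed _ _ P b1 b2 bt F n x11 x12 x21 x22 z l1 l2 W) => //.
- by move=> k; exact: smooth_sub (sF k).
- by move=> k; exact: smooth_sub (sn k).
- exact: res.
- exact: res.
- move=> q /O'O Oq; have [e1 e2 e3] := orth q Oq; split.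
  + by rewrite -(hn u q Oq).
  + by rewrite -(hn v q Oq).
  + by rewrite -e3; apply: eq_bigr => k _; rewrite nE.
- by move=> q k /O'O Oq; rewrite flow // lsum -HE // nE.
- by move=> q /O'O Oq; have [] := roots q Oq.
- move=> a b; have [r r0 hr] := wmax a b.
  have [r' r'0 hr'] : exists2 r' : R, 0 < r' & forall h : R, `|h| < r' -> O (p + h *: (a *: b1 + b *: b2)).
    set e := _ + _.
    have /nbhs_ballP[r' r'0 hr'] := open_nbhs_nbhs (conj oO Op).
    exists (r' / (`|e| + 1)); first by rewrite divr_gt0 // ltr_wpDl.
    move=> h; rewrite ltr_pdivlMr ?ltr_wpDl // => hh; apply: hr'.
    rewrite -ball_normE /= opprD addNKr normrN normrZ; apply: le_lt_trans hh.
    by rewrite ler_wpM2l // lerDl.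
  exists (Num.min r r'); first by rewrite lt_min r0.
  move=> h; rewrite lt_min => /andP[h1 h2].
  by rewrite -!wW //; [exact: hr|exact: hr'].
Qed.

End LocalSpeed.

(** * Local representations of a family of surfaces *)

Section SmoothOn.
Context {R : realType}.

Lemma diff_within_open (E F : normedModType R) (D O : set E) (f : E -> F) x
    (df : {linear E -> F}) : open O -> O `<=` D -> O x -> diff_within D f x df ->
  differentiable f x /\ 'd f x = df :> (E -> F).
Proof.
move=> oO OD Ox [cdf h]; apply: differential_eps => // eps eps0.
have := h eps eps0; rewrite near_withinE => h'.
by apply: filterS2 (open_nbhs_nbhs (conj oO Ox)) h' => y /OD Dy; apply.
Qed.

Lemma coord_derive (E : normedModType R) n (f : E -> 'rV[R]_n) x v i : derivable f x v ->
  'D_v (fun y => f y 0 i) x = ('D_v f x) 0 i.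
Proof. by move=> df; rewrite (derive_mx df) mxE. Qed.

Lemma coord_differentiable (E : normedModType R) n (f : E -> 'rV[R]_n) x i :
  differentiable f x -> differentiable (fun y => f y 0 i) x.
Proof.
move=> df; apply: (@differentiable_comp _ _ _ _ f (fun N : 'rV[R]_n => N 0 i)) => //.
exact: differentiable_coord.
Qed.

Lemma Ck_on_coord (E : normedModType R) n k (D O : set E) (f : E -> 'rV[R]_n) i :
  open O -> O `<=` D -> Ck_on k D f -> Cn k O (fun y => f y 0 i).
Proof.
move=> oO OD; elim: k f => [|k IH] f /=.
  move=> /subspace_continuousP cf x Ox.
  apply: (@continuous_comp _ _ _ f (fun N : 'rV[R]_n => N 0 i)); last exact: coord_continuous.
  have := cf x (OD x Ox) => cfx A /cfx; rewrite /= nbhs_simpl /within /= => hA.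
  by apply: filterS2 (open_nbhs_nbhs (conj oO Ox)) hA => y /OD Dy; apply.
move=> [df [hd hc]].
have hdf x : O x -> differentiable f x /\ 'd f x = df x :> (E -> _).
  by move=> Ox; apply: diff_within_open oO OD Ox (hd x (OD x Ox)).
split=> [x Ox|v]; first by apply: coord_differentiable; have [] := hdf x Ox.
apply: Cn_ext (IH _ (hc v)) => // x Ox.
have [d e] := hdf x Ox.
by rewrite (coord_derive i (diff_derivable d)) deriveE // e.
Qed.

Lemma smooth_on_coord (E : normedModType R) n (D O : set E) (f : E -> 'rV[R]_n) i :
  open O -> O `<=` D -> smooth_on D f -> smooth O (fun y => f y 0 i).
Proof. by move=> oO OD sf k; apply: Ck_on_coord (sf k). Qed.

Lemma smooth_on_differentiable (E F : normedModType R) (D : set E) (f : E -> F) x :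
  open D -> D x -> smooth_on D f -> differentiable f x.
Proof.
move=> oD Dx sf; have [df [hd _]] := sf 1%N.
by have [] := diff_within_open oD (@subset_refl _ D) Dx (hd x Dx).
Qed.

(** Spatial derivatives of a time slice are values of the differential of the
    family, including at time 0 where this differential is one-sided in time. *)
Lemma slice_derive (E F : normedModType R) (U : set E) (I : set R) (f : (E * R)%type -> F)
    (u v : E) (t : R) (df : {linear (E * R)%type -> F}) : open U -> U u -> I t ->
  diff_within (U `*` I) f (u, t) df ->
  'D_v (fun y => f (y, t)) u = df (v, 0).
Proof.
move=> oU Uu It [_ h].
apply/cvg_lim => //; apply/cvgrPdist_le => eps eps0.
have n0 : 0 < `|v| + 1 by rewrite ltr_wpDl.
have e0 : 0 < eps / (`|v| + 1) by rewrite divr_gt0.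
have := h _ e0; rewrite near_withinE => /nbhs_ballP[r r0 hr].
have /nbhs_ballP[r' r'0 hr'] := open_nbhs_nbhs (conj oU Uu).
have m0 : 0 < Num.min r r' / (`|v| + 1) by rewrite divr_gt0 // lt_min r0.
near=> k.
have k0 : k != 0 by near: k; exact: nbhs_dnbhs_neq.
have : `|k| < Num.min r r' / (`|v| + 1) by near: k; apply: dnbhs0_lt.
rewrite ltr_pdivlMr // lt_min => /andP[k1 k2].
have kv : `|k *: v| <= `|k| * (`|v| + 1) by rewrite normrZ ler_wpM2l // lerDl.
have pE : (k *: v + u, t) - (u, t) = k *: (v, 0) :> (E * R)%type.
  by apply/pair_equal_spec; rewrite /= addrK subrr scaler0.
have nE : `|k *: (v, 0) : (E * R)%type| = `|k *: v|.
  by rewrite prod_normE /= scaler0 normr0; apply/max_idPl.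
have hb : ball (u, t) r (k *: v + u, t).
  split; last exact: ballxx.
  rewrite -ball_normE /= opprD addrCA subrr addr0 normrN; exact: le_lt_trans k1.
have UIk : (U `*` I) (k *: v + u, t).
  split=> //=; apply: hr'; rewrite -ball_normE /= opprD addrCA subrr addr0 normrN.
  exact: le_lt_trans k2.
have := hr _ hb UIk; rewrite pE nE linearZ /= => hk.
rewrite distrC -[X in _ - X](scalerK k0) [X in _ - _ *: X]/= -scalerBr normrZ normfV.
rewrite ler_pdivrMl ?normr_gt0 //; apply: le_trans hk _.
rewrite normrZ mulrCA -ler_pdivlMl ?normr_gt0 // mulKf ?normr_eq0 //.
by rewrite mulrAC ler_pdivrMr // ler_wpM2l ?(ltW eps0) // lerDl.
Unshelve. all: by end_near. Qed.

End SmoothOn.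

Section TwoByTwo.

Lemma det_mx22 (R : comNzRingType) (S : 'M[R]_2) : \det S = S 0 0 * S 1 1 - S 0 1 * S 1 0.
Proof.
rewrite (expand_det_row _ 0) !big_ord_recl big_ord0 addr0 /cofactor !det_mx11 !mxE /=.
have -> : lift 0 0 = 1 :> 'I_2 by apply: val_inj.
have -> : lift (1 : 'I_2) 0 = 0 :> 'I_2 by apply: val_inj.
by rewrite expr0 expr1 mul1r mulN1r mulrN.
Qed.

Lemma mxtrace22 (R : nzRingType) (S : 'M[R]_2) : \tr S = S 0 0 + S 1 1.
Proof.
rewrite /mxtrace !big_ord_recl big_ord0 addr0.
by have -> : lift 0 0 = 1 :> 'I_2 by apply: val_inj.
Qed.

Lemma char_poly_roots2 (R : fieldType) (S : 'M[R]_2) (l1 l2 : R) :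
  char_poly S = ('X - l1%:P) * ('X - l2%:P) -> l1 + l2 = \tr S /\ l1 * l2 = \det S.
Proof.
move=> e; split.
  have := char_poly_trace S (isT : 0 < 2)%N; rewrite e => /(congr1 -%R); rewrite opprK => <-.
  by rewrite mulrBl !mulrBr -polyCM !coefB coefCM coefMC coefXM !coefX coefC /=; ring.
have := char_poly_det S; rewrite e sqrrN expr1n mul1r => <-.
by rewrite mulrBl !mulrBr -polyCM !coefB coefCM coefMC coefXM !coefX coefC /=; ring.
Qed.

(** With [S = invmx g *m h], the relation [h = g *m S] expresses the right hand
    sides through the trace and the determinant of [S]. *)
Lemma pencil_roots (R : fieldType) (g h : 'M[R]_2) (l1 l2 : R) : \det g != 0 ->
  char_poly (invmx g *m h) = ('X - l1%:P) * ('X - l2%:P) ->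
  (l1 + l2) * \det g = g 1 1 * h 0 0 - g 0 1 * h 1 0 - g 1 0 * h 0 1 + g 0 0 * h 1 1 /\
  l1 * l2 * \det g = h 0 0 * h 1 1 - h 0 1 * h 1 0.
Proof.
move=> dg /char_poly_roots2[-> ->].
have gu : g \in unitmx by rewrite unitmxE unitfE.
set S := invmx g *m h.
have hE : h = g *m S by rewrite /S mulKVmx.
split; last by rewrite mulrC -det_mulmx -hE det_mx22.
have e i j : h i j = g i 0 * S 0 j + g i 1 * S 1 j.
  rewrite {1}hE mxE !big_ord_recl big_ord0 addr0.
  by have -> : lift 0 0 = 1 :> 'I_2 by apply: val_inj.
by rewrite !e det_mx22 mxtrace22; ring.
Qed.

End TwoByTwo.

(** The squared length of this combination is [g11] times the Gram determinant. *)
Lemma gram_degenerate (R : realFieldType) n (a b : 'I_n -> R) (k : 'I_n) :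
  let g11 := \sum_k a k * a k in let g12 := \sum_k a k * b k in
  let g22 := \sum_k b k * b k in
  g11 * g22 - g12 ^+ 2 = 0 -> g12 * a k - g11 * b k = 0.
Proof.
move=> g11 g12 g22 g0.
have expand (p q : R) : \sum_k (p * a k - q * b k) ^+ 2 =
    p ^+ 2 * g11 - 2 * (p * q) * g12 + q ^+ 2 * g22.
  rewrite /g11 /g12 /g22 !mulr_sumr -sumrB -big_split; apply: eq_bigr => i _ /=; ring.
have : \sum_k (g12 * a k - g11 * b k) ^+ 2 = 0.
  rewrite expand; transitivity (g11 * (g11 * g22 - g12 ^+ 2)); last by rewrite g0 mulr0.
  by move: g11 g12 g22 {g0 expand} => p q r; ring.
move/eqP; rewrite psumr_eq0; last by move=> i _; exact: sqr_ge0.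
by move=> /allP/(_ k (mem_index_enum k))/=; rewrite sqrf_eq0 => /eqP.
Qed.

Section ChartData.
Context {R : realType} {M : topologicalType}.

Lemma first_formE (F : 'rV[R]_2 -> 'rV[R]_3) u i j : first_form F u i j =
  \sum_k ('D_(basis_vec R i) F u) 0 k * ('D_(basis_vec R j) F u) 0 k.
Proof. by rewrite mxE. Qed.

Lemma second_formE (F : 'rV[R]_2 -> 'rV[R]_3) n u i j : second_form F n u i j =
  - \sum_k ('D_(basis_vec R i) (fun v => 'D_(basis_vec R j) F v) u) 0 k * n 0 k.
Proof. by rewrite mxE. Qed.

Lemma linear_combo (U V : lmodType R) (f : {linear U -> V}) (p q : R) (x y : U) :
  f (p *: x - q *: y) = p *: f x - q *: f y.
Proof. by rewrite linearB !linearZ. Qed.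

Lemma row_combo n (p q : R) (v w : 'rV[R]_n) : (forall k, p * v 0 k - q * w 0 k = 0) ->
  p *: v - q *: w = 0.
Proof. by move=> h; apply/rowP => k; rewrite !mxE h. Qed.

Lemma basis_combo (p q : R) : p *: basis_vec R 0 - q *: basis_vec R 1 = 0 -> q = 0.
Proof.
move=> /(congr1 (fun w : 'rV[R]_2 => w 0 1)); rewrite !mxE /= => /eqP.
by rewrite mulr0 mulr1 sub0r oppr_eq0 => /eqP.
Qed.

Lemma basis_vec0_neq0 : basis_vec R 0 != 0.
Proof.
apply/eqP => /(congr1 (fun w : 'rV[R]_2 => w 0 0)); rewrite !mxE /= => /eqP.
by rewrite oner_eq0.
Qed.

(** The curvatures in coordinates.  The Gram determinant is nonzero because the
    differential of an embedding is injective, and the second form is symmetric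
    because second derivatives commute; at a fixed time the embedding is smooth
    on an open set, so this holds at time 0 as well. *)
Lemma chart_data (A : set (chart R M)) (c : chart R M) (f : M -> 'rV[R]_3)
    (u : 'rV[R]_2) (n : 'rV[R]_3) (l1 l2 : R) :
  let F := local_rep c f in
  let a k := ('D_(basis_vec R 0) F u) 0 k in
  let b k := ('D_(basis_vec R 1) F u) 0 k in
  let saa k := ('D_(basis_vec R 0) (fun v => 'D_(basis_vec R 0) F v) u) 0 k in
  let sab k := ('D_(basis_vec R 0) (fun v => 'D_(basis_vec R 1) F v) u) 0 k in
  let sbb k := ('D_(basis_vec R 1) (fun v => 'D_(basis_vec R 1) F v) u) 0 k in
  let g11 := \sum_k a k * a k in let g12 := \sum_k a k * b k in
  let g22 := \sum_k b k * b k in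
  let h11 := - \sum_k saa k * n 0 k in let h12 := - \sum_k sab k * n 0 k in
  let h22 := - \sum_k sbb k * n 0 k in
  A c -> is_chart c -> smooth_embedding A f -> cimg c u ->
  outer_unit_normal A f (cinv c u) n ->
  principal_curvatures A f (cinv c u) n l1 l2 ->
  [/\ \sum_k a k * n 0 k = 0, \sum_k b k * n 0 k = 0 & \sum_k n 0 k * n 0 k = 1] /\
  [/\ g11 * g22 - g12 ^+ 2 != 0,
     (l1 + l2) * (g11 * g22 - g12 ^+ 2) = g22 * h11 - 2 * g12 * h12 + g11 * h22 &
     l1 * l2 * (g11 * g22 - g12 ^+ 2) = h11 * h22 - h12 ^+ 2].
Proof.
move=> F a b saa sab sbb g11 g12 g22 h11 h12 h22 Ac [odom oimg cK _ _] [_ sF iF] Uu.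
move=> [nn tn _] pc.
have [x dx ux] : exists2 x, cdom c x & cmap c x = u by case: Uu => x ? <-; exists x.
have xE : cinv c u = x by rewrite -ux cK.
rewrite xE in tn pc; have := tn c Ac dx; rewrite ux -/F => {}tn.
have := pc c Ac dx; rewrite ux -/F => {}pc.
have dF v : cimg c v -> differentiable F v.
  by move=> Uv; apply: smooth_on_differentiable oimg Uv (sF c Ac).
have DE v : 'D_v F u = 'd F u v by rewrite deriveE //; apply: dF.
have an : \sum_k a k * n 0 k = 0 by have := tn (basis_vec R 0); rewrite -DE.
have bn : \sum_k b k * n 0 k = 0 by have := tn (basis_vec R 1); rewrite -DE.
split; first by split.
have i0 v : 'd F u v = 0 -> v = 0.
  by move=> e; apply: (iF c u Ac Uu); rewrite e linear0.
have dg : g11 * g22 - g12 ^+ 2 != 0.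
  apply/eqP => g0.
  have z k : g12 * a k - g11 * b k = 0 by exact: gram_degenerate.
  have v0 : g12 *: basis_vec R 0 - g11 *: basis_vec R 1 = 0.
    apply: i0; transitivity (g12 *: 'd F u (basis_vec R 0) - g11 *: 'd F u (basis_vec R 1)).
      exact: linear_combo.
    rewrite -!DE.
    by apply: row_combo; exact: z.
  have g110 := basis_combo v0.
  move/eqP: basis_vec0_neq0; apply; apply: i0; rewrite -DE.
  have zk k : a k = 0.
    move/eqP: g110; rewrite psumr_eq0; last by move=> i _; rewrite -expr2 sqr_ge0.
    by move=> /allP/(_ k (mem_index_enum k))/=; rewrite -expr2 sqrf_eq0 => /eqP.
  by apply/rowP => k; rewrite [RHS]mxE; exact: zk.
pose g := first_form F u; pose h := second_form F n u.
have g00 : g 0 0 = g11 by exact: first_formE.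
have g01 : g 0 1 = g12 by exact: first_formE.
have g10 : g 1 0 = g12.
  apply: etrans (first_formE _ _ _ _) _; apply: eq_bigr => k _; exact: mulrC.
have g_11 : g 1 1 = g22 by exact: first_formE.
have h00 : h 0 0 = h11 by exact: second_formE.
have h01 : h 0 1 = h12 by exact: second_formE.
have h_11 : h 1 1 = h22 by exact: second_formE.
have smk k : smooth (cimg c) (fun v => F v 0 k).
  by apply: smooth_on_coord (sF c Ac).
have D2 i j k : ('D_(basis_vec R i) (fun v => 'D_(basis_vec R j) F v) u) 0 k =
    'D_(basis_vec R i) ('D_(basis_vec R j) (fun v => F v 0 k)) u.
  have nU := open_nbhs_nbhs (conj oimg Uu).
  have nD : \forall v \near u, ('D_(basis_vec R j) F v) 0 k =
      'D_(basis_vec R j) (fun v => F v 0 k) v.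
    by apply: filterS nU => v Uv; rewrite coord_derive //; apply: diff_derivable; exact: dF.
  rewrite -(near_eq_derive _ nD) -coord_derive //.
  apply/derivable_mxP => i' k'; rewrite (ord1 i').
  have : derivable ('D_(basis_vec R j) (fun v => F v 0 k')) u (basis_vec R i).
    by apply: diff_derivable; apply: smooth_differentiable Uu; apply: smooth_derive.
  apply: near_eq_derivable; apply: filterS nU => v Uv.
  by rewrite -coord_derive //; apply: diff_derivable; exact: dF.
have sba k : ('D_(basis_vec R 1) (fun v => 'D_(basis_vec R 0) F v) u) 0 k = sab k.
  apply: etrans (D2 1 0 k) (etrans _ (esym (D2 0 1 k))).
  exact: derive_comm oimg (smk k) Uu.
have h10 : h 1 0 = h12.
  apply: etrans (second_formE _ _ _ _ _) _; apply: (congr1 -%R).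
  apply: eq_bigr => k _; exact: (congr1 (fun z => z * n 0 k) (sba k)).
have dgE : \det g = g11 * g22 - g12 ^+ 2 by rewrite det_mx22 g00 g01 g10 g_11 expr2.
have := @pencil_roots R g h l1 l2; rewrite dgE => /(_ dg pc).
rewrite g00 g01 g10 g_11 h00 h01 h10 h_11 => -[e1 e2]; split; first exact: dg.
  rewrite e1; clear -e1; move: (g11) (g12) (g22) (h11) (h12) (h22) => x y z x' y' z'; ring.
by rewrite e2 expr2.
Qed.

End ChartData.

(** * Continuity of the pinching function *)

Section RelativeContinuity.
Context {R : realType} {T : topologicalType}.
Implicit Types (D : set T) (p : T).

Definition cont_within (S : topologicalType) D p (f : T -> S) : Prop :=
  f @ within D (nbhs p) --> f p.

Lemma cont_within_ext (S : topologicalType) D p (f g : T -> S) : D p ->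
  (forall q, D q -> f q = g q) -> cont_within D p f -> cont_within D p g.
Proof.
move=> Dp fg; rewrite /cont_within -(fg p Dp); apply: cvg_trans; apply: near_eq_cvg.
by rewrite near_withinE; near=> q => Dq; apply: fg.
Unshelve. all: by end_near. Qed.

Variables (D : set T) (p : T).
Implicit Types f g : T -> R.
Local Notation cw := (cont_within D p).

Lemma cont_within_cst (c : R) : cw (fun _ => c). Proof. exact: cvg_cst. Qed.

Lemma cont_withinD f g : cw f -> cw g -> cw (fun q => f q + g q).
Proof. exact: cvgD. Qed.

Lemma cont_withinN f : cw f -> cw (fun q => - f q). Proof. exact: cvgN. Qed.

Lemma cont_withinM f g : cw f -> cw g -> cw (fun q => f q * g q).
Proof. exact: cvgM. Qed.

Lemma cont_withinV f : f p != 0 -> cw f -> cw (fun q => (f q)^-1).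
Proof. exact: cvgV. Qed.

Lemma cont_within_sqrt f : cw f -> cw (fun q => Num.sqrt (f q)).
Proof.
by move=> cf; exact: (continuous_cvg _ (@sqrt_continuous R (f p)) cf).
Qed.

Lemma cont_within_sum (I : Type) (r : seq I) (f : I -> T -> R) : (forall k, cw (f k)) ->
  cw (fun q => \sum_(k <- r) f k q).
Proof.
move=> cf; elim: r => [|k r IH].
  have -> : (fun q => \sum_(k <- [::]) f k q) = (fun _ => 0).
    by apply/funext => q; rewrite big_nil.
  exact: cont_within_cst.
have -> : (fun q => \sum_(k <- k :: r) f k q) = (fun q => f k q + \sum_(k <- r) f k q).
  by apply/funext => q; rewrite big_cons.
exact: cont_withinD.
Qed.

Lemma cont_within_dot (u v : 'I_3 -> T -> R) : (forall k, cw (u k)) -> (forall k, cw (v k)) ->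
  cw (fun q => \sum_k u k q * v k q).
Proof. by move=> cu cv; apply: cont_within_sum => k; apply: cont_withinM. Qed.

Lemma cont_within_coord n (f : T -> 'rV[R]_n) k : cont_within D p f -> cw (fun q => f q 0 k).
Proof.
by move=> cf; exact: (continuous_cvg _ (@coord_continuous _ _ _ 0 k (f p)) cf).
Qed.

(** [pinch] in terms of the sum and the product of the curvatures.  These depend
    continuously on the point, whereas the curvatures in their given order need
    not. *)
Definition pinch_HK (H K : R) : R :=
  H * H * H * (H * H + - (4 * K)) * (2 * (H * H + - (2 * K)) * K)^-1.

Lemma pinch_HKE (la mu : R) : pinch_HK (la + mu) (la * mu) = pinch la mu.
Proof. by rewrite /pinch_HK /pinch; congr (_ / _); ring. Qed.

Lemma cont_within_pinch (la mu : T -> R) : 0 < la p -> 0 < mu p ->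
  cw (fun q => la q + mu q) -> cw (fun q => la q * mu q) ->
  cw (fun q => pinch (la q) (mu q)).
Proof.
move=> la0 mu0 cH cK.
have -> : (fun q => pinch (la q) (mu q)) = (fun q => pinch_HK (la q + mu q) (la q * mu q)).
  by apply/funext => q; rewrite pinch_HKE.
have c2 : cw (fun q => (la q + mu q) * (la q + mu q)) by exact: cont_withinM.
rewrite /pinch_HK; apply: cont_withinM.
  apply: cont_withinM; first by apply: cont_withinM.
  by apply: cont_withinD => //; apply: cont_withinN; apply: cont_withinM => //; exact: cont_within_cst.
apply: cont_withinV; last first.
  apply: cont_withinM => //; apply: cont_withinM; first exact: cont_within_cst.
  by apply: cont_withinD => //; apply: cont_withinN; apply: cont_withinM => //; exact: cont_within_cst.
have -> : (la p + mu p) * (la p + mu p) + - (2 * (la p * mu p)) = la p * la p + mu p * mu p.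
  by ring.
apply: lt0r_neq0; apply: mulr_gt0; last exact: mulr_gt0.
by apply: mulr_gt0 => //; apply: addr_gt0; exact: mulr_gt0.
Qed.

Lemma cont_within_pinch_curvatures (u v a b c : 'I_3 -> T -> R) (n : T -> 'I_3 -> R) (la mu : T -> R) : D p ->
  let g11 q := \sum_k u k q * u k q in let g12 q := \sum_k u k q * v k q in
  let g22 q := \sum_k v k q * v k q in
  let h11 q := - \sum_k a k q * n q k in let h12 q := - \sum_k b k q * n q k in
  let h22 q := - \sum_k c k q * n q k in
  (forall k, cw (u k)) -> (forall k, cw (v k)) -> (forall k, cw (a k)) ->
  (forall k, cw (b k)) -> (forall k, cw (c k)) ->
  (forall q, D q -> [/\ \sum_k u k q * n q k = 0, \sum_k v k q * n q k = 0 &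
      \sum_k n q k * n q k = 1] /\
    [/\ g11 q * g22 q - g12 q ^+ 2 != 0,
     (la q + mu q) * (g11 q * g22 q - g12 q ^+ 2) =
       g22 q * h11 q - 2 * g12 q * h12 q + g11 q * h22 q &
     la q * mu q * (g11 q * g22 q - g12 q ^+ 2) = h11 q * h22 q - h12 q ^+ 2]) ->
  (forall q, D q -> 0 < la q /\ 0 < mu q) ->
  cw (fun q => pinch (la q) (mu q)).
Proof.
move=> Dp g11 g12 g22 h11 h12 h22 cu cv ca cb cc geo pos.
have cg11 : cw g11 by exact: cont_within_dot.
have cg12 : cw g12 by exact: cont_within_dot.
have cg22 : cw g22 by exact: cont_within_dot.
pose N k q := cross (u^~ q) (v^~ q) k.
have cN k : cw (N k) by apply: cont_withinD; first exact: cont_withinM; apply: cont_withinN; exact: cont_withinM.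
pose La q := \sum_k a k q * N k q.
pose Lb q := \sum_k b k q * N k q.
pose Lc q := \sum_k c k q * N k q.
have cLa : cw La by exact: cont_within_dot.
have cLb : cw Lb by exact: cont_within_dot.
have cLc : cw Lc by exact: cont_within_dot.
pose Dt q := g11 q * g22 q + - (g12 q * g12 q).
have DtE q : Dt q = g11 q * g22 q - g12 q ^+ 2 by rewrite /Dt expr2.
have cDt : cw Dt by apply: cont_withinD; [exact: cont_withinM|apply: cont_withinN; exact: cont_withinM].
pose Tr q := - (g22 q * La q + - (2 * g12 q * Lb q) + g11 q * Lc q).
have cTr : cw Tr.
  apply: cont_withinN; apply: cont_withinD; last exact: cont_withinM.
  apply: cont_withinD; first exact: cont_withinM.
  by apply: cont_withinN; apply: cont_withinM => //; apply: cont_withinM => //; exact: cont_within_cst.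
have facts q : D q -> [/\ 0 < Dt q,
    la q + mu q = Num.sqrt (Dt q) * Num.sqrt (Tr q * Tr q) * (Dt q * Dt q)^-1 &
    la q * mu q = (La q * Lc q + - (Lb q * Lb q)) * (Dt q * Dt q)^-1].
  move=> Dq; have [[un vn nn] [D0 hH hK]] := geo q Dq; have [la0 mu0] := pos q Dq.
  have := @curvatures_from_cross R (u^~ q) (v^~ q) (n q) (a^~ q) (b^~ q) (c^~ q) (la q) (mu q).
  rewrite DtE -!expr2 => h.
  have [|||||||d0 _ _ e1 e2] := h.
  - exact: un.
  - exact: vn.
  - exact: nn.
  - exact: D0.
  - exact: hH.
  - by rewrite hK /h11 /h12 /h22 mulrNN sqrrN.
  - exact: addr_gt0.
  - by split.
have [la0 mu0] := pos p Dp.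
have [D1 _ _] := facts p Dp.
have cV : cw (fun q => (Dt q * Dt q)^-1).
  by apply: cont_withinV; [rewrite mulf_neq0 // gt_eqF|exact: cont_withinM].
apply: cont_within_pinch => //.
  apply: (@cont_within_ext _ D p (fun q => Num.sqrt (Dt q) * Num.sqrt (Tr q * Tr q) * (Dt q * Dt q)^-1)) => //.
    by move=> q /facts[].
  by apply: cont_withinM => //; apply: cont_withinM; apply: cont_within_sqrt => //; exact: cont_withinM.
apply: (@cont_within_ext _ D p (fun q => (La q * Lc q + - (Lb q * Lb q)) * (Dt q * Dt q)^-1)) => //.
  by move=> q /facts[].
by apply: cont_withinM => //; apply: cont_withinD; [exact: cont_withinM|apply: cont_withinN; exact: cont_withinM].
Qed.

End RelativeContinuity.

Section SliceContinuity.
Context {R : realType} {E F : normedModType R}.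
Variables (U : set E) (I : set R) (f : (E * R)%type -> F).
Hypotheses (oU : open U) (sf : smooth_on (U `*` I) f).
Let D : set (E * R)%type := U `*` I.

Lemma cont_within_slice_derive v p : D p ->
  cont_within D p (fun q => 'D_v (fun y => f (y, q.2)) q.1).
Proof.
move=> Dp; have [df [hd hc]] := sf 1%N.
have /subspace_continuousP c := hc (v, 0).
apply: cont_within_ext (c p Dp) => //.
move=> [u t] [Uu It]; symmetry.
exact: (slice_derive v oU Uu It (hd (u, t) (conj Uu It))).
Qed.

Lemma cont_within_slice_derive2 v w p : D p ->
  cont_within D p (fun q => 'D_v (fun z => 'D_w (fun y => f (y, q.2)) z) q.1).
Proof.
move=> Dp; have [df [hd hc]] := sf 2.
have [df2 [hd2 hc2]] := hc (w, 0).
have /subspace_continuousP c := hc2 (v, 0).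
apply: cont_within_ext (c p Dp) => //.
move=> [u t] [Uu It]; symmetry => /=.
apply: etrans _ (slice_derive v oU Uu It (hd2 (u, t) (conj Uu It))).
apply: near_eq_derive; apply: filterS (open_nbhs_nbhs (conj oU Uu)) => z Uz.
exact: (slice_derive w oU Uz It (hd (z, t) (conj Uz It))).
Qed.

End SliceContinuity.

(** * The flow in a chart *)

Lemma congr6 (T1 T2 : Type) (f : T1 -> T1 -> T1 -> T1 -> T1 -> T1 -> T2) x1 x2 x3 x4 x5 x6 y1 y2 y3 y4 y5 y6 :
  x1 = y1 -> x2 = y2 -> x3 = y3 -> x4 = y4 -> x5 = y5 -> x6 = y6 ->
  f x1 x2 x3 x4 x5 x6 = f y1 y2 y3 y4 y5 y6.
Proof. by move=> -> -> -> -> -> ->. Qed.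

Section Flow.
Context {R : realType} {M : topologicalType}.
Variables (A : set (chart R M)) (T : R) (X : M -> R -> 'rV[R]_3) (nu : M -> R -> 'rV[R]_3).
Variables (lambda1 lambda2 : M -> R -> R).
Hypothesis hA : smooth_atlas A.
Hypothesis hX : smooth_family A T X.
Hypothesis hnu : forall (x : M) (t : R), t \in `[0, T[ ->
  outer_unit_normal A (X ^~ t) x (nu x t).
Hypothesis hlambda : forall (x : M) (t : R), t \in `[0, T[ ->
  principal_curvatures A (X ^~ t) x (nu x t) (lambda1 x t) (lambda2 x t).
Hypothesis hconvex : forall (x : M) (t : R), t \in `[0, T[ ->
  0 < lambda1 x t /\ 0 < lambda2 x t.
Hypothesis hflow : forall (x : M) (t : R), t \in `[0, T[ ->
  time_derivative T (X x) t (- ((lambda1 x t + lambda2 x t) ^+ 2 *: nu x t)).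

Definition pinching (x : M) (t : R) : R := pinch (lambda1 x t) (lambda2 x t).

Let Phi (c : chart R M) (q : ('rV[R]_2 * R)%type) : 'rV[R]_3 := X (cinv c q.1) q.2.

Lemma pinching_chart_cont c q : A c -> (cimg c `*` `[0, T[) q ->
  cont_within (cimg c `*` `[0, T[) q (fun q => pinching (cinv c q.1) q.2).
Proof.
move=> Ac Dq; have [hc _ _] := hA; have [odom oimg _ _ _] := hc c Ac.
have sP : smooth_on (cimg c `*` `[0, T[) (Phi c) by apply: hX.1.
pose b i := basis_vec R i.
pose e k (q : ('rV[R]_2 * R)%type) := ('D_(b 0) (fun y => Phi c (y, q.2)) q.1) 0 k.
pose f k (q : ('rV[R]_2 * R)%type) := ('D_(b 1) (fun y => Phi c (y, q.2)) q.1) 0 k.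
pose s i j k (q : ('rV[R]_2 * R)%type) :=
  ('D_(b i) (fun z => 'D_(b j) (fun y => Phi c (y, q.2)) z) q.1) 0 k.
apply: (@cont_within_pinch_curvatures _ _ _ _ e f (s 0 0) (s 0 1) (s 1 1) (fun q k => nu (cinv c q.1) q.2 0 k)) => //.
- by move=> k; apply: cont_within_coord; exact: cont_within_slice_derive.
- by move=> k; apply: cont_within_coord; exact: cont_within_slice_derive.
- by move=> k; apply: cont_within_coord; exact: cont_within_slice_derive2.
- by move=> k; apply: cont_within_coord; exact: cont_within_slice_derive2.
- by move=> k; apply: cont_within_coord; exact: cont_within_slice_derive2.
- move=> [u t] [/= Uu It].
  exact: (chart_data Ac (hc c Ac) (hX.2 t It) Uu (@hnu _ _ It) (@hlambda _ _ It)).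
- by move=> [u t] [/= Uu It]; exact: hconvex.
Qed.

Lemma pinching_cont (x : M) (t : R) : t \in `[0, T[ ->
  cont_within ([set: M] `*` `[0, T[) (x, t) (fun z : (M * R)%type => pinching z.1 z.2).
Proof.
move=> It; have [hc hcov _] := hA; have [c Ac cx] := hcov x.
have [odom oimg cK cm _] := hc c Ac.
have Uu : cimg c (cmap c x) by exists x.
have := @pinching_chart_cont c (cmap c x, t) Ac (conj Uu It).
rewrite /cont_within /= cK // => cp.
have cmx : cmap c @ x --> cmap c x.
  move/subspace_continuousP: cm => /(_ x cx) h B /h; rewrite /= nbhs_simpl /within /= => hB.
  by apply: filterS2 (open_nbhs_nbhs (conj odom cx)) hB => y cy; apply.
have n1 : \forall z \near ((x, t) : (M * R)%type), cdom c z.1.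
  exact: (cvg_fst (open_nbhs_nbhs (conj odom cx))).
have cpair : (fun z : (M * R)%type => (cmap c z.1, z.2)) @
    within ([set: M] `*` `[0, T[) (nbhs (x, t)) -->
    within (cimg c `*` `[0, T[) (nbhs (cmap c x, t)).
  have c0 : (fun z : (M * R)%type => (cmap c z.1, z.2)) @ (x, t) --> (cmap c x, t).
    apply: (@cvg_pair _ _ _ (nbhs (x, t)) (nbhs (cmap c x)) (nbhs t)); last exact: cvg_snd.
    exact: (cvg_comp _ _ cvg_fst cmx).
  move=> B /c0; rewrite /= !nbhs_simpl /within /= => hB.
  apply: filterS2 n1 hB => z cz hz [_ Iz]; apply: hz; split=> //.
  by exists z.1.
have := cvg_comp _ _ cpair cp; apply: cvg_trans; apply: near_eq_cvg.
rewrite near_withinE; apply: filterS n1 => z cz _.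
by rewrite /= cK.
Qed.

Lemma flow_velocity c u t : A c -> cimg c u -> t \in `]0, T[ ->
  derivable (Phi c) (u, t) (0, 1) ->
  'D_(0, 1) (Phi c) (u, t) =
  - ((lambda1 (cinv c u) t + lambda2 (cinv c u) t) ^+ 2 *: nu (cinv c u) t).
Proof.
move=> Ac Uu It d.
have It' : t \in `[0, T[ by move: It; rewrite !in_itv /= => /andP[/ltW -> ->].
have h := @hflow (cinv c u) t It'; rewrite /time_derivative in h.
apply/cvg_lim => //; apply: cvg_trans h.
have nI : \forall k \near (0 : R), t + k \in `[0, T[.
  have /nbhs_ballP[r r0 hr] : nbhs t [set` `]0, T[].
    by apply: open_nbhs_nbhs; split; [exact: interval_open|exact: It].
  apply/nbhs_ballP; exists r => // k; rewrite /ball /= sub0r normrN => kr.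
  have : (t + k) \in `]0, T[ by apply: hr; rewrite /ball /= opprD addNKr normrN.
  by rewrite !in_itv /= => /andP[/ltW -> ->].
move=> B /=; rewrite !nbhs_simpl /= => hB.
rewrite /within /= in hB; rewrite /dnbhs /within /=.
move: hB; rewrite /dnbhs /within /= => hB.
apply: filterS2 nI hB => k Ik hk k0; have := hk k0 Ik.
by rewrite /Phi /= scaler0 add0r [k *: 1]mulr1 [k + t]addrC.
Qed.

(** At a spatial maximum that is not umbilic the speed is at most zero, by
    [local_speed] in a chart around [x].  Along straight lines of the chart [w]
    takes values of [pinching] at the same time, so the global maximum is a
    maximum along every such line. *)
Lemma pinching_growth (x : M) (t eps : R) : t \in `]0, T[ ->
  lambda1 x t != lambda2 x t ->
  (forall y, pinching y t <= pinching x t) ->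
  (exists2 d : R, 0 < d & forall h, 0 < h < d -> pinching x (t - h) <= pinching x t - eps * h) ->
  eps <= 0.
Proof.
move=> It l12 wmax [d d0 hd]; have [hc hcov _] := hA; have [c Ac cx] := hcov x.
have [odom oimg cK _ _] := hc c Ac.
have Uu : cimg c (cmap c x) by exists x.
pose O : set ('rV[R]_2 * R)%type := cimg c `*` `]0, T[.
have oI : open [set` `]0, T[] by exact: interval_open.
have oO : open O.
  rewrite openE => q [U1 I1]; exists (cimg c, [set` `]0, T[]); last by move=> z [].
  by split; apply: open_nbhs_nbhs; split.
have sub (s : R) : s \in `]0, T[ -> s \in `[0, T[.
  by rewrite !in_itv /= => /andP[/ltW -> ->].
have OD : O `<=` cimg c `*` `[0, T[ by move=> q [U1 I1]; split=> //; exact: sub.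
pose p : ('rV[R]_2 * R)%type := (cmap c x, t).
have Op : O p by split.
have sP : smooth_on (cimg c `*` `[0, T[) (Phi c) by apply: hX.1.
have sPO k : smooth O (fun q => Phi c q 0 k) by exact: smooth_on_coord sP.
pose b i : ('rV[R]_2 * R)%type := (basis_vec R i, 0).
have slice (W : normedModType R) (F : ('rV[R]_2 * R)%type -> W) (v : 'rV[R]_2) (q : ('rV[R]_2 * R)%type) :
    'D_(v, 0) F q = 'D_v (fun y => F (y, q.2)) q.1.
  have e : (fun h : R => h^-1 *: ((F \o shift q) (h *: ((v, 0) : ('rV[R]_2 * R)%type)) - F q)) =
      (fun h : R => h^-1 *: (((fun y => F (y, q.2)) \o shift q.1) (h *: v) - F (q.1, q.2))).
    apply/funext => h; case: q => u s /=; congr (_ *: (F _ - _)).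
    by apply/pair_equal_spec; rewrite /= scaler0 add0r.
  by rewrite /derive e.
have dP q v : O q -> derivable (Phi c) q v.
  move=> Oq; apply/derivable_mxP => i k; rewrite (ord1 i).
  by apply: diff_derivable; exact: smooth_differentiable (sPO k) Oq.
have first_c i k q : O q -> 'D_(b i) (fun q => Phi c q 0 k) q =
    ('D_(basis_vec R i) (local_rep c (X^~ q.2)) q.1) 0 k.
  by move=> Oq; rewrite coord_derive; [rewrite slice|exact: dP].
have second_c i j k q : O q -> 'D_(b i) ('D_(b j) (fun q => Phi c q 0 k)) q =
    ('D_(basis_vec R i) (fun v => 'D_(basis_vec R j) (local_rep c (X^~ q.2)) v) q.1) 0 k.
  move=> Oq.
  pose G q : 'rV[R]_3 := 'D_(b j) (Phi c) q.
  have GE k' q' : O q' -> G q' 0 k' = 'D_(b j) (fun q => Phi c q 0 k') q'.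
    by move=> Oq'; rewrite (coord_derive k' (dP q' (b j) Oq')).
  have nG k' : \forall q' \near q, 'D_(b j) (fun q => Phi c q 0 k') q' = G q' 0 k'.
    by apply: filterS (open_nbhs_nbhs (conj oO Oq)) => q' Oq'; rewrite GE.
  have dG : derivable G q (b i).
    apply/derivable_mxP => i' k'; rewrite (ord1 i').
    apply: (near_eq_derivable (nG k')).
    by apply: diff_derivable; apply: smooth_differentiable Oq; exact: smooth_derive.
  have GS : (fun y => G (y, q.2)) = (fun v => 'D_(basis_vec R j) (local_rep c (X^~ q.2)) v).
    by apply/funext => v; exact: slice.
  apply: etrans (near_eq_derive (b i) (nG k)) _; apply: etrans (coord_derive k dG) _.
  by rewrite (slice _ G (basis_vec R i) q) GS.
pose la q := lambda1 (cinv c q.1) q.2; pose mu (q : ('rV[R]_2 * R)%type) := lambda2 (cinv c q.1) q.2.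
have data q : O q -> _ := fun Oq => chart_data Ac (hc c Ac) (hX.2 q.2 (sub _ Oq.2)) Oq.1
   (@hnu _ _ (sub _ Oq.2)) (@hlambda _ _ (sub _ Oq.2)).
have sum_eq (f g f' g' : 'I_3 -> R) : f =1 f' -> g =1 g' ->
    \sum_k f k * g k = \sum_k f' k * g' k.
  by move=> ff gg; apply: eq_bigr => k _; rewrite ff gg.
have f0 q (Oq : O q) := fun k => first_c 0 k q Oq.
have f1 q (Oq : O q) := fun k => first_c 1 k q Oq.
have s00 q (Oq : O q) := fun k => second_c 0 0 k q Oq.
have s01 q (Oq : O q) := fun k => second_c 0 1 k q Oq.
have s11 q (Oq : O q) := fun k => second_c 1 1 k q Oq.
pose n (q : ('rV[R]_2 * R)%type) k := nu (cinv c q.1) q.2 0 k.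
have rn q : n q =1 n q by [].
have tr q (Oq : O q) (f : R -> R -> R -> R -> R -> R -> Prop) := congr6 f
  (sum_eq _ _ _ _ (f0 q Oq) (f0 q Oq)) (sum_eq _ _ _ _ (f0 q Oq) (f1 q Oq))
  (sum_eq _ _ _ _ (f1 q Oq) (f1 q Oq))
  (congr1 -%R (sum_eq _ _ _ _ (s00 q Oq) (rn q)))
  (congr1 -%R (sum_eq _ _ _ _ (s01 q Oq) (rn q)))
  (congr1 -%R (sum_eq _ _ _ _ (s11 q Oq) (rn q))).
have [dw Dw] : derivable (fun q => pinch (la q) (mu q)) p (0, 1) /\
    'D_(0, 1) (fun q => pinch (la q) (mu q)) p <= 0.
  apply: (@local_speed _ _ O p (b 0) (b 1) (0, 1) (fun k q => Phi c q 0 k)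
    (fun q k => nu (cinv c q.1) q.2 0 k)) => //.
  - move=> q Oq; have [[e1 e2 e3] _] := data q Oq; split=> //.
      by rewrite -[RHS]e1; apply: eq_bigr => k _; rewrite first_c.
    by rewrite -[RHS]e2; apply: eq_bigr => k _; rewrite first_c.
  - move=> q Oq; have [_ [e4 _ _]] := data q Oq.
    have := tr q Oq (fun x y z _ _ _ => x * z - y ^+ 2 != 0).
    by move=> /= e; rewrite e; exact: e4.
  - move=> q Oq; have [_ [_ e5 _]] := data q Oq.
    have := tr q Oq (fun x y z x' y' z' =>
      (la q + mu q) * (x * z - y ^+ 2) = z * x' - 2 * y * y' + x * z').
    by move=> /= e; rewrite e; exact: e5.
  - move=> q Oq; have [_ [_ _ e6]] := data q Oq.
    have := tr q Oq (fun x y z x' y' z' =>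
      la q * mu q * (x * z - y ^+ 2) = x' * z' - y' ^+ 2).
    by move=> /= e; rewrite e; exact: e6.
  - by move=> q Oq; apply: hconvex; exact: sub Oq.2.
  - move=> q k Oq; rewrite coord_derive; last exact: dP.
    case: q Oq => u s Oq; rewrite flow_velocity //; [|exact: Oq.1|exact: Oq.2|exact: dP].
    by rewrite !mxE.
  - by rewrite /la /mu /= cK.
  - move=> a b'; exists 1 => // h _; rewrite /la /mu /= cK //.
    have -> : t + h * (a * 0 + b' * 0) = t by rewrite !mulr0 addr0 mulr0 addr0.
    exact: wmax.
apply: le_trans Dw; apply: derive_growth => //.
exists d => // h hh; rewrite /la /mu /= cK // scaler0 subr0 cK // [h *: 1]mulr1.
exact: hd.
Qed.

End Flow.

(** * The maximum principle *)

Section MaximumPrinciple.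
Context {R : realType} {M : topologicalType}.

Lemma slice_max (W : M -> R -> R) (T t : R) : [set: M] !=set0 -> compact [set: M] ->
  (forall x, cont_within ([set: M] `*` `[0, T[) (x, t) (fun z : (M * R)%type => W z.1 z.2)) ->
  t \in `[0, T[ -> exists m, is_max (range (W^~ t)) m.
Proof.
move=> M0 cM cW It.
have c : {within [set: M], continuous (W^~ t)}.
  apply/subspace_continuousP => x _.
  have cp : (fun y : M => (y, t)) @ within [set: M] (nbhs x) -->
     within ([set: M] `*` `[0, T[) (nbhs ((x, t) : (M * R)%type)).
    move=> B [[B1 B2] /= [n1 n2] hB]; rewrite /= nbhs_simpl /within /=.
    apply: filterS n1 => y By _; apply: hB; first by split=> //=; exact: nbhs_singleton n2.
    by split.
  exact: cvg_comp _ _ cp (cW x).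
have [x _ hx] := compact_EVT_max M0 cM c.
by exists (W x t); split; [exists x|move=> _ [y _ <-]; apply: hx; rewrite inE].
Qed.

(** If [m] grew, the maximum of [W - eps * t] over a time interval would be a spatial
    maximum that grows with speed [eps] and has a smaller value in its past.  The
    latter gives a lower bound at the maximum; for a nonnegative [W] it shows that
    the maximum is positive. *)
Lemma max_nonincreasing (W : M -> R -> R) (T : R) (m : R -> R) :
  compact [set: M] ->
  (forall x t, t \in `[0, T[ ->
     cont_within ([set: M] `*` `[0, T[) (x, t) (fun z : (M * R)%type => W z.1 z.2)) ->
  (forall t, t \in `[0, T[ -> is_max (range (W^~ t)) (m t)) ->
  (forall x t eps, t \in `]0, T[ -> 0 < eps ->
     (exists2 s, s \in `[0, T[ & W x s < W x t) ->
     (forall y, W y t <= W x t) ->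
     (exists2 d : R, 0 < d & forall h, 0 < h < d -> W x (t - h) <= W x t - eps * h) ->
     False) ->
  {in `[0, T[ &, nonincreasing_fun m}.
Proof.
move=> cM cW mmax no_increase t1 t2 I1 I2 t12; rewrite leNgt; apply/negP => m12.
have lt12 : t1 < t2.
  by rewrite lt_neqAle t12 andbT; apply: contraTneq m12 => ->; rewrite ltxx.
have [t10 t1T] : 0 <= t1 /\ t1 < T by move: I1; rewrite in_itv /= => /andP[].
have [t20 t2T] : 0 <= t2 /\ t2 < T by move: I2; rewrite in_itv /= => /andP[].
have [[x1 _ ex1] ub1] := mmax t1 I1; have [[x2 _ ex2] ub2] := mmax t2 I2.
have dm : 0 < m t2 - m t1 by rewrite subr_gt0.
have dt : 0 < t2 - t1 by rewrite subr_gt0.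
(* half the mean slope of [m], so that tilting by [eps] keeps time [t2] above [t1] *)
pose eps := (m t2 - m t1) / (2 * (t2 - t1)).
have eps0 : 0 < eps by rewrite divr_gt0 // mulr_gt0.
have epsE : eps * (t2 - t1) = (m t2 - m t1) / 2.
  by rewrite /eps; field; rewrite gt_eqF.
pose f (z : (M * R)%type) := W z.1 z.2 - eps * z.2.
pose K : set (M * R)%type := [set: M] `*` `[t1, t2].
have K0 : K !=set0 by exists (x1, t1); split=> //=; rewrite in_itv /= lexx.
have cK : compact K by apply: compact_setX => //; exact: segment_compact.
have sub s : s \in `[t1, t2] -> s \in `[0, T[.
  rewrite !in_itv /= => /andP[h1 h2].
  by rewrite (le_trans t10 h1) (le_lt_trans h2 t2T).
have cf : {within K, continuous f}.
  apply/subspace_continuousP => -[x s] [_ Is].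
  have h := cW x s (sub s Is).
  have KD : within K (nbhs ((x, s) : (M * R)%type)) `=>`
      within ([set: M] `*` `[0, T[) (nbhs ((x, s) : (M * R)%type)).
    move=> B; rewrite /within /=; apply: filterS => z hz [_ Iz].
    by apply: hz; split=> //; exact: sub.
  apply: cvgB; first exact: (fun B hB => KD _ (h B hB)).
  apply: cvgM; first exact: cvg_cst.
  exact: (cvg_within_filter _ cvg_snd).
have [[x0 t0] + hmax] := compact_EVT_max K0 cK cf.
rewrite inE => -[_ It0']; have It0 : t0 \in `[t1, t2] := It0'.
have {}hmax y s : s \in `[t1, t2] -> W y s - eps * s <= W x0 t0 - eps * t0.
  by move=> Is; have := hmax (y, s); rewrite inE; apply; split.
have It1 : t1 \in `[t1, t2] by rewrite in_itv /= lexx.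
have It2 : t2 \in `[t1, t2] by rewrite in_itv /= lexx ltW.
have big : m t1 - eps * t1 < W x0 t0 - eps * t0.
  have := hmax x2 t2 It2; rewrite ex2; apply: lt_le_trans.
  have : (m t2 - m t1) / 2 < m t2 - m t1 by exact: half_lt.
  rewrite -epsE mulrBr; lra.
have t01 : t1 < t0.
  have := It0; rewrite in_itv /= => /andP[h _]; rewrite lt_neqAle h andbT.
  apply: contraTneq big => <-; rewrite -leNgt lerD2r.
  by apply: ub1; exists x0.
have t02 : t0 <= t2 by move: It0; rewrite in_itv /= => /andP[].
apply: (no_increase x0 t0 eps) => //.
- by rewrite in_itv /= (le_lt_trans t10 t01) (le_lt_trans t02 t2T).
- exists t1 => //.
  have h1 : W x0 t1 <= m t1 by apply: ub1; exists x0.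
  have h2 : eps * t1 < eps * t0 by rewrite ltr_pM2l.
  by move: big h1 h2; lra.
- by move=> y; have := hmax y t0 It0; rewrite lerD2r.
- exists (t0 - t1); first by rewrite subr_gt0.
  move=> h /andP[h0 h1].
  have Ih : t0 - h \in `[t1, t2].
    rewrite in_itv /=; apply/andP; split; last by apply: le_trans t02; rewrite lerBlDr lerDl ltW.
    by rewrite lerBrDr -lerBrDl ltW.
  by have := hmax x0 _ Ih; rewrite mulrBr; lra.
Qed.

End MaximumPrinciple.

Theorem theorem6p2 (R : realType) (M : topologicalType) (A : set (chart R M))
    (T : R) (X : M -> R -> 'rV[R]_3) (nu : M -> R -> 'rV[R]_3)
    (lambda1 lambda2 : M -> R -> R)
    (hM : closed_surface A) (hT : 0 < T)
    (hX : smooth_family A T X)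
    (hnu : forall (x : M) (t : R), t \in `[0, T[ ->
      outer_unit_normal A (X ^~ t) x (nu x t))
    (hlambda : forall (x : M) (t : R), t \in `[0, T[ ->
      principal_curvatures A (X ^~ t) x (nu x t) (lambda1 x t) (lambda2 x t))
    (hconvex : forall (x : M) (t : R), t \in `[0, T[ ->
      0 < lambda1 x t /\ 0 < lambda2 x t)
    (hflow : forall (x : M) (t : R), t \in `[0, T[ ->
      time_derivative T (X x) t
        (- ((lambda1 x t + lambda2 x t) ^+ 2 *: nu x t))) :
  exists m : R -> R,
    (forall t : R, t \in `[0, T[ ->
      is_max (range (fun x : M =>
        ((lambda1 x t + lambda2 x t) ^+ 3 * (lambda1 x t - lambda2 x t) ^+ 2) /
        (2 * (lambda1 x t ^+ 2 + lambda2 x t ^+ 2)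
           * lambda1 x t * lambda2 x t))) (m t)) /\
    {in `[0, T[ &, nonincreasing_fun m}.
Proof.
have [M0 _ cM _ hA] := hM.
pose W := pinching lambda1 lambda2.
have cW x t : t \in `[0, T[ ->
    cont_within ([set: M] `*` `[0, T[) (x, t) (fun z : (M * R)%type => W z.1 z.2).
  by move=> It; apply: (pinching_cont hA hX hnu hlambda hconvex).
have max_ex t : exists m, t \in `[0, T[ -> is_max (range (W^~ t)) m.
  have [It|nIt] := boolP (t \in `[0, T[); last by exists 0.
  by have [m hm] := slice_max M0 cM (fun x => cW x t It) It; exists m.
have [m hm] := choice max_ex.
exists m; split; first exact: hm.
apply: (max_nonincreasing cM cW hm) => x t eps It eps0 [s Is hs] wmax growth.
have It' : t \in `[0, T[ by move: It; rewrite !in_itv /= => /andP[/ltW -> ->].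
suff : eps <= 0 by rewrite leNgt eps0.
apply: (pinching_growth hA hX hnu hlambda hconvex hflow It _ wmax growth).
apply: contraTneq hs => e; rewrite -leNgt.
have -> : W x t = 0 by rewrite /W /pinching /pinch e subrr expr0n /= mulr0 mul0r.
have [/ltW l1 /ltW l2] := hconvex x s Is.
exact: pinch_ge0.

Qed.
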